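(* Let $h_2(z)=\eta^2(z)\eta^2(2z)$, and let $\nu_\pm$ be the multiplier systems on $\Gamma^*(2)$ defined below. (a) For every integer $d>0$ with $d\equiv1\pmod4$ and each choice of sign there is a unique form $f_d^{\pm}=q^{-d/4}+\sum_{n>0,\ n\equiv3\bmod4}a_d^\pm(n)q^{n/4}\in M_2^!(\Gamma^*(2),\bar\nu_\pm)$. (b) For every integer $d>0$ with $d\equiv3\pmod4$ there are unique forms $f_d^{+}=q^{-d/4}+\sum_{n>0,\ n\equiv1\bmod4}a_d^+(n)q^{n/4}\in M_2^!(\Gamma^*(2),\nu_+)$ and $f_d^{-}=q^{-d/4}+\sum_{n\ge5,\ n\equiv1\bmod4}a_d^-(n)q^{n/4}\in M_2^!(\Gamma^*(2),\nu_-)$. (c) For every odd prime $p$ and every $n\ge1$ we have $f_1^+|T_2^{(4)}(p^n)=p^nf^+_{p^n}$. If $p^n\equiv1\pmod4$ then $f_1^-|T_2^{(4)}(p^n)=p^nf^-_{p^n}$. If $p^n\equiv3\pmod4$ then $f_1^-|T_2^{(4)}(p^n)=p^nf^-_{p^n}+a_1^-(p^n)\,h_2$.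
   Context: $q=e^{2\pi iz}$, $\eta(z)=q^{1/24}\prod_{n\ge1}(1-q^n)$. $\Gamma^*(2)$ is the Fricke group generated by $\Gamma_0(2)$ and $W_2=\begin{pmatrix}0&-1\\2&0\end{pmatrix}$ (equivalently by $\begin{pmatrix}1&1\\0&1\end{pmatrix}$ and $W_2$). $\nu_\pm$ is the character of $\Gamma^*(2)$ given by $\nu_\pm(\gamma)=i^{d(b-c/2)}$ for $\gamma=\begin{pmatrix}a&b\\c&d\end{pmatrix}\in\Gamma_0(2)$ (the multiplier system of $h_2$ on $\Gamma_0(2)$) and $\nu_\pm(W_2)=\pm1$; $\bar\nu_\pm$ is its complex conjugate. For $\gamma\in GL_2^+(\mathbb{Q})$, $f|_k\gamma(z)=(\det\gamma)^{k/2}(cz+d)^{-k}f(\gamma z)$. $M_k^!(\Gamma,\chi)$ is the space of holomorphic functions on the upper half-plane, meromorphic at the cusps, with $f|_k\gamma=\chi(\gamma)f$ for all $\gamma\in\Gamma$. For a prime $p$, $f|T_k^{(t)}(p)=p^{k/2-1}\left(\sum_{\lambda=0}^{p-1}f|_k\begin{pmatrix}1&t\lambda\\0&p\end{pmatrix}+f|_k\begin{pmatrix}p&0\\0&1\end{pmatrix}\right)$, acting on $f=\sum a(n)q^{n/t}$ by $\sum(a(pn)+p^{k-1}a(n/p))q^{n/t}$; $T_k^{(t)}(1)=\mathrm{id}$, $T_k^{(t)}(p^{n+1})=T_k^{(t)}(p^n)T_k^{(t)}(p)-p^{k-1}T_k^{(t)}(p^{n-1})$. In (c), $f^\pm_{p^n}$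 are the forms from (a) or (b) according to $p^n\bmod4$, and $a_1^-(m)$ is the coefficient of $q^{m/4}$ in $f_1^-$. *)

(* Defs.v *)
From Stdlib Require Import Reals ZArith Znumtheory ClassicalEpsilon.
From Coquelicot Require Import Coquelicot.

Open Scope R_scope.

Definition UHP (z : C) : Prop := 0 < Im z.

Definition cexp (z : C) : C := (exp (Re z) * cos (Im z), exp (Re z) * sin (Im z)).
Definition Ci : C := (0, 1).
Definition qpow (r : R) (z : C) : C := cexp ((RtoC (2 * PI * r) * Ci * z)%C).

(** 2x2 integer matrices [[a,b],[c,d]] (elements of GL_2^+(Q) used here
    all have integral representatives) *)
Record mat := Mat { ma : Z; mb : Z; mc : Z; md : Z }.
Definition mdet (m : mat) : Z := (ma m * md m - mb m * mc m)%Z.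
Definition mact (m : mat) (z : C) : C :=
  ((RtoC (IZR (ma m)) * z + RtoC (IZR (mb m))) / (RtoC (IZR (mc m)) * z + RtoC (IZR (md m))))%C.

Definition slash (k : nat) (m : mat) (f : C -> C) (z : C) : C :=
  (RtoC (sqrt (IZR (mdet m))) ^ k * / (RtoC (IZR (mc m)) * z + RtoC (IZR (md m))) ^ k
   * f (mact m z))%C.

Definition W2 : mat := Mat 0 (-1) 2 0.

(** Gamma_0(2) and the Fricke group Gamma^*(2) = Gamma_0(2) u Gamma_0(2) W2,
    represented by integral matrices: Gamma_0(2) W2 consists exactly of the
    integral matrices [[A,B],[C,D]] of determinant 2 with A, C, D even. *)
Definition in_Gamma0_2 (m : mat) : Prop := mdet m = 1%Z /\ Z.Even (mc m).
Definition in_GammaStar2 (m : mat) : Prop :=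
  in_Gamma0_2 m \/
  (mdet m = 2%Z /\ Z.Even (ma m) /\ Z.Even (mc m) /\ Z.Even (md m)).

Definition ipow (e : Z) : C :=
  match (e mod 4)%Z with
  | 0%Z => RtoC 1
  | 1%Z => Ci
  | 2%Z => RtoC (-1)
  | _ => Copp Ci
  end.

(** The character nu_eps (eps = +1 or -1) of Gamma^*(2):
    nu(gamma) = i^{d(b - c/2)} on Gamma_0(2), nu(W2) = eps, extended
    multiplicatively: for gamma' = [[a',b'],[c',d']] in Gamma_0(2),
    gamma' W2 = [[2b', -a'],[2d', -c']], so nu([[A,B],[C,D]]) =
    eps * i^{(C/2)(A/2 + D/2)} on the coset Gamma_0(2) W2. *)
Definition nu (eps : R) (m : mat) : C :=
  if Z.eqb (mdet m) 1 then ipow (md m * (mb m - mc m / 2))%Z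
  else (RtoC eps * ipow ((mc m / 2) * (ma m / 2 + md m / 2))%Z)%C.
Definition nubar (eps : R) (m : mat) : C := Cconj (nu eps m).

Definition mero_at_cusps (k : nat) (f : C -> C) : Prop :=
  forall g : mat, mdet g = 1%Z ->
  exists (M N : nat) (b : nat -> C), (0 < M)%nat /\
    forall z, UHP z ->
      is_series (fun n : nat => (b n * qpow ((INR n - INR N) / INR M) z)%C)
                (slash k g f z).

Definition weakly_holomorphic (k : nat) (Gam : mat -> Prop) (chi : mat -> C)
  (f : C -> C) : Prop :=
  (forall z, UHP z -> ex_derive (K := C_AbsRing) (V := C_NormedModule) f z) /\
  (forall g, Gam g -> forall z, UHP z -> slash k g f z = (chi g * f z)%C) /\
  mero_at_cusps k f.

Definition has_qexp (t : R) (f : C -> C) (c : Z -> C) : Prop :=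
  exists N : nat,
    (forall n : Z, (n < - Z.of_nat N)%Z -> c n = RtoC 0) /\
    forall z, UHP z ->
      is_series (fun m : nat => (c (Z.of_nat m - Z.of_nat N)%Z
                     * qpow ((INR m - INR N) / t) z)%C) (f z).

Definition qcoef (d r L : Z) (a : Z -> C) (n : Z) : C :=
  if Z.eqb n (- d) then RtoC 1
  else if andb (Z.leb L n) (Z.eqb (n mod 4) r) then a n else RtoC 0.

Definition is_form (d r L : Z) (chi : mat -> C) (f : C -> C) (a : Z -> C) : Prop :=
  weakly_holomorphic 2 in_GammaStar2 chi f /\ has_qexp 4 f (qcoef d r L a).

Definition is_fplus (d : Z) (f : C -> C) (a : Z -> C) : Prop :=
  if Z.eqb (d mod 4) 1 then is_form d 3 1 (nubar 1) f a
  else is_form d 1 1 (nu 1) f a.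
Definition is_fminus (d : Z) (f : C -> C) (a : Z -> C) : Prop :=
  if Z.eqb (d mod 4) 1 then is_form d 3 1 (nubar (-1)) f a
  else is_form d 1 5 (nu (-1)) f a.

Definition unique_on_UHP (P : (C -> C) -> Prop) : Prop :=
  exists f, P f /\ forall g, P g -> forall z, UHP z -> g z = f z.

Definition hecke_p (k : nat) (t p : Z) (f : C -> C) (z : C) : C :=
  (RtoC (Rpower (IZR p) (INR k / 2 - 1)) *
   (sum_n (G := C_AbelianMonoid)
      (fun l : nat => slash k (Mat 1 (t * Z.of_nat l) 0 p) f z) (Z.to_nat p - 1)
    + slash k (Mat p 0 0 1) f z))%C.

Fixpoint hecke_pn (k : nat) (t p : Z) (n : nat) (f : C -> C) {struct n} : C -> C :=
  match n with
  | O => f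
  | S n' =>
    match n' with
    | O => hecke_p k t p f
    | S n'' => fun z =>
        (hecke_p k t p (hecke_pn k t p n' f) z
         - RtoC (Rpower (IZR p) (INR k - 1)) * hecke_pn k t p n'' f z)%C
    end
  end.

Fixpoint eta_partial (z : C) (N : nat) : C :=
  match N with
  | O => RtoC 1
  | S N' => (eta_partial z N' * (RtoC 1 - qpow (INR N) z))%C
  end.
Definition eta_prod (z : C) : C :=
  epsilon (inhabits (RtoC 0))
    (fun w : C => filterlim (eta_partial z) eventually (locally w)).
Definition eta (z : C) : C := (qpow (1 / 24) z * eta_prod z)%C.

Definition h2 (z : C) : C := (eta z ^ 2 * eta (RtoC 2 * z) ^ 2)%C.

(* Main.v *)
(** Uniqueness. If [f] has weight 2 and sign [+-1] under [W2] and starts at [q^(3/4)] or later, then [y |f|] is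
    invariant under [z -> z + 1] and [z -> -1/(2z)]; these move every point to height at least [49/100], where the
    decay of [f] contradicts Cauchy's estimates unless [f = 0]. If [f] starts at [q^(1/4)] with sign [+1], the same
    argument in weight 4 gives [f^2 = c^2 h2^2], and [f] vanishes at the fixed point [i / sqrt 2] of [W2]
    whereas [h2] does not.

    Existence. With [u = eta(z)^2] and [v = eta(2z)^2], the forms [h2 = u v], [u^7/v^5 +- 64 v^7/u^5] and
    [h2 (t - 4096/t)], [t = (u/v)^12], have the smallest poles; multiplication by [t + 4096/t] produces the others.
    Everything rests on [eta^2(-1/z) = -i z eta^2(z)], which follows by integrating the transformation law of the
    weight 2 Eisenstein series; the latter is obtained from the partial fractions of the cotangent by
    interchanging two summations.

    Hecke operators. [T(p)] commutes with [W2] because [l -> l'] with [32 l l' = -1 mod p] permutes the nonzero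
    residues, and on coefficients [T(p^(n+1)) = U^(n+1) + p V T(p^n)] shows that [f1 | T(p^n)] has principal
    part [p^n q^(-p^n/4)]; uniqueness identifies it. *)

Require Import Defs.
From Stdlib Require Import Reals ZArith Znumtheory Lra Lia ClassicalEpsilon FunctionalExtensionality.
From Coquelicot Require Import Coquelicot.
Local Open Scope C_scope.

(** * Absolutely convergent complex series *)

(** No valence formula and no maximum principle enters: uniqueness is a contraction argument, and
    its numbers shape the statement. A fundamental domain for translation and [W2] reaches down to
    height [1/2]; settling for slightly less lets every reduction step gain a fixed factor. There,
    Cauchy's estimate on the line of half the height costs a factor [2] per two units of weight and
    gains [exp (- PI * rho * y)], where [rho] is the leading exponent. This contracts once [rho] is
    at least [3/4] per two units of weight. The exponent [1/4] falls short, as it must: [h2] begins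
    there with sign [-1]. Hence the normalisation [n >= 5] in (b) and the multiple of [h2] in (c)
    for that sign. With sign [+1], cancelling the leading term of the square gains a full power of
    [q] and reaches [3/2] in weight 4, again exactly [3/4] per two units.

    A form is handled only through its behaviour under [z -> z + 1] and under [W2]; a Euclidean
    algorithm on the bottom row of a matrix recovers the rest of the group together with the
    character. *)

Lemma Cmod_minus_sym (x y : C) : Cmod (x - y) = Cmod (y - x).
Proof. rewrite <- Cmod_opp. f_equal. ring. Qed.

Lemma Cmod_sub_le (x y : C) : (Cmod (x - y) <= Cmod x + Cmod y)%R.
Proof. unfold Cminus. rewrite <- (Cmod_opp y). apply Cmod_triangle. Qed.

Lemma Cmod_sub_ge (x y : C) : (Cmod x - Cmod y <= Cmod (x - y))%R.
Proof.
  pose proof (Cmod_triangle (x - y) y) as H.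
  replace (x - y + y) with x in H by ring. lra.
Qed.

Lemma Cmod_eps_0 (x : C) : (forall e : R, (0 < e)%R -> (Cmod x <= e)%R) -> x = 0.
Proof.
  intros H. apply Cmod_eq_0. pose proof (Cmod_ge_0 x).
  destruct (Req_dec (Cmod x) 0) as [|Hn]; [assumption|].
  specialize (H (Cmod x / 2)%R). lra.
Qed.

(** The index stays strictly below [n], so that empty sums exist and splitting or shifting needs no
    off-by-one; [sum_n_csum] translates from the inclusive [sum_n]. *)
Fixpoint csum (f : nat -> C) (n : nat) : C :=
  match n with O => 0 | S m => csum f m + f m end.

Fixpoint rsum (f : nat -> R) (n : nat) : R :=
  match n with O => 0%R | S m => (rsum f m + f m)%R end.

Definition clim (u : nat -> C) (l : C) : Prop :=
  forall eps : R, (0 < eps)%R -> exists N, forall n, (N <= n)%nat -> (Cmod (u n - l) < eps)%R.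

Definition csums (f : nat -> C) (l : C) : Prop := clim (csum f) l.

Definition cabs (f : nat -> C) : Prop := ex_series (fun n => Cmod (f n)).

(** A total function, assembled from the real [Series] of the two components; it is the sum of the
    series as soon as [cabs f] holds. *)
Definition Cser (f : nat -> C) : C :=
  (Series (fun n => Re (f n)), Series (fun n => Im (f n))).

Lemma csum_ext (f g : nat -> C) n :
  (forall k, (k < n)%nat -> f k = g k) -> csum f n = csum g n.
Proof.
  induction n as [|n IH]; intros H; simpl; [reflexivity|].
  rewrite IH by (intros; apply H; lia). now rewrite H by lia.
Qed.

Lemma csum_plus f g n : csum (fun k => f k + g k) n = csum f n + csum g n.
Proof. induction n as [|n IH]; simpl; [ring|]. rewrite IH. ring. Qed.

Lemma csum_minus f g n : csum (fun k => f k - g k) n = csum f n - csum g n.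
Proof. induction n as [|n IH]; simpl; [ring|]. rewrite IH. ring. Qed.

Lemma csum_scal c f n : csum (fun k => c * f k) n = c * csum f n.
Proof. induction n as [|n IH]; simpl; [ring|]. rewrite IH. ring. Qed.

Lemma csum_const c n : csum (fun _ => c) n = INR n * c.
Proof.
  induction n as [|n IH]; simpl csum; [simpl; ring|].
  rewrite IH, S_INR, RtoC_plus. ring.
Qed.

Lemma csum_swap (F : nat -> nat -> C) m n :
  csum (fun i => csum (fun j => F i j) n) m = csum (fun j => csum (fun i => F i j) m) n.
Proof.
  induction m as [|m IH]; simpl.
  - induction n as [|n IH]; simpl; [reflexivity|]. rewrite <- IH. ring.
  - now rewrite IH, <- csum_plus.
Qed.

Lemma csum_split f m n : csum f (m + n) = csum f m + csum (fun k => f (m + k)%nat) n.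
Proof.
  induction n as [|n IH]; simpl; [rewrite Nat.add_0_r; ring|].
  rewrite Nat.add_succ_r. simpl. rewrite IH. ring.
Qed.

Lemma csum_S_l f n : csum f (S n) = f O + csum (fun k => f (S k)) n.
Proof. change (S n) with (1 + n)%nat. rewrite csum_split. simpl. ring. Qed.

Lemma csum_telescope f n : csum (fun k => f (S k) - f k) n = f n - f O.
Proof. induction n as [|n IH]; simpl; [ring|]. rewrite IH. ring. Qed.

Lemma Cmod_csum_le f A n :
  (forall k, (k < n)%nat -> (Cmod (f k) <= A k)%R) -> (Cmod (csum f n) <= rsum A n)%R.
Proof.
  induction n as [|n IH]; intros H; simpl; [rewrite Cmod_0; lra|].
  eapply Rle_trans; [apply Cmod_triangle|].
  apply Rplus_le_compat; [apply IH; intros; apply H; lia|apply H; lia].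
Qed.

Lemma sum_n_csum (f : nat -> C) n : sum_n (G := C_AbelianMonoid) f n = csum f (S n).
Proof.
  induction n as [|n IH].
  - rewrite sum_O. simpl. symmetry. apply Cplus_0_l.
  - rewrite sum_Sn, IH. reflexivity.
Qed.

Lemma sum_n_rsum (f : nat -> R) n : sum_n f n = rsum f (S n).
Proof.
  induction n as [|n IH].
  - rewrite sum_O. simpl. ring.
  - rewrite sum_Sn, IH. reflexivity.
Qed.

Lemma filterlim_clim (u : nat -> C) l :
  filterlim u eventually (locally (T := C_UniformSpace) l) <-> clim u l.
Proof.
  split.
  - intros H eps Heps.
    pose proof (proj1 (filterlim_locally_ball_norm (K := C_AbsRing) (U := C_NormedModule) u l) H
      (mkposreal eps Heps)) as [N HN].
    exists N. intros n Hn. exact (HN n Hn).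
  - intros H. apply (proj2 (filterlim_locally_ball_norm (K := C_AbsRing) (U := C_NormedModule) u l)).
    intros eps. destruct (H eps (cond_pos eps)) as [N HN]. exists N. intros n Hn. exact (HN n Hn).
Qed.

Lemma clim_subseq (u : nat -> C) l (phi : nat -> nat) :
  (forall M, exists N, forall n, (N <= n)%nat -> (M <= phi n)%nat) ->
  clim u l -> clim (fun n => u (phi n)) l.
Proof.
  intros Hp H eps He. destruct (H eps He) as [M HM]. destruct (Hp M) as [N HN].
  exists N. intros n Hn. apply HM, HN, Hn.
Qed.

Lemma clim_ext (u v : nat -> C) l : (forall n, u n = v n) -> clim u l -> clim v l.
Proof. intros H Hu eps He. destruct (Hu eps He) as [N HN]. exists N. intros n Hn. rewrite <- H. auto. Qed.

Lemma clim_shift (u : nat -> C) l k : clim (fun n => u (k + n)%nat) l <-> clim u l.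
Proof.
  split; intros H.
  - intros eps He. destruct (H eps He) as [N HN]. exists (k + N)%nat. intros n Hn.
    replace n with (k + (n - k))%nat by lia. apply HN. lia.
  - apply clim_subseq; [|exact H]. intros M. exists M. intros; lia.
Qed.

Lemma is_series_csums (f : nat -> C) l :
  is_series (K := C_AbsRing) (V := C_NormedModule) f l <-> csums f l.
Proof.
  unfold is_series, csums. etransitivity; [apply filterlim_clim|].
  rewrite <- (clim_shift (csum f) l 1).
  split; apply clim_ext; intros n; [|symmetry]; apply sum_n_csum.
Qed.

Lemma clim_const (c : C) : clim (fun _ => c) c.
Proof. intros eps He. exists O. intros. replace (c - c) with (RtoC 0) by ring. now rewrite Cmod_0. Qed.

Lemma clim_unique u l1 l2 : clim u l1 -> clim u l2 -> l1 = l2.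
Proof.
  intros H1 H2. assert (l1 - l2 = 0) as H.
  { apply Cmod_eps_0. intros e He.
    destruct (H1 (e / 2)%R) as [N1 K1]; [lra|]. destruct (H2 (e / 2)%R) as [N2 K2]; [lra|].
    specialize (K1 (N1 + N2)%nat ltac:(lia)). specialize (K2 (N1 + N2)%nat ltac:(lia)).
    replace (l1 - l2) with ((u (N1 + N2)%nat - l2) - (u (N1 + N2)%nat - l1)) by ring.
    eapply Rle_trans; [apply Cmod_sub_le|]. lra. }
  replace l1 with (l1 - l2 + l2) by ring. rewrite H. ring.
Qed.

Lemma clim_squeeze u l (r : nat -> R) :
  (forall n, (Cmod (u n - l) <= r n)%R) -> is_lim_seq r 0 -> clim u l.
Proof.
  intros H Hr eps He. apply is_lim_seq_spec in Hr. destruct (Hr (mkposreal eps He)) as [N HN].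
  exists N. intros n Hn. specialize (HN n Hn). simpl in HN. rewrite Rminus_0_r in HN.
  eapply Rle_lt_trans; [apply H|]. eapply Rle_lt_trans; [apply Rle_abs|exact HN].
Qed.

Lemma clim_plus u v a b : clim u a -> clim v b -> clim (fun n => u n + v n) (a + b).
Proof.
  intros H1 H2 e He.
  destruct (H1 (e / 2)%R) as [N1 K1]; [lra|]. destruct (H2 (e / 2)%R) as [N2 K2]; [lra|].
  exists (N1 + N2)%nat. intros n Hn.
  specialize (K1 n ltac:(lia)). specialize (K2 n ltac:(lia)).
  replace (u n + v n - (a + b)) with ((u n - a) + (v n - b)) by ring.
  eapply Rle_lt_trans; [apply Cmod_triangle|]. lra.
Qed.

Lemma clim_scal c u a : clim u a -> clim (fun n => c * u n) (c * a).
Proof.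
  intros H e He.
  pose proof (Cmod_ge_0 c).
  destruct (H (e / (Cmod c + 1))%R) as [N K]; [apply Rdiv_lt_0_compat; lra|].
  exists N. intros n Hn. specialize (K n Hn).
  replace (c * u n - c * a) with (c * (u n - a)) by ring. rewrite Cmod_mult.
  apply Rlt_div_r in K; [|lra]. pose proof (Cmod_ge_0 (u n - a)). nra.
Qed.

Lemma clim_minus u v a b : clim u a -> clim v b -> clim (fun n => u n - v n) (a - b).
Proof.
  intros H1 H2. apply (clim_ext (fun n => u n + (-(1)) * v n)); [intros; ring|].
  replace (a - b) with (a + (-(1)) * b) by ring. apply clim_plus; [assumption|]. now apply clim_scal.
Qed.

Lemma clim_mult_0 u v M : (forall n, (Cmod (v n) <= M)%R) -> clim u 0 -> clim (fun n => u n * v n) 0.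
Proof.
  intros HM H e He.
  assert (0 <= M)%R by (eapply Rle_trans; [apply Cmod_ge_0|apply (HM O)]).
  destruct (H (e / (M + 1))%R) as [N K]; [apply Rdiv_lt_0_compat; lra|].
  exists N. intros n Hn. specialize (K n Hn). specialize (HM n).
  replace (u n * v n - 0) with (u n * v n) by ring. rewrite Cmod_mult.
  replace (u n - 0) with (u n) in K by ring.
  apply Rlt_div_r in K; [|lra]. pose proof (Cmod_ge_0 (u n)). pose proof (Cmod_ge_0 (v n)). nra.
Qed.

Lemma clim_bounded u l : clim u l -> exists M, forall n, (Cmod (u n) <= M)%R.
Proof.
  intros H. destruct (H 1%R ltac:(lra)) as [N K].
  exists (rsum (fun n => Cmod (u n)) N + Cmod l + 1)%R. intros n.
  assert (Hs : forall m, (0 <= rsum (fun n => Cmod (u n)) m)%R).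
  { induction m; simpl; [lra|]. pose proof (Cmod_ge_0 (u m)). lra. }
  destruct (le_lt_dec N n) as [L|L].
  - specialize (K n L). specialize (Hs N). pose proof (Cmod_sub_ge (u n) l). lra.
  - assert (forall m, (n < m)%nat -> (Cmod (u n) <= rsum (fun n => Cmod (u n)) m)%R) as G.
    { induction m as [|m IH]; intros Hm; [lia|]. simpl.
      destruct (Nat.eq_dec n m) as [->|]; [specialize (Hs m); lra|].
      specialize (IH ltac:(lia)). pose proof (Cmod_ge_0 (u m)). lra. }
    specialize (G N L). pose proof (Cmod_ge_0 l). lra.
Qed.

Lemma clim_mult u v a b : clim u a -> clim v b -> clim (fun n => u n * v n) (a * b).
Proof.
  intros H1 H2. destruct (clim_bounded _ _ H2) as [M HM].
  apply (clim_ext (fun n => (u n - a) * v n + a * v n)); [intros; ring|].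
  replace (a * b) with (0 + a * b) by ring.
  apply clim_plus; [|now apply clim_scal]. apply clim_mult_0 with M; [assumption|].
  replace (RtoC 0) with (a - a) by ring. apply clim_minus; [assumption|apply clim_const].
Qed.

Lemma clim_Cmod_le u l M : (forall n, (Cmod (u n) <= M)%R) -> clim u l -> (Cmod l <= M)%R.
Proof.
  intros H Hu. apply Rnot_lt_le. intros Hl.
  destruct (Hu (Cmod l - M)%R ltac:(lra)) as [N K]. specialize (K N (Nat.le_refl _)).
  rewrite Cmod_minus_sym in K. pose proof (Cmod_sub_ge l (u N)). specialize (H N). lra.
Qed.

Lemma cabs_le f A : (forall n, (Cmod (f n) <= A n)%R) -> ex_series A -> cabs f.
Proof.
  intros H HA. apply (ex_series_le (K := R_AbsRing) (V := R_CompleteNormedModule) _ A); [|exact HA].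
  intros n. unfold norm; simpl. unfold abs; simpl.
  rewrite Rabs_pos_eq by apply Cmod_ge_0. apply H.
Qed.

Lemma Re_csum f n : Re (csum f n) = rsum (fun k => Re (f k)) n.
Proof.
  induction n as [|n IH]; [reflexivity|].
  change (Re (csum f n) + Re (f n) = rsum (fun k => Re (f k)) n + Re (f n))%R. now rewrite IH.
Qed.

Lemma Im_csum f n : Im (csum f n) = rsum (fun k => Im (f k)) n.
Proof.
  induction n as [|n IH]; [reflexivity|].
  change (Im (csum f n) + Im (f n) = rsum (fun k => Im (f k)) n + Im (f n))%R. now rewrite IH.
Qed.

Lemma csums_Cser f : cabs f -> csums f (Cser f).
Proof.
  intros H. apply is_series_csums.
  destruct (ex_series_le (K := C_AbsRing) (V := C_CompleteNormedModule) f (fun n => Cmod (f n))) as [l Hl];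
    [intros n; apply Rle_refl|exact H|].
  assert (Cser f = l) as ->; [|exact Hl].
  apply is_series_csums in Hl.
  destruct l as [a b]. unfold Cser. f_equal; apply is_series_unique;
  match goal with |- is_series ?u ?v => change (is_lim_seq (sum_n u) v) end; apply is_lim_seq_spec;
  intros eps; destruct (Hl eps (cond_pos eps)) as [N K]; exists N; intros n Hn;
  specialize (K (S n) ltac:(lia)); (eapply Rle_lt_trans; [|exact K]); rewrite sum_n_rsum.
  - replace (rsum (fun n0 => Re (f n0)) (S n)) with (Re (csum f (S n))).
    2:{ apply Re_csum. }
    eapply Rle_trans; [|apply re_le_Cmod]. simpl. apply Rle_refl.
  - replace (rsum (fun n0 => Im (f n0)) (S n)) with (Im (csum f (S n))).
    2:{ apply Im_csum. }
    eapply Rle_trans; [|apply Rmax_Cmod]. eapply Rle_trans; [|apply Rmax_r]. simpl. apply Rle_refl.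
Qed.

Lemma Cser_unique f l : cabs f -> csums f l -> Cser f = l.
Proof. intros H Hl. eapply clim_unique; [apply csums_Cser|]; eassumption. Qed.

Lemma Cser_ext f g : (forall n, f n = g n) -> Cser f = Cser g.
Proof. intros H. f_equal. apply functional_extensionality, H. Qed.

Lemma cabs_ext f g : (forall n, f n = g n) -> cabs f -> cabs g.
Proof. intros H. replace g with f; [auto|]. apply functional_extensionality, H. Qed.

Lemma cabs_plus f g : cabs f -> cabs g -> cabs (fun n => f n + g n).
Proof.
  intros Hf Hg. apply cabs_le with (fun n => Cmod (f n) + Cmod (g n))%R.
  - intros; apply Cmod_triangle.
  - apply (ex_series_plus (K := R_AbsRing) (V := R_NormedModule)); assumption.
Qed.

Lemma cabs_scal c f : cabs f -> cabs (fun n => c * f n).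
Proof.
  intros Hf. apply cabs_le with (fun n => Cmod c * Cmod (f n))%R.
  - intros; rewrite Cmod_mult; apply Rle_refl.
  - apply (ex_series_scal (K := R_AbsRing) (V := R_NormedModule)); assumption.
Qed.

Lemma cabs_minus f g : cabs f -> cabs g -> cabs (fun n => f n - g n).
Proof.
  intros Hf Hg. apply cabs_ext with (fun n => f n + (-(1)) * g n); [intros; ring|].
  apply cabs_plus; [assumption|now apply cabs_scal].
Qed.

Lemma Cser_plus f g : cabs f -> cabs g -> Cser (fun n => f n + g n) = Cser f + Cser g.
Proof.
  intros Hf Hg. apply Cser_unique; [now apply cabs_plus|].
  eapply clim_ext; [intros; symmetry; apply csum_plus|].
  apply clim_plus; now apply csums_Cser.
Qed.

Lemma Cser_scal c f : cabs f -> Cser (fun n => c * f n) = c * Cser f.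
Proof.
  intros Hf. apply Cser_unique; [now apply cabs_scal|].
  eapply clim_ext; [intros; symmetry; apply csum_scal|].
  apply clim_scal; now apply csums_Cser.
Qed.

Lemma Cser_minus f g : cabs f -> cabs g -> Cser (fun n => f n - g n) = Cser f - Cser g.
Proof.
  intros Hf Hg. apply Cser_unique; [now apply cabs_minus|].
  eapply clim_ext; [intros; symmetry; apply csum_minus|].
  apply clim_minus; now apply csums_Cser.
Qed.

Lemma cabs_shift f k : cabs (fun n => f (k + n)%nat) <-> cabs f.
Proof. unfold cabs. symmetry. apply (ex_series_incr_n (fun n => Cmod (f n)) k). Qed.

Lemma Cser_split f k : cabs f -> Cser f = csum f k + Cser (fun n => f (k + n)%nat).
Proof.
  intros H. apply Cser_unique; [assumption|]. apply (clim_shift _ _ k).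
  eapply clim_ext; [intros; symmetry; apply csum_split|].
  apply clim_plus; [apply clim_const|]. apply csums_Cser. now apply cabs_shift.
Qed.

Lemma Cser_S_l f : cabs f -> Cser f = f O + Cser (fun n => f (S n)).
Proof. intros H. rewrite (Cser_split f 1) by assumption. simpl. ring. Qed.

Lemma csums_shift f k l : csums (fun n => f (k + n)%nat) l <-> csums f (csum f k + l).
Proof.
  unfold csums. rewrite <- (clim_shift (csum f) _ k). split; intros H.
  - eapply clim_ext; [intros; symmetry; apply csum_split|]. apply clim_plus; [apply clim_const|exact H].
  - replace l with (csum f k + l - csum f k) by ring.
    eapply clim_ext; [|apply clim_minus; [exact H|apply (clim_const (csum f k))]].
    intros n. cbv beta. rewrite csum_split. ring.
Qed.

Lemma rsum_lim A : ex_series A -> is_lim_seq (rsum A) (Series A).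
Proof.
  intros H. apply is_lim_seq_incr_1.
  apply is_lim_seq_ext with (sum_n A); [intros; apply sum_n_rsum|]. exact (Series_correct _ H).
Qed.

Lemma rsum_le_Series A n : ex_series A -> (forall k, (0 <= A k)%R) -> (rsum A n <= Series A)%R.
Proof.
  intros H H0.
  apply (is_lim_seq_le (fun _ => rsum A n) (fun k => rsum A (n + k)) (rsum A n) (Series A)).
  - intros k. induction k as [|k IH]; [rewrite Nat.add_0_r; lra|].
    rewrite Nat.add_succ_r. simpl. specialize (H0 (n + k)%nat). lra.
  - apply is_lim_seq_const.
  - apply is_lim_seq_ext with (fun k => rsum A (k + n)); [intros; f_equal; lia|].
    apply (is_lim_seq_incr_n (rsum A) n). now apply rsum_lim.
Qed.

(** The remainder of a dominated series is bounded by the remainder of the majorant; this is the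
    uniformity that [tannery] rests on. *)
Lemma Cser_tail f A K : (forall n, (Cmod (f n) <= A n)%R) -> ex_series A ->
  (Cmod (Cser f - csum f K) <= Series A - rsum A K)%R.
Proof.
  intros H HA.
  assert (HA0 : forall k, (0 <= A k)%R) by (intros k; eapply Rle_trans; [apply Cmod_ge_0|apply H]).
  apply (clim_Cmod_le (fun n => csum f (K + n) - csum f K)).
  - intros n. rewrite csum_split. replace (csum f K + csum (fun k => f (K + k)%nat) n - csum f K)
      with (csum (fun k => f (K + k)%nat) n) by ring.
    eapply Rle_trans; [apply (Cmod_csum_le _ (fun k => A (K + k)%nat)); intros; apply H|].
    pose proof (rsum_le_Series A (K + n) HA HA0) as G.
    assert (rsum A (K + n) = rsum A K + rsum (fun k => A (K + k)%nat) n)%R.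
    { clear. induction n as [|n IH]; simpl; [rewrite Nat.add_0_r; ring|].
      rewrite Nat.add_succ_r. simpl. rewrite IH. ring. }
    lra.
  - apply clim_minus; [|apply clim_const]. apply (clim_shift (csum f)). apply csums_Cser.
    now apply cabs_le with A.
Qed.

Lemma Cser_Cmod_le f A : (forall n, (Cmod (f n) <= A n)%R) -> ex_series A ->
  (Cmod (Cser f) <= Series A)%R.
Proof.
  intros H HA. pose proof (Cser_tail f A 0 H HA) as G. simpl in G.
  replace (Cser f - 0) with (Cser f) in G by ring. lra.
Qed.

(** Dominated convergence for series: cut at an index beyond which the majorant contributes less
    than [eps / 3]; the finite head converges term by term. *)
Lemma tannery (F : nat -> nat -> C) f A :
  (forall n k, (Cmod (F n k) <= A k)%R) -> ex_series A ->
  (forall k, clim (fun n => F n k) (f k)) -> clim (fun n => Cser (F n)) (Cser f).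
Proof.
  intros HF HA Hf.
  assert (HfA : forall k, (Cmod (f k) <= A k)%R).
  { intros k. apply clim_Cmod_le with (fun n => F n k); auto. }
  intros eps He.
  assert (exists K, (Series A - rsum A K < eps / 3)%R) as [K HK].
  { pose proof (rsum_lim A HA) as L. apply is_lim_seq_spec in L.
    destruct (L (mkposreal (eps / 3) ltac:(lra))) as [K HK]. exists K.
    specialize (HK K (Nat.le_refl _)). simpl in HK. apply Rabs_def2 in HK. lra. }
  assert (clim (fun n => csum (F n) K) (csum f K)) as HC.
  { clear HK. induction K as [|K IH]; simpl; [apply clim_const|]. now apply clim_plus. }
  destruct (HC (eps / 3)%R) as [N HN]; [lra|]. exists N. intros n Hn. specialize (HN n Hn).
  pose proof (Cser_tail (F n) A K (HF n) HA) as T1.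
  pose proof (Cser_tail f A K HfA HA) as T2.
  replace (Cser (F n) - Cser f) with
    ((Cser (F n) - csum (F n) K) + (csum (F n) K - csum f K) - (Cser f - csum f K)) by ring.
  eapply Rle_lt_trans; [apply Cmod_sub_le|].
  pose proof (Cmod_triangle (Cser (F n) - csum (F n) K) (csum (F n) K - csum f K)). lra.
Qed.

Lemma cabs_fin (f : nat -> C) N : (forall m, (N <= m)%nat -> f m = 0) -> cabs f.
Proof.
  intros H. apply (cabs_shift f N). exists 0%R.
  match goal with |- is_series ?u ?v => change (is_lim_seq (sum_n u) v) end.
  apply is_lim_seq_ext with (fun _ => 0%R); [|apply is_lim_seq_const].
  intros n. rewrite sum_n_rsum. induction (S n) as [|k IH]; [reflexivity|].
  simpl. rewrite <- IH, H, Cmod_0 by lia. ring.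
Qed.

Lemma csums_fin (f : nat -> C) N : (forall m, (N <= m)%nat -> f m = 0) -> csums f (csum f N).
Proof.
  intros H. apply (clim_shift _ _ N). eapply clim_ext; [|apply clim_const].
  intros n. rewrite csum_split. rewrite (csum_ext (fun k => f (N + k)%nat) (fun _ => 0)) by (intros; apply H; lia).
  rewrite csum_const. ring.
Qed.

Lemma Cser_fin (f : nat -> C) N : (forall m, (N <= m)%nat -> f m = 0) -> Cser f = csum f N.
Proof. intros H. apply Cser_unique; [now apply cabs_fin with N|now apply csums_fin]. Qed.

Lemma csum_Cser (X : nat -> nat -> C) N :
  (forall n, cabs (fun m => X m n)) ->
  csum (fun n => Cser (fun m => X m n)) N = Cser (fun m => csum (X m) N)
  /\ cabs (fun m => csum (X m) N).
Proof.
  intros H. induction N as [|N [IH1 IH2]]; simpl.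
  - split; [|apply cabs_fin with O; auto]. now rewrite (Cser_fin _ O).
  - split; [|now apply cabs_plus]. rewrite IH1. symmetry. now apply Cser_plus.
Qed.

Lemma RtoC_rsum f n : RtoC (rsum f n) = csum (fun k => RtoC (f k)) n.
Proof. induction n as [|n IH]; simpl; [reflexivity|]. now rewrite RtoC_plus, IH. Qed.

Lemma csums_RtoC (f : nat -> R) l : ex_series f -> l = Series f -> csums (fun n => RtoC (f n)) l.
Proof.
  intros H ->. eapply clim_ext; [intros; apply RtoC_rsum|].
  intros eps He. pose proof (rsum_lim f H) as L. apply is_lim_seq_spec in L.
  destruct (L (mkposreal eps He)) as [N HN]. exists N. intros n Hn.
  rewrite <- RtoC_minus, Cmod_R. exact (HN n Hn).
Qed.

Lemma ex_series_csums (f : nat -> R) l : csums (fun n => RtoC (f n)) l -> ex_series f.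
Proof.
  intros H. exists (Re l).
  match goal with |- is_series ?u ?v => change (is_lim_seq (sum_n u) v) end.
  apply is_lim_seq_spec. intros eps. destruct (H eps (cond_pos eps)) as [N K]. exists N. intros n Hn.
  specialize (K (S n) ltac:(lia)). eapply Rle_lt_trans; [|exact K].
  rewrite sum_n_rsum, <- RtoC_rsum. apply (re_le_Cmod (RtoC (rsum f (S n)) - l)).
Qed.

(** * Interchange of two summations *)

Lemma fubini_csums (X : nat -> nat -> C) :
  (forall m, cabs (X m)) -> ex_series (fun m => Series (fun n => Cmod (X m n))) ->
  (forall n, cabs (fun m => X m n)) /\ cabs (fun m => Cser (X m)) /\
  csums (fun n => Cser (fun m => X m n)) (Cser (fun m => Cser (X m))).
Proof.
  intros H1 H2.
  assert (B : forall m n, (Cmod (X m n) <= Series (fun n => Cmod (X m n)))%R).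
  { intros m n. eapply Rle_trans; [|apply (rsum_le_Series (fun n => Cmod (X m n)) (S n) (H1 m))].
    - simpl. assert (0 <= rsum (fun n => Cmod (X m n)) n)%R.
      { induction n as [|n IH]; simpl; [lra|]. pose proof (Cmod_ge_0 (X m n)). lra. }
      lra.
    - intros; apply Cmod_ge_0. }
  assert (H3 : forall n, cabs (fun m => X m n)).
  { intros n. eapply cabs_le; [|exact H2]. intros m. apply (B m n). }
  split; [exact H3|]. split.
  { eapply cabs_le; [|exact H2]. intros m. apply Cser_Cmod_le; [intros; apply Rle_refl|apply H1]. }
  (* A finite sum of columns is the sum over the rows of their partial sums; these are dominated by
     the row norms, so Tannery's theorem applies. *)
  unfold csums. eapply clim_ext; [intros N; symmetry; apply (csum_Cser X N H3)|].
  eapply tannery; [|exact H2|].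
  - intros N m. simpl. eapply Rle_trans; [apply (Cmod_csum_le _ (fun n => Cmod (X m n))); intros; apply Rle_refl|].
    apply rsum_le_Series; [apply H1|intros; apply Cmod_ge_0].
  - intros m. apply csums_Cser, H1.
Qed.

Lemma fubini (X : nat -> nat -> C) :
  (forall m, cabs (X m)) -> ex_series (fun m => Series (fun n => Cmod (X m n))) ->
  (forall n, cabs (fun m => X m n)) /\ cabs (fun m => Cser (X m)) /\
  cabs (fun n => Cser (fun m => X m n)) /\
  Cser (fun n => Cser (fun m => X m n)) = Cser (fun m => Cser (X m)).
Proof.
  intros H1 H2. destruct (fubini_csums X H1 H2) as (H3 & H4 & H5).
  assert (H6 : cabs (fun n => Cser (fun m => X m n))).
  { apply cabs_le with (fun n => Series (fun m => Cmod (X m n))).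
    - intros n. apply Cser_Cmod_le; [intros; apply Rle_refl|apply H3].
    (* The column norms are summable because the previous lemma, applied to the moduli, makes their
       partial sums converge. *)
    - destruct (fubini_csums (fun m n => RtoC (Cmod (X m n)))) as (K1 & _ & K2).
      + intros m. apply cabs_le with (fun n => Cmod (X m n)); [|apply H1].
        intros n. rewrite Cmod_R, Rabs_pos_eq by apply Cmod_ge_0. apply Rle_refl.
      + eapply ex_series_ext; [|exact H2]. intros m. apply Series_ext. intros n.
        now rewrite Cmod_R, Rabs_pos_eq by apply Cmod_ge_0.
      + eapply ex_series_csums. eapply clim_ext; [|exact K2]. intros N. apply csum_ext. intros n _.
        apply Cser_unique; [apply (K1 n)|]. apply csums_RtoC; [apply H3|reflexivity]. }
  repeat split; try assumption. now apply Cser_unique.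
Qed.

(** * Cauchy products and dilated series *)

Definition conv (a b : nat -> C) (n : nat) : C := csum (fun k => a k * b (n - k)%nat) (S n).

Lemma Cser_conv a b : cabs a -> cabs b -> cabs (conv a b) /\ Cser (conv a b) = Cser a * Cser b.
Proof.
  (* Triangular array: row [m] is [a m] times the series [b] delayed by [m] places, and column [n]
     is the [n]-th coefficient of the product. *)
  intros Ha Hb. pose (X m n := if (m <=? n)%nat then a m * b (n - m)%nat else 0).
  assert (Xs : forall m n, X m (m + n)%nat = a m * b n).
  { intros m n. unfold X. rewrite (proj2 (Nat.leb_le _ _)) by lia. do 2 f_equal. lia. }
  assert (X0 : forall m n, (n < m)%nat -> X m n = 0).
  { intros m n Hn. unfold X. now rewrite (proj2 (Nat.leb_gt _ _)) by lia. }
  assert (R1 : forall m, cabs (X m)).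
  { intros m. apply (cabs_shift (X m) m). apply cabs_ext with (fun n => a m * b n); [intros; now rewrite Xs|].
    now apply cabs_scal. }
  assert (R2 : forall m, Cser (X m) = a m * Cser b).
  { intros m. rewrite (Cser_split _ m) by apply R1. rewrite (csum_ext _ (fun _ => 0)) by (intros; now apply X0).
    rewrite csum_const. rewrite (Cser_ext _ (fun n => a m * b n)) by (intros; apply Xs).
    rewrite Cser_scal by assumption. ring. }
  destruct (fubini X R1) as (C1 & C2 & C3 & C4).
  { apply ex_series_ext with (fun m => Cmod (a m) * Series (fun n => Cmod (b n)))%R.
    - intros m. rewrite <- Series_scal_l. symmetry.
      destruct m as [|m].
      + apply Series_ext. intros n. rewrite <- Cmod_mult, <- Xs. reflexivity.
      + rewrite (Series_incr_n _ (S m)); [|lia|apply (R1 (S m))].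
        rewrite sum_eq_R0.
        * rewrite Rplus_0_l. apply Series_ext. intros n. now rewrite Xs, Cmod_mult.
        * intros k Hk. rewrite X0, Cmod_0 by (simpl in Hk; lia). reflexivity.
    - apply ex_series_scal_r. exact Ha. }
  assert (E : forall n, Cser (fun m => X m n) = conv a b n).
  { intros n. rewrite (Cser_fin _ (S n)) by (intros; now apply X0).
    apply csum_ext. intros k Hk. unfold X. now rewrite (proj2 (Nat.leb_le _ _)) by lia. }
  split; [eapply cabs_ext; [exact E|exact C3]|].
  rewrite <- (Cser_ext _ _ E), C4, (Cser_ext _ _ R2).
  rewrite (Cser_ext _ (fun m => Cser b * a m)) by (intros; ring). rewrite Cser_scal by assumption. ring.
Qed.

(** Coefficients after the substitution of [X^k] for [X]. It serves for Lambert series, for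
    [z -> 2 z], for expansions in [q^(1/4)] and for the Hecke operators. *)
Definition spread (k : nat) (x : nat -> C) (m : nat) : C :=
  if (m mod k =? 0)%nat then x (m / k)%nat else 0.

(** Partial sums of the dilated series are constant between multiples of [k]; with [r < k] the cut
    [k * n + S r] lies just past the term of index [k * n] and before the next nonzero one. *)
Lemma csum_spread k x n r : (0 < k)%nat -> (r < k)%nat ->
  csum (spread k x) (k * n + S r)%nat = csum x (S n).
Proof.
  intros Hk Hr.
  assert (H0 : forall n, spread k x (k * n) = x n).
  { intros j. unfold spread. rewrite Nat.mul_comm, Nat.Div0.mod_mul, Nat.eqb_refl, Nat.div_mul by lia. reflexivity. }
  assert (H1 : forall n r, (S r < k)%nat -> spread k x (k * n + S r) = 0).
  { intros j i Hi. unfold spread. rewrite (Nat.mul_comm k j), Nat.add_comm, Nat.Div0.mod_add, Nat.mod_small by lia.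
    reflexivity. }
  assert (E : forall n r, (r < k)%nat -> csum (spread k x) (k * n + S r)%nat = csum (spread k x) (k * n) + x n).
  { intros j i. induction i as [|i IH]; intros Hi.
    - rewrite Nat.add_1_r. simpl. now rewrite H0.
    - rewrite Nat.add_succ_r. simpl csum. rewrite IH, H1 by lia. ring. }
  rewrite E by assumption. simpl. f_equal. clear r Hr.
  induction n as [|n IH]; [rewrite Nat.mul_0_r; reflexivity|].
  replace (k * S n)%nat with (k * n + S (k - 1))%nat by lia. rewrite E, IH by lia. reflexivity.
Qed.

Lemma csums_spread k x l : (0 < k)%nat -> csums (spread k x) l <-> csums x l.
Proof.
  intros Hk. split; intros H.
  - apply (clim_shift _ _ 1). apply (clim_ext (fun n => csum (spread k x) (k * n + 1)%nat)).
    + intros n. rewrite csum_spread by lia. reflexivity.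
    + apply (clim_subseq (csum (spread k x)) l (fun n => (k * n + 1)%nat)); [|exact H].
      intros M. exists M. intros n Hn. nia.
  - apply (clim_shift _ _ 1). apply (clim_ext (fun m => csum x (S (m / k)))).
    + intros m. rewrite <- (csum_spread k x (m / k) (m mod k)) by (try apply Nat.mod_upper_bound; lia).
      f_equal. pose proof (Nat.div_mod_eq m k). lia.
    + apply (clim_subseq (csum x) l (fun m => S (m / k))); [|exact H].
      intros M. exists (k * M)%nat. intros n Hn.
      assert (M <= n / k)%nat by (apply Nat.div_le_lower_bound; lia). lia.
Qed.

Lemma cabs_iff f : cabs f <-> exists l, csums (fun n => RtoC (Cmod (f n))) l.
Proof.
  split.
  - intros H. eexists. apply csums_RtoC; [exact H|reflexivity].
  - intros [l H]. now apply ex_series_csums in H.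
Qed.

Lemma cabs_spread k x : (0 < k)%nat -> cabs (spread k x) <-> cabs x.
Proof.
  intros Hk. rewrite !cabs_iff.
  assert (E : forall n, RtoC (Cmod (spread k x n)) = spread k (fun n => RtoC (Cmod (x n))) n).
  { intros n. unfold spread. destruct (_ =? _)%nat; [reflexivity|now rewrite Cmod_0]. }
  split; intros [l H]; exists l.
  - apply (csums_spread k _ _ Hk). eapply clim_ext; [|exact H]. intros N. apply csum_ext. intros; apply E.
  - apply (csums_spread k _ _ Hk) in H. eapply clim_ext; [|exact H]. intros N. apply csum_ext. intros; now rewrite E.
Qed.

Lemma Cser_spread k x : (0 < k)%nat -> cabs x -> Cser (spread k x) = Cser x.
Proof.
  intros Hk H. apply Cser_unique; [now apply cabs_spread|]. apply csums_spread; [assumption|].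
  now apply csums_Cser.
Qed.

(** * Complex differentiation and power series *)

Lemma RtoC_neq0 (x : R) : x <> 0%R -> RtoC x <> 0.
Proof. intros H E. apply H. now apply RtoC_inj. Qed.

Lemma Cmult_reg_l (a b c : C) : a <> 0 -> a * b = a * c -> b = c.
Proof.
  intros Ha H. replace b with (/ a * (a * b)) by (field; assumption). rewrite H. now field.
Qed.

Lemma INR_S_neq0 n : RtoC (INR (S n)) <> 0.
Proof. apply RtoC_neq0, not_0_INR. lia. Qed.

(* Differentiability with a quadratic error term: it holds for every analytic function and
   makes the calculus rules elementary. *)
Definition qder (f : C -> C) (x l : C) : Prop :=
  exists d K : R, (0 < d)%R /\ (0 <= K)%R /\
    forall h, (Cmod h <= d)%R -> (Cmod (f (x + h) - f x - h * l)%C <= K * Cmod h ^ 2)%R.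

Lemma qder_ext_loc f g x l d : (0 < d)%R ->
  (forall h, (Cmod h <= d)%R -> f (x + h) = g (x + h)) -> qder f x l -> qder g x l.
Proof.
  intros Hd E (d' & K & Hd' & HK & H). exists (Rmin d d'), K.
  split; [apply Rmin_pos; assumption|]. split; [assumption|]. intros h Hh.
  assert (f x = g x) as E0.
  { specialize (E 0). replace (x + 0) with x in E by ring. apply E. rewrite Cmod_0. lra. }
  rewrite <- E, <- E0.
  - apply H. eapply Rle_trans; [exact Hh|apply Rmin_r].
  - eapply Rle_trans; [exact Hh|apply Rmin_l].
Qed.

Lemma qder_val f x l l' : qder f x l -> l = l' -> qder f x l'.
Proof. now intros H <-. Qed.

Lemma qder_const c x : qder (fun _ => c) x 0.
Proof.
  exists 1%R, 0%R. repeat split; try lra. intros h _.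
  replace (c - c - h * 0) with (RtoC 0) by ring. rewrite Cmod_0. lra.
Qed.

Lemma qder_id x : qder (fun y => y) x 1.
Proof.
  exists 1%R, 0%R. repeat split; try lra. intros h _.
  replace (x + h - x - h * 1) with (RtoC 0) by ring. rewrite Cmod_0. lra.
Qed.

Lemma qder_plus f g x l m : qder f x l -> qder g x m -> qder (fun y => f y + g y) x (l + m).
Proof.
  intros (d1 & K1 & Hd1 & HK1 & H1) (d2 & K2 & Hd2 & HK2 & H2).
  exists (Rmin d1 d2), (K1 + K2)%R. split; [now apply Rmin_pos|]. split; [lra|]. intros h Hh.
  specialize (H1 h (Rle_trans _ _ _ Hh (Rmin_l _ _))). specialize (H2 h (Rle_trans _ _ _ Hh (Rmin_r _ _))).
  replace (f (x + h) + g (x + h) - (f x + g x) - h * (l + m)) with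
    ((f (x + h) - f x - h * l) + (g (x + h) - g x - h * m)) by ring.
  eapply Rle_trans; [apply Cmod_triangle|]. lra.
Qed.

Lemma qder_lip f x l : qder f x l -> exists d L : R, (0 < d)%R /\ (0 <= L)%R /\
  forall h, (Cmod h <= d)%R -> (Cmod (f (x + h) - f x)%C <= L * Cmod h)%R.
Proof.
  intros (d & K & Hd & HK & H). exists (Rmin d 1), (Cmod l + K)%R.
  pose proof (Cmod_ge_0 l).
  split; [apply Rmin_pos; lra|]. split; [lra|]. intros h Hh.
  specialize (H h (Rle_trans _ _ _ Hh (Rmin_l _ _))).
  assert (Cmod h <= 1)%R by (eapply Rle_trans; [exact Hh|apply Rmin_r]).
  replace (f (x + h) - f x) with ((f (x + h) - f x - h * l) + h * l) by ring.
  eapply Rle_trans; [apply Cmod_triangle|]. rewrite Cmod_mult. pose proof (Cmod_ge_0 h).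
  assert (0 <= K * Cmod h * (1 - Cmod h))%R by (repeat apply Rmult_le_pos; lra).
  simpl in H. nra.
Qed.

Lemma qder_mult f g x l m : qder f x l -> qder g x m ->
  qder (fun y => f y * g y) x (l * g x + f x * m).
Proof.
  intros Hf Hg. destruct (qder_lip _ _ _ Hf) as (d3 & L1 & Hd3 & HL1 & G1).
  destruct (qder_lip _ _ _ Hg) as (d4 & L2 & Hd4 & HL2 & G2).
  destruct Hf as (d1 & K1 & Hd1 & HK1 & H1). destruct Hg as (d2 & K2 & Hd2 & HK2 & H2).
  pose proof (Cmod_ge_0 (f x)). pose proof (Cmod_ge_0 (g x)).
  exists (Rmin (Rmin d1 d2) (Rmin d3 d4)), (K1 * Cmod (g x) + Cmod (f x) * K2 + L1 * L2)%R.
  split; [repeat apply Rmin_pos; assumption|].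
  split; [nra|]. intros h Hh.
  assert (Cmod h <= d1 /\ Cmod h <= d2 /\ Cmod h <= d3 /\ Cmod h <= d4)%R as (A1 & A2 & A3 & A4).
  { pose proof (Rmin_l (Rmin d1 d2) (Rmin d3 d4)). pose proof (Rmin_r (Rmin d1 d2) (Rmin d3 d4)).
    pose proof (Rmin_l d1 d2). pose proof (Rmin_r d1 d2). pose proof (Rmin_l d3 d4). pose proof (Rmin_r d3 d4).
    repeat split; lra. }
  specialize (H1 h A1). specialize (H2 h A2). specialize (G1 h A3). specialize (G2 h A4).
  replace (f (x + h) * g (x + h) - f x * g x - h * (l * g x + f x * m)) with
   ((f (x + h) - f x - h * l) * g x + f x * (g (x + h) - g x - h * m)
    + (f (x + h) - f x) * (g (x + h) - g x)) by ring.
  eapply Rle_trans; [apply Cmod_triangle|].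
  eapply Rle_trans; [apply Rplus_le_compat_r, Cmod_triangle|]. rewrite !Cmod_mult.
  pose proof (Cmod_ge_0 h). pose proof (Cmod_ge_0 (f (x + h) - f x)). pose proof (Cmod_ge_0 (g (x + h) - g x)).
  assert (Cmod (f (x + h) - f x)%C * Cmod (g (x + h) - g x)%C <= (L1 * Cmod h) * (L2 * Cmod h))%R
    by (apply Rmult_le_compat; assumption).
  nra.
Qed.

Lemma qder_comp f g x l m : qder g x m -> qder f (g x) l -> qder (fun y => f (g y)) x (m * l).
Proof.
  intros Hg Hf. destruct (qder_lip _ _ _ Hg) as (d3 & L & Hd3 & HL & G).
  destruct Hf as (d1 & K1 & Hd1 & HK1 & H1). destruct Hg as (d2 & K2 & Hd2 & HK2 & H2).
  pose proof (Cmod_ge_0 l).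
  exists (Rmin (Rmin d3 d2) (d1 / (L + 1))), (K1 * L ^ 2 + K2 * Cmod l)%R.
  assert (0 < d1 / (L + 1))%R by (apply Rdiv_lt_0_compat; lra).
  split; [repeat apply Rmin_pos; assumption|]. split; [nra|]. intros h Hh.
  assert (Cmod h <= d3 /\ Cmod h <= d2 /\ Cmod h <= d1 / (L + 1))%R as (A1 & A2 & A3).
  { pose proof (Rmin_l (Rmin d3 d2) (d1 / (L + 1))). pose proof (Rmin_r (Rmin d3 d2) (d1 / (L + 1))).
    pose proof (Rmin_l d3 d2). pose proof (Rmin_r d3 d2). repeat split; lra. }
  specialize (G h A1). specialize (H2 h A2). pose proof (Cmod_ge_0 h).
  apply Rle_div_r in A3; [|lra].
  remember (g (x + h) - g x) as k eqn:Ek.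
  assert (Cmod k <= d1)%R as Hk by nra. specialize (H1 k Hk).
  replace (g (x + h)) with (g x + k) by (rewrite Ek; ring).
  replace (f (g x + k) - f (g x) - h * (m * l)) with
    ((f (g x + k) - f (g x) - k * l) + (k - h * m) * l) by ring.
  eapply Rle_trans; [apply Cmod_triangle|]. rewrite Cmod_mult.
  pose proof (Cmod_ge_0 k).
  assert (Cmod k ^ 2 <= L ^ 2 * Cmod h ^ 2)%R.
  { replace (L ^ 2 * Cmod h ^ 2)%R with ((L * Cmod h) ^ 2)%R by ring. apply pow_incr. lra. }
  assert (Cmod (k - h * m)%C * Cmod l <= K2 * Cmod h ^ 2 * Cmod l)%R by (apply Rmult_le_compat_r; assumption).
  nra.
Qed.

Lemma qder_scal c f x l : qder f x l -> qder (fun y => c * f y) x (c * l).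
Proof.
  intros H. eapply qder_val; [exact (qder_mult _ _ _ _ _ (qder_const c x) H)|cbv beta; ring].
Qed.

Lemma qder_inv (x : C) : x <> 0 -> qder (fun y => / y) x (- (/ (x * x))).
Proof.
  intros Hx. assert (0 < Cmod x)%R as Hm by now apply Cmod_gt_0.
  exists (Cmod x / 2)%R, (2 / Cmod x ^ 3)%R.
  split; [lra|]. split; [apply Rlt_le, Rdiv_lt_0_compat; [lra|now apply pow_lt]|]. intros h Hh.
  assert (Cmod x / 2 <= Cmod (x + h))%R as Hb.
  { replace (x + h) with (x - - h) by ring. pose proof (Cmod_sub_ge x (- h)). rewrite Cmod_opp in H. lra. }
  assert (x + h <> 0) as Hn by (apply Cmod_gt_0; lra).
  replace (/ (x + h) - / x - h * - / (x * x)) with (h * h * / (x * x * (x + h))) by (field; now split).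
  rewrite Cmod_mult, Cmod_mult, Cmod_inv by (repeat apply Cmult_neq_0; assumption).
  rewrite !Cmod_mult.
  replace (2 / Cmod x ^ 3 * Cmod h ^ 2)%R with (Cmod h * Cmod h * (2 / Cmod x ^ 3))%R by ring.
  apply Rmult_le_compat_l; [pose proof (Cmod_ge_0 h); nra|].
  replace (2 / Cmod x ^ 3)%R with (/ (Cmod x * Cmod x * (Cmod x / 2)))%R by (field; lra).
  apply Rinv_le_contravar; [repeat apply Rmult_lt_0_compat; lra|]. apply Rmult_le_compat_l; [nra|assumption].
Qed.

(** The bridge to the differentiability demanded of a form, and the source of uniqueness of
    derivatives in [qder_unique]. *)
Lemma qder_is_derive f x l : qder f x l -> is_derive (K := C_AbsRing) (V := C_NormedModule) f x l.
Proof.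
  intros (d & K & Hd & HK & H). split.
  - apply (is_linear_scal_l (K := C_AbsRing) (V := C_NormedModule) l).
  - intros y Hy eps.
    assert (y = x) as -> .
    { symmetry. exact (is_filter_lim_locally_unique (K := C_AbsRing) (V := AbsRing_NormedModule C_AbsRing) x y Hy). }
    assert (He : (0 < eps / (K + 1))%R) by (apply Rdiv_lt_0_compat; [apply cond_pos|lra]).
    apply (locally_le_locally_norm (K := C_AbsRing) (V := AbsRing_NormedModule C_AbsRing)).
    exists (mkposreal (Rmin d (eps / (K + 1))) (Rmin_pos _ _ Hd He)). intros z Hz. change C in z.
    change (Cmod (z - x) < Rmin d (eps / (K + 1)))%R in Hz.
    change (Cmod ((f z - f x) - (z - x) * l) <= eps * Cmod (z - x))%R.
    assert (Cmod (z - x) <= d)%R as A1 by (pose proof (Rmin_l d (eps / (K + 1))); lra).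
    assert (Cmod (z - x) <= eps / (K + 1))%R as A2 by (pose proof (Rmin_r d (eps / (K + 1))); lra).
    specialize (H (z - x) A1). replace (x + (z - x)) with z in H by ring.
    eapply Rle_trans; [exact H|]. apply Rle_div_r in A2; [|lra]. pose proof (Cmod_ge_0 (z - x)).
    simpl pow. nra.
Qed.

(** Differentiates an identity between functions: two formulas for one function have equal
    derivatives. [Cser_lin_geom] and [E2_UHP] are obtained in this way. *)
Lemma qder_unique f x l l' : qder f x l -> qder f x l' -> l = l'.
Proof.
  intros H H'. apply qder_is_derive in H. apply qder_is_derive in H'.
  now rewrite <- (is_C_derive_unique f x l H), <- (is_C_derive_unique f x l' H').
Qed.

Lemma is_derive_quad (f : R -> R) (t l d K : R) : (0 < d)%R -> (0 <= K)%R ->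
  (forall s, Rabs s <= d -> Rabs (f (t + s) - f t - s * l) <= K * s ^ 2)%R -> is_derive f t l.
Proof.
  intros Hd HK H. apply is_derive_Reals. intros eps Heps.
  assert (He : (0 < Rmin d (eps / (K + 1)))%R) by (apply Rmin_pos; [assumption|apply Rdiv_lt_0_compat; lra]).
  exists (mkposreal _ He). simpl. intros h Hh Hlt.
  assert (Rabs h <= d)%R as A1 by (pose proof (Rmin_l d (eps / (K + 1))); lra).
  assert (Rabs h < eps / (K + 1))%R as A2 by (pose proof (Rmin_r d (eps / (K + 1))); lra).
  specialize (H h A1).
  replace ((f (t + h) - f t) / h - l)%R with ((f (t + h) - f t - h * l) / h)%R by (field; assumption).
  unfold Rdiv. rewrite Rabs_mult, Rabs_inv. pose proof (Rabs_pos_lt h Hh).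
  apply Rlt_div_r in A2; [|lra]. apply Rlt_div_l; [lra|].
  rewrite <- (pow2_abs h) in H. simpl in H. nra.
Qed.

(** The real and imaginary parts along the segment are real functions with zero derivative. All
    integration is done in this form: to identify two functions, a quotient or product of them is
    shown to have zero derivative. *)
Lemma qder_zero_const f a b :
  (forall t : R, (0 <= t <= 1)%R -> qder f (a + t * (b - a)) 0) -> f a = f b.
Proof.
  intros H.
  assert (G : forall (p : C -> R), (forall u v, Rabs (p u - p v) <= Cmod (u - v)%C)%R -> p (f a) = p (f b)).
  { intros p Hp.
    pose proof (eq_is_derive (V := R_NormedModule) (fun t : R => p (f (a + t * (b - a)))) 0 1) as E.
    cbv beta in E. replace (a + 0 * (b - a)) with a in E by ring.
    replace (a + 1 * (b - a)) with b in E by ring. apply E; [|lra]. clear E.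
    intros t Ht. destruct (H t Ht) as (d & K & Hd & HK & Hq).
    pose proof (Cmod_ge_0 (b - a)).
    apply (is_derive_quad _ t zero (d / (Cmod (b - a) + 1)) (K * Cmod (b - a) ^ 2)).
    - apply Rdiv_lt_0_compat; lra.
    - nra.
    - intros s Hs. apply Rle_div_r in Hs; [|lra].
      change (@zero R_NormedModule) with 0%R. rewrite Rmult_0_r, Rminus_0_r.
      eapply Rle_trans; [apply Hp|].
      assert (E1 : Cmod (s * (b - a)) = (Rabs s * Cmod (b - a))%R) by now rewrite Cmod_mult, Cmod_R.
      specialize (Hq (s * (b - a))). rewrite E1 in Hq.
      replace (a + (t + s)%R * (b - a)) with (a + t * (b - a) + s * (b - a)) by (rewrite RtoC_plus; ring).
      replace (f (a + t * (b - a) + s * (b - a)) - f (a + t * (b - a))) with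
        (f (a + t * (b - a) + s * (b - a)) - f (a + t * (b - a)) - s * (b - a) * 0) by ring.
      eapply Rle_trans; [apply Hq; pose proof (Rabs_pos s); nra|].
      rewrite Rpow_mult_distr, pow2_abs. apply Req_le. ring. }
  apply injective_projections.
  - apply (G fst). intros u v. apply (re_le_Cmod (u - v)).
  - apply (G snd). intros u v. eapply Rle_trans; [|apply Rmax_Cmod]. apply (Rmax_r (Rabs (fst (u - v)))).
Qed.

(** * The complex exponential *)

Lemma cexp_plus a b : cexp (a + b) = cexp a * cexp b.
Proof.
  unfold cexp. change (Re (a + b)) with (Re a + Re b)%R. change (Im (a + b)) with (Im a + Im b)%R.
  rewrite exp_plus, cos_plus, sin_plus. unfold Cmult, fst, snd. f_equal; ring.
Qed.

Lemma cexp_0 : cexp 0 = 1.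
Proof. unfold cexp, RtoC; simpl. rewrite exp_0, cos_0, sin_0. f_equal; ring. Qed.

Lemma cexp_neq0 a : cexp a <> 0.
Proof.
  intros H. apply C1_nz. rewrite <- cexp_0. replace (RtoC 0) with (a + - a) at 1 by ring.
  rewrite cexp_plus, H. ring.
Qed.

Lemma cexp_opp a : cexp (- a) = / cexp a.
Proof.
  pose proof (cexp_neq0 a). apply (Cmult_reg_l (cexp a)); [assumption|].
  rewrite <- cexp_plus. replace (a + - a) with (RtoC 0) by ring. rewrite cexp_0. now field.
Qed.

Lemma cexp_INR n a : cexp (INR n * a) = cexp a ^ n.
Proof.
  induction n as [|n IH].
  - simpl. replace (0 * a) with (RtoC 0) by ring. apply cexp_0.
  - rewrite S_INR, RtoC_plus. replace ((INR n + 1) * a) with (a + INR n * a) by ring.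
    now rewrite cexp_plus, IH, Cpow_S.
Qed.

Lemma Cmod_cexp a : Cmod (cexp a) = exp (Re a).
Proof.
  unfold Cmod, cexp; simpl.
  replace (exp (Re a) * cos (Im a) * (exp (Re a) * cos (Im a) * 1) +
     exp (Re a) * sin (Im a) * (exp (Re a) * sin (Im a) * 1))%R with
    (exp (Re a) * exp (Re a) * (Rsqr (sin (Im a)) + Rsqr (cos (Im a))))%R by (unfold Rsqr; ring).
  rewrite sin2_cos2, Rmult_1_r. apply sqrt_square, Rlt_le, exp_pos.
Qed.

(** Both bounds come from [1 + x <= exp x], used at [a] and at [- a]. *)
Lemma exp_quad a : (Rabs a <= 1/2 -> Rabs (exp a - 1 - a) <= 2 * a ^ 2 /\ exp a <= 2)%R.
Proof.
  intros Ha. apply Rabs_le_between in Ha.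
  pose proof (exp_ineq1_le a) as H1. pose proof (exp_ineq1_le (- a)) as H2.
  rewrite exp_Ropp in H2. pose proof (exp_pos a) as H3.
  assert (exp a * (1 - a) <= 1)%R as H4.
  { apply Rmult_le_reg_l with (/ exp a)%R; [now apply Rinv_0_lt_compat|].
    field_simplify; [|lra|lra]. unfold Rdiv. rewrite Rmult_1_l. lra. }
  split; [|nra]. rewrite Rabs_pos_eq by lra. nra.
Qed.

Lemma Rabs_sin_le x : (Rabs (sin x) <= Rabs x)%R.
Proof.
  destruct (Req_dec x 0) as [->|Hx]; [rewrite sin_0, Rabs_R0; lra|].
  destruct (MVT_gen sin 0 x cos) as (c & Hc & E).
  - intros t _. apply is_derive_Reals, derivable_pt_lim_sin.
  - intros t _. apply continuity_sin.
  - rewrite sin_0, !Rminus_0_r in E. rewrite E, Rabs_mult. pose proof (Rabs_pos x).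
    assert (Rabs (cos c) <= 1)%R by (apply Rabs_le; split; apply COS_bound). nra.
Qed.

Lemma cos_quad x : (Rabs (cos x - 1) <= x ^ 2)%R.
Proof.
  replace x with (2 * (x / 2))%R at 1 by field. rewrite cos_2a_sin.
  replace (1 - 2 * sin (x / 2) * sin (x / 2) - 1)%R with (- (2 * sin (x / 2) ^ 2))%R by ring.
  rewrite Rabs_Ropp, Rabs_pos_eq by (pose proof (pow2_ge_0 (sin (x / 2))); lra).
  rewrite <- (pow2_abs (sin (x / 2))), <- (pow2_abs x).
  pose proof (Rabs_sin_le (x / 2)) as H. pose proof (Rabs_pos (sin (x / 2))).
  unfold Rdiv in *. rewrite Rabs_mult, (Rabs_pos_eq (/ 2)) in H by lra. nra.
Qed.

Lemma sin_quad x : (Rabs x <= 1 -> Rabs (sin x - x) <= x ^ 2)%R.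
Proof.
  intros Hx1.
  destruct (MVT_gen (fun t => sin t - t)%R 0 x (fun t => cos t - 1)%R) as (c & Hc & E).
  - intros t _. apply (is_derive_minus (V := R_NormedModule) sin (fun t => t)).
    + apply is_derive_Reals, derivable_pt_lim_sin.
    + apply (is_derive_id (K := R_AbsRing)).
  - intros t _. apply continuity_pt_minus; [apply continuity_sin|].
    apply derivable_continuous_pt, derivable_pt_id.
  - rewrite sin_0, !Rminus_0_r in E. rewrite E, Rabs_mult.
    pose proof (cos_quad c) as Q. rewrite <- (pow2_abs c) in Q. rewrite <- (pow2_abs x).
    assert (Rabs c <= Rabs x)%R.
    { unfold Rmin, Rmax in Hc. destruct (Rle_dec 0 x).
      - rewrite !Rabs_pos_eq by lra. lra.
      - rewrite !Rabs_left1 by lra. lra. }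
    pose proof (Rabs_pos c). pose proof (Rabs_pos x). pose proof (Rabs_pos (cos c - 1)). nra.
Qed.

Lemma Cmod_le_Re_Im (z : C) : (Cmod z <= Rabs (Re z) + Rabs (Im z))%R.
Proof.
  replace z with (RtoC (Re z) + Coquelicot.Complex.Ci * RtoC (Im z)) at 1.
  - eapply Rle_trans; [apply Cmod_triangle|]. rewrite Cmod_mult, Cmod_Ci, !Cmod_R. lra.
  - destruct z as [a b]. unfold Cmult, Cplus, RtoC, Complex.Ci; simpl. f_equal; ring.
Qed.

Lemma im_le_Cmod (z : C) : (Rabs (Im z) <= Cmod z)%R.
Proof. eapply Rle_trans; [|apply Rmax_Cmod]. apply (Rmax_r (Rabs (fst z))). Qed.

(** The real and the imaginary part contribute at most [4 * Cmod h ^ 2] each; the constant [10] is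
    not sharp. *)
Lemma cexp_quad h : (Cmod h <= 1/2 -> Cmod (cexp h - 1 - h)%C <= 10 * Cmod h ^ 2)%R.
Proof.
  intros Hh. pose proof (re_le_Cmod h) as Ha. pose proof (im_le_Cmod h) as Hb.
  set (a := Re h) in *. set (b := Im h) in *. set (m := Cmod h) in *.
  destruct (exp_quad a) as [E1 E2]; [lra|].
  pose proof (cos_quad b) as E3. pose proof (sin_quad b ltac:(lra)) as E4.
  eapply Rle_trans; [apply Cmod_le_Re_Im|].
  replace (Re (cexp h - 1 - h)) with ((exp a - 1 - a) + exp a * (cos b - 1))%R
    by (symmetry; transitivity (exp a * cos b + - (1) + - a)%R; [reflexivity|ring]).
  replace (Im (cexp h - 1 - h)) with (exp a * (sin b - b) + ((exp a - 1 - a) + a) * b)%R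
    by (symmetry; transitivity (exp a * sin b + - (0) + - b)%R; [reflexivity|ring]).
  pose proof (exp_pos a). rewrite <- (pow2_abs a) in E1. rewrite <- (pow2_abs b) in E3, E4.
  pose proof (Rabs_pos a). pose proof (Rabs_pos b).
  assert (Rabs a ^ 2 <= m ^ 2)%R by (apply pow_incr; lra).
  assert (Rabs b ^ 2 <= m ^ 2)%R by (apply pow_incr; lra).
  assert (Rabs a * Rabs b <= m ^ 2)%R by (simpl; rewrite Rmult_1_r; apply Rmult_le_compat; lra).
  pose proof (Rabs_triang (exp a - 1 - a) (exp a * (cos b - 1))) as T1.
  pose proof (Rabs_triang (exp a * (sin b - b)) (((exp a - 1 - a) + a) * b)) as T2.
  pose proof (Rabs_triang (exp a - 1 - a) a) as T3.
  rewrite Rabs_mult, (Rabs_pos_eq (exp a)) in T1 by lra.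
  rewrite !Rabs_mult, (Rabs_pos_eq (exp a)) in T2 by lra.
  assert (exp a * Rabs (cos b - 1) <= 2 * m ^ 2)%R by (pose proof (Rabs_pos (cos b - 1)); nra).
  assert (exp a * Rabs (sin b - b) <= 2 * m ^ 2)%R by (pose proof (Rabs_pos (sin b - b)); nra).
  assert (Rabs (exp a - 1 - a + a) * Rabs b <= 2 * m ^ 2)%R.
  { apply Rle_trans with ((2 * Rabs a ^ 2 + Rabs a) * Rabs b)%R; [apply Rmult_le_compat_r; lra|].
    assert (Rabs a ^ 2 <= Rabs a / 2)%R by (simpl; nra).
    nra. }
  pose proof (pow2_ge_0 m). lra.
Qed.

Lemma qder_cexp x : qder cexp x (cexp x).
Proof.
  exists (1/2)%R, (10 * Cmod (cexp x))%R. pose proof (Cmod_ge_0 (cexp x)).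
  split; [lra|]. split; [lra|]. intros h Hh. rewrite cexp_plus.
  replace (cexp x * cexp h - cexp x - h * cexp x) with (cexp x * (cexp h - 1 - h)) by ring.
  rewrite Cmod_mult. pose proof (cexp_quad h Hh). nra.
Qed.

(** * Differentiation of power series *)

Definition psabs (c : nat -> C) (r : R) : Prop := ex_series (fun n => (Cmod (c n) * r ^ n)%R).
Definition ev (c : nat -> C) (x : C) : C := Cser (fun n => c n * x ^ n).
Definition dco (c : nat -> C) (n : nat) : C := INR (S n) * c (S n).

Lemma cabs_ev c r x : psabs c r -> (Cmod x <= r)%R -> cabs (fun n => c n * x ^ n).
Proof.
  intros H Hx. eapply cabs_le; [|exact H]. intros n. cbv beta. rewrite Cmod_mult, Cmod_pow.
  apply Rmult_le_compat_l; [apply Cmod_ge_0|]. apply pow_incr. split; [apply Cmod_ge_0|assumption].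
Qed.

Lemma pow_lip x h d n : (0 < d)%R -> (Cmod h <= d)%R ->
  (Cmod ((x + h) ^ n - x ^ n)%C <= Cmod h / d * (Cmod x + d) ^ n)%R.
Proof.
  intros Hd Hh. pose proof (Cmod_ge_0 x). pose proof (Cmod_ge_0 h).
  assert (0 <= Cmod h / d)%R by (apply Rmult_le_pos; [lra|apply Rlt_le, Rinv_0_lt_compat; lra]).
  assert (Cmod h = Cmod h / d * d)%R as Eh by (field; lra).
  induction n as [|n IH].
  - simpl. replace (1 - 1) with (RtoC 0) by ring. rewrite Cmod_0. lra.
  - rewrite !Cpow_S. replace ((x + h) * (x + h) ^ n - x * x ^ n)
      with ((x + h) * ((x + h) ^ n - x ^ n) + h * x ^ n) by ring.
    replace ((x + h) * ((x + h) ^ n - x ^ n) + h * x ^ n) with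
      (x * ((x + h) ^ n - x ^ n) + h * (x + h) ^ n) by ring.
    eapply Rle_trans; [apply Cmod_triangle|]. rewrite !Cmod_mult, Cmod_pow.
    assert (Cmod (x + h) ^ n <= (Cmod x + d) ^ n)%R.
    { apply pow_incr. split; [apply Cmod_ge_0|]. pose proof (Cmod_triangle x h). lra. }
    assert (0 <= (Cmod x + d) ^ n)%R by (apply pow_le; lra).
    simpl. pose proof (Cmod_ge_0 ((x + h) ^ n - x ^ n)).
    apply Rle_trans with (Cmod x * (Cmod h / d * (Cmod x + d) ^ n) + Cmod h * (Cmod x + d) ^ n)%R.
    + apply Rplus_le_compat; apply Rmult_le_compat_l; assumption.
    + rewrite Eh at 2. apply Req_le. ring.
Qed.

(** In the binomial expansion the terms of order [j >= 2] in [h] satisfy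
    [|h|^j <= (|h| / d)^2 * d^j]. The bound carries no factor depending on [n], so that absolute
    convergence at radius [|x| + d] alone controls the remainder of the whole series. *)
Lemma pow_quad x h d n : (0 < d)%R -> (Cmod h <= d)%R ->
  (Cmod ((x + h) ^ n - x ^ n - h * (INR n * x ^ (n - 1)))%C <= (Cmod h / d) ^ 2 * (Cmod x + d) ^ n)%R.
Proof.
  intros Hd Hh. pose proof (Cmod_ge_0 x). pose proof (Cmod_ge_0 h).
  assert (0 <= Cmod h / d)%R by (apply Rmult_le_pos; [lra|apply Rlt_le, Rinv_0_lt_compat; lra]).
  assert (Cmod h = Cmod h / d * d)%R as Eh by (field; lra).
  induction n as [|n IH].
  - simpl. replace (1 - 1 - h * (0 * 1)) with (RtoC 0) by ring. rewrite Cmod_0.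
    pose proof (pow2_ge_0 (Cmod h / d)). nra.
  - replace ((x + h) ^ S n - x ^ S n - h * (INR (S n) * x ^ (S n - 1))) with
      (x * ((x + h) ^ n - x ^ n - h * (INR n * x ^ (n - 1))) + h * ((x + h) ^ n - x ^ n)).
    2:{ rewrite S_INR, RtoC_plus. destruct n as [|n].
        - simpl. ring.
        - replace (S (S n) - 1)%nat with (S n) by lia. replace (S n - 1)%nat with n by lia.
          rewrite !Cpow_S. ring. }
    eapply Rle_trans; [apply Cmod_triangle|]. rewrite !Cmod_mult.
    pose proof (pow_lip x h d n Hd Hh) as L.
    apply Rle_trans with (Cmod x * ((Cmod h / d) ^ 2 * (Cmod x + d) ^ n) + Cmod h * (Cmod h / d * (Cmod x + d) ^ n))%R.
    + apply Rplus_le_compat; apply Rmult_le_compat_l; assumption.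
    + rewrite Eh at 2. simpl. apply Req_le. ring.
Qed.

(** The left side is the term linear in [d] of the binomial expansion of the right side. *)
Lemma pow_der_bound (a d : R) n : (0 <= a)%R -> (0 < d)%R -> (INR n * a ^ (n - 1) * d <= (a + d) ^ n)%R.
Proof.
  intros Ha Hd. induction n as [|n IH]; [simpl; lra|].
  rewrite S_INR. destruct n as [|n]; [simpl; lra|].
  replace (S (S n) - 1)%nat with (S n) by lia. replace (S n - 1)%nat with n in IH by lia.
  assert (a ^ S n <= (a + d) ^ S n)%R by (apply pow_incr; lra).
  assert (0 <= (a + d) ^ S n)%R by (apply pow_le; lra).
  change ((a + d) ^ S (S n))%R with ((a + d) * (a + d) ^ S n)%R. 
  assert (INR (S n) * a ^ S n * d <= a * (a + d) ^ S n)%R.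
  { replace (INR (S n) * a ^ S n * d)%R with (a * (INR (S n) * a ^ n * d))%R by (simpl; ring).
    apply Rmult_le_compat_l; assumption. }
  nra.
Qed.

Lemma cabs_dco c r x : psabs c r -> (Cmod x < r)%R -> cabs (fun n => dco c n * x ^ n).
Proof.
  intros H Hx. pose proof (Cmod_ge_0 x). set (d := (r - Cmod x)%R). assert (0 < d)%R by (unfold d; lra).
  apply cabs_le with (fun n => (/ d * (Cmod (c (S n)) * r ^ S n))%R).
  - intros n. unfold dco. rewrite !Cmod_mult, Cmod_R, Cmod_pow, Rabs_pos_eq by apply pos_INR.
    pose proof (pow_der_bound (Cmod x) d (S n) H0 H1) as B.
    replace (S n - 1)%nat with n in B by lia. replace (Cmod x + d)%R with r in B by (unfold d; ring).
    apply (Rmult_le_compat_l (/ d * Cmod (c (S n)))) in B.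
    2:{ apply Rmult_le_pos; [apply Rlt_le, Rinv_0_lt_compat; lra|apply Cmod_ge_0]. }
    rewrite <- Rmult_assoc. eapply Rle_trans; [|exact B]. apply Req_le. field. lra.
  - apply (ex_series_scal_l (/ d)%R (fun n => (Cmod (c (S n)) * r ^ S n)%R)).
    apply (ex_series_incr_1 (fun n => (Cmod (c n) * r ^ n)%R)). exact H.
Qed.

(** With [d = r - |x|] the bound of [pow_quad] sums to a multiple of the absolutely convergent
    series at [r]. *)
Lemma qder_ev c r x : psabs c r -> (Cmod x < r)%R -> qder (ev c) x (ev (dco c) x).
Proof.
  intros H Hx. pose proof (Cmod_ge_0 x). set (d := (r - Cmod x)%R). assert (0 < d)%R as Hd by (unfold d; lra).
  exists d, (Series (fun n => Cmod (c n) * r ^ n)%R / d ^ 2)%R.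
  assert (0 <= Series (fun n => Cmod (c n) * r ^ n)%R)%R.
  { replace 0%R with (Cmod 0) by apply Cmod_0. 
    replace (RtoC 0) with (Cser (fun _ => 0)) by now rewrite (Cser_fin _ O).
    apply Cser_Cmod_le; [|exact H]. intros n. rewrite Cmod_0. apply Rmult_le_pos; [apply Cmod_ge_0|apply pow_le; lra]. }
  split; [assumption|]. split.
  { apply Rmult_le_pos; [assumption|]. apply Rlt_le, Rinv_0_lt_compat, pow_lt. assumption. }
  intros h Hh.
  assert (Cmod (x + h) <= r)%R as Hxh by (pose proof (Cmod_triangle x h); unfold d in Hh; lra).
  pose proof (cabs_ev c r (x + h) H Hxh) as A1. pose proof (cabs_ev c r x H (Rlt_le _ _ Hx)) as A2.
  pose proof (cabs_dco c r x H Hx) as A3.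
  assert (A4 : cabs (fun n => INR n * (c n * x ^ (n - 1)))).
  { apply (cabs_shift _ 1). eapply cabs_ext; [|exact A3]. intros n.
    change (dco c n * x ^ n = INR (S n) * (c (S n) * x ^ (S n - 1))). unfold dco. replace (S n - 1)%nat with n by lia. ring. }
  assert (E : ev (dco c) x = Cser (fun n => INR n * (c n * x ^ (n - 1)))).
  { rewrite (Cser_S_l _ A4). change (INR 0) with 0%R. rewrite Cmult_0_l, Cplus_0_l. apply Cser_ext. intros n.
    unfold dco. replace (S n - 1)%nat with n by lia. ring. }
  rewrite E. unfold ev. rewrite <- Cser_minus, <- Cser_scal, <- Cser_minus; try assumption.
  2:{ now apply cabs_minus. } 2:{ now apply cabs_scal. }
  replace (Series (fun n => Cmod (c n) * r ^ n)%R / d ^ 2 * Cmod h ^ 2)%R with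
    (Series (fun n => (Cmod h / d) ^ 2 * (Cmod (c n) * r ^ n))%R) by (rewrite Series_scal_l; field; lra).
  apply Cser_Cmod_le.
  - intros n.
    replace (c n * (x + h) ^ n - c n * x ^ n - h * (INR n * (c n * x ^ (n - 1)))) with
      (c n * ((x + h) ^ n - x ^ n - h * (INR n * x ^ (n - 1)))) by ring.
    rewrite Cmod_mult. pose proof (pow_quad x h d n Hd Hh) as Q.
    replace (Cmod x + d)%R with r in Q by (unfold d; ring).
    apply (Rmult_le_compat_l (Cmod (c n))) in Q; [|apply Cmod_ge_0].
    eapply Rle_trans; [exact Q|]. apply Req_le. ring.
  - apply (ex_series_scal_l ((Cmod h / d) ^ 2)%R (fun n => (Cmod (c n) * r ^ n)%R)). exact H.
Qed.

(** * The algebra of series converging in the open unit disc *)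

Definition rad1 (c : nat -> C) : Prop := forall r : R, (0 <= r < 1)%R -> psabs c r.

Lemma cabs_rad1 c x : rad1 c -> (Cmod x < 1)%R -> cabs (fun n => c n * x ^ n).
Proof.
  intros H Hx. apply cabs_ev with (Cmod x); [|lra]. apply H. split; [apply Cmod_ge_0|assumption].
Qed.

Lemma psabs_cabs c (r : R) : (0 <= r)%R -> cabs (fun n => c n * r ^ n) -> psabs c r.
Proof.
  intros Hr H. eapply ex_series_ext; [|exact H]. intros n. cbv beta.
  rewrite Cmod_mult, Cmod_pow, Cmod_R, Rabs_pos_eq by assumption. reflexivity.
Qed.

Lemma rad1_cabs c : (forall r : R, (0 <= r < 1)%R -> cabs (fun n => c n * r ^ n)) -> rad1 c.
Proof. intros H r Hr. apply psabs_cabs; [lra|auto]. Qed.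

Lemma conv_pow a b x n : conv (fun n => a n * x ^ n) (fun n => b n * x ^ n) n = conv a b n * x ^ n.
Proof.
  unfold conv. rewrite Cmult_comm, <- csum_scal. apply csum_ext. intros k Hk.
  replace n with (k + (n - k))%nat at 3 by lia. rewrite Cpow_add_r. ring.
Qed.

Lemma rsum_sum_f_R0 f n : rsum f (S n) = sum_f_R0 f n.
Proof. induction n as [|n IH]; [simpl; ring|]. simpl sum_f_R0. rewrite <- IH. reflexivity. Qed.

(** The weighted [l^1] norm at radius [r]. It is submultiplicative for [conv], which keeps the
    powers of a series under control when it is exponentiated. *)
Definition nrm (a : nat -> C) (r : R) : R := Series (fun n => Cmod (a n) * r ^ n)%R.

Lemma nrm_conv a b r : (0 <= r)%R -> psabs a r -> psabs b r ->
  psabs (conv a b) r /\ (nrm (conv a b) r <= nrm a r * nrm b r)%R.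
Proof.
  intros Hr Ha Hb.
  assert (P : forall c n, (0 <= Cmod (c n) * r ^ n)%R).
  { intros c n. apply Rmult_le_pos; [apply Cmod_ge_0|now apply pow_le]. }
  assert (E : forall c, psabs c r -> ex_series (fun n => Rabs (Cmod (c n) * r ^ n))).
  { intros c Hc. eapply ex_series_ext; [|exact Hc]. intros n. cbv beta. now rewrite Rabs_pos_eq. }
  pose proof (is_series_mult _ _ _ _ (Series_correct _ Ha) (Series_correct _ Hb) (E a Ha) (E b Hb)) as S.
  assert (B : forall n, (0 <= Cmod (conv a b n) * r ^ n <=
     sum_f_R0 (fun k => Cmod (a k) * r ^ k * (Cmod (b (n - k)%nat) * r ^ (n - k))) n)%R).
  { intros n. split; [apply (P (conv a b))|]. rewrite <- rsum_sum_f_R0.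
    replace (Cmod (conv a b n) * r ^ n)%R with (Cmod (conv (fun n => a n * r ^ n) (fun n => b n * r ^ n) n)).
    2:{ now rewrite conv_pow, Cmod_mult, Cmod_pow, Cmod_R, Rabs_pos_eq by assumption. }
    apply Cmod_csum_le. intros k _. rewrite !Cmod_mult, !Cmod_pow, Cmod_R, Rabs_pos_eq by assumption. lra. }
  split.
  (* The explicit term is the domination required, with the absolute value of a nonnegative number
     rewritten away. *)
  - apply (ex_series_le (K := R_AbsRing) (V := R_CompleteNormedModule) _ _ (fun n => eq_ind_r (fun x => x <= _)%R (proj2 (B n)) (Rabs_pos_eq _ (proj1 (B n))))).
    eexists; exact S.
  - unfold nrm. rewrite <- (is_series_unique _ _ S). apply Series_le; [exact B|]. eexists; exact S.
Qed.

Lemma rad1_conv a b : rad1 a -> rad1 b -> rad1 (conv a b).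
Proof. intros Ha Hb r Hr. apply nrm_conv; [lra|auto|auto]. Qed.

Lemma ev_conv a b x : rad1 a -> rad1 b -> (Cmod x < 1)%R -> ev (conv a b) x = ev a x * ev b x.
Proof.
  intros Ha Hb Hx. unfold ev.
  rewrite <- (proj2 (Cser_conv _ _ (cabs_rad1 a x Ha Hx) (cabs_rad1 b x Hb Hx))).
  apply Cser_ext. intros n. symmetry. apply conv_pow.
Qed.

Lemma conv_0 a b : conv a b 0 = a O * b O.
Proof. unfold conv; simpl. ring. Qed.

Definition cone (n : nat) : C := match n with O => 1 | _ => 0 end.

Fixpoint cpow (a : nat -> C) (k : nat) : nat -> C :=
  match k with O => cone | S j => conv a (cpow a j) end.

Lemma rad1_fin (a : nat -> C) N : (forall n, (N <= n)%nat -> a n = 0) -> rad1 a.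
Proof.
  intros H. apply rad1_cabs. intros r Hr. apply cabs_fin with N. intros m Hm. rewrite H by assumption. ring.
Qed.

Lemma rad1_cone : rad1 cone.
Proof. apply rad1_fin with 1%nat. intros [|n] Hn; [lia|reflexivity]. Qed.

Lemma ev_cone x : ev cone x = 1.
Proof.
  unfold ev. rewrite (Cser_fin _ 1). { simpl. ring. }
  intros [|n] Hn; [lia|]. simpl. ring.
Qed.

Lemma rad1_cpow a k : rad1 a -> rad1 (cpow a k).
Proof. intros Ha. induction k; simpl; [apply rad1_cone|now apply rad1_conv]. Qed.

Lemma ev_cpow a k x : rad1 a -> (Cmod x < 1)%R -> ev (cpow a k) x = ev a x ^ k.
Proof.
  intros Ha Hx. induction k; simpl; [apply ev_cone|].
  rewrite ev_conv by (try apply rad1_cpow; assumption). now rewrite IHk.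
Qed.

Lemma cpow_0 a k : cpow a k 0 = a O ^ k.
Proof. induction k; simpl; [reflexivity|]. now rewrite conv_0, IHk. Qed.

Lemma nrm_cone r : nrm cone r = 1%R.
Proof.
  unfold nrm. apply is_series_unique.
  match goal with |- is_series ?u ?v => change (is_lim_seq (sum_n u) v) end.
  apply is_lim_seq_ext with (fun _ => 1%R); [|apply is_lim_seq_const].
  intros n. rewrite sum_n_rsum. induction n as [|n IH].
  - simpl. rewrite Cmod_1. ring.
  - change (1 = rsum (fun n => Cmod (cone n) * r ^ n) (S n) + Cmod 0 * r ^ S n)%R.
    rewrite <- IH, Cmod_0. ring.
Qed.

Lemma nrm_pos a r : (0 <= r)%R -> psabs a r -> (0 <= nrm a r)%R.
Proof.
  intros Hr Ha. pose proof (rsum_le_Series (fun n => Cmod (a n) * r ^ n)%R 0 Ha) as H.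
  apply H. intros k. apply Rmult_le_pos; [apply Cmod_ge_0|now apply pow_le].
Qed.

Lemma nrm_cpow a k r : rad1 a -> (0 <= r < 1)%R -> (nrm (cpow a k) r <= nrm a r ^ k)%R.
Proof.
  intros Ha Hr. induction k as [|k IH]; simpl; [rewrite nrm_cone; lra|].
  destruct (nrm_conv a (cpow a k) r) as [_ H]; [lra|now apply Ha|now apply rad1_cpow|].
  eapply Rle_trans; [exact H|]. apply Rmult_le_compat_l; [apply nrm_pos; [lra|now apply Ha]|exact IH].
Qed.

Lemma RtoC_Series (f : nat -> R) : ex_series f -> (forall n, (0 <= f n)%R) ->
  Cser (fun n => RtoC (f n)) = Series f.
Proof.
  intros H H0. apply Cser_unique; [|now apply csums_RtoC].
  apply cabs_le with f; [|exact H]. intros n. rewrite Cmod_R, Rabs_pos_eq by apply H0. lra.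
Qed.

(** * The exponential of a power series *)

Definition ifact (n : nat) : C := RtoC (/ INR (fact n)).

Lemma psabs_ifact r : (0 <= r)%R -> psabs ifact r.
Proof.
  intros Hr. pose proof (is_exp_Reals r) as H. unfold is_pseries in H.
  exists (exp r). eapply is_series_ext; [|exact H]. intros n. cbv beta.
  unfold ifact. rewrite Cmod_R, Rabs_pos_eq.
  - rewrite Rmult_comm. rewrite pow_n_pow. reflexivity.
  - apply Rlt_le, Rinv_0_lt_compat, INR_fact_lt_0.
Qed.

Lemma cexp_series w : cexp w = ev ifact w.
Proof.
  assert (D : forall x, qder (ev ifact) x (ev ifact x)).
  { intros x. eapply qder_val; [apply (qder_ev ifact (Cmod x + 1)); [apply psabs_ifact; pose proof (Cmod_ge_0 x); lra|lra]|].
    apply Cser_ext. intros n. f_equal. unfold dco, ifact. rewrite <- RtoC_mult. f_equal.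
    change (fact (S n)) with (S n * fact n)%nat. rewrite mult_INR. field.
    split; apply not_0_INR; [apply fact_neq_0|lia]. }
  (* The series is its own derivative, so its product with [cexp (- x)] is constant. *)
  assert (E : ev ifact 0 * cexp (- (0)) = ev ifact w * cexp (- w)).
  { apply (qder_zero_const (fun x => ev ifact x * cexp (- x))). intros t _.
    eapply qder_val; [apply qder_mult; [apply D|]|].
    - apply (qder_comp cexp (fun x => - x)); [|apply qder_cexp].
      eapply qder_ext_loc with (f := fun x => (-(1)) * x) (d := 1%R); [lra|intros; ring|].
      apply qder_scal, qder_id.
    - cbv beta. ring. }
  assert (ev ifact 0 = 1) as E0.
  { unfold ev. rewrite (Cser_fin _ 1).
    - simpl. unfold ifact. simpl. rewrite Rinv_1. ring.
    - intros [|m] Hm; [lia|]. simpl. ring. }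
  rewrite E0, !cexp_opp, cexp_0 in E. pose proof (cexp_neq0 w).
  apply (Cmult_reg_l (/ cexp w)).
  - intros Z. apply C1_nz. rewrite <- (Cinv_l (cexp w)), Z by assumption. ring.
  - rewrite Cinv_l by assumption. rewrite Cmult_comm, <- E. field.
Qed.

(** Coefficients of the exponential of the series [a]. The sum over [k] is an infinite one, because
    the constant term of [a] may be nonzero. *)
Definition expco (a : nat -> C) (n : nat) : C := Cser (fun k => ifact k * cpow a k n).

(** Interchange of the summations over the powers [a^k / k!] and over the coefficients. The norm of
    [a^k] is at most the [k]-th power of the norm of [a], so the row norms are dominated by an
    exponential series. *)
Lemma exp_ps a x : rad1 a -> (Cmod x < 1)%R ->
  cabs (fun n => expco a n * x ^ n) /\ ev (expco a) x = cexp (ev a x).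
Proof.
  intros Ha Hx. pose proof (Cmod_ge_0 x) as H0.
  pose (X k n := ifact k * (cpow a k n * x ^ n)).
  assert (R1 : forall k, cabs (X k)).
  { intros k. apply cabs_scal. apply cabs_rad1; [now apply rad1_cpow|assumption]. }
  destruct (fubini X R1) as (C1 & C2 & C3 & C4).
  { pose proof (psabs_ifact (nrm a (Cmod x))) as Q.
    assert (0 <= nrm a (Cmod x))%R as Hn by (apply nrm_pos; [assumption|now apply Ha]).
    specialize (Q Hn).
    apply (ex_series_le (K := R_AbsRing) (V := R_CompleteNormedModule) _ (fun k => Cmod (ifact k) * nrm a (Cmod x) ^ k)%R); [|exact Q].
    intros k. unfold norm; simpl; unfold abs; simpl.
    assert (E : Series (fun n => Cmod (X k n)) = (Cmod (ifact k) * nrm (cpow a k) (Cmod x))%R).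
    { unfold nrm. rewrite <- Series_scal_l. apply Series_ext. intros n. unfold X. now rewrite !Cmod_mult, Cmod_pow. }
    rewrite E, Rabs_pos_eq.
    - apply Rmult_le_compat_l; [apply Cmod_ge_0|now apply nrm_cpow].
    - apply Rmult_le_pos; [apply Cmod_ge_0|apply nrm_pos; [assumption|now apply rad1_cpow]]. }
  assert (EX : forall n, Cser (fun k => X k n) = expco a n * x ^ n).
  (* At [x = 0] the factor [x^n] cannot be divided out to obtain summability over [k]. *)
  { intros n. unfold X. destruct (Req_dec (Cmod x) 0) as [Hz|Hz].
    - apply Cmod_eq_0 in Hz. subst x. destruct n as [|n].
      + simpl. unfold expco. rewrite Cmult_1_r. apply Cser_ext. intros k. ring.
      + simpl. rewrite (Cser_ext _ (fun _ => 0)) by (intros; ring). rewrite (Cser_fin _ O) by reflexivity. simpl. ring.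
    - unfold expco. rewrite Cmult_comm, <- Cser_scal.
      + apply Cser_ext. intros k. ring.
      + apply cabs_ext with (fun k => / x ^ n * X k n).
        * intros k. unfold X. field. apply Cpow_nz. intros Z. apply Hz. rewrite Z. apply Cmod_0.
        * apply cabs_scal, C1. }
  split; [eapply cabs_ext; [exact EX|exact C3]|].
  unfold ev at 1. rewrite <- (Cser_ext _ _ EX), C4, cexp_series. apply Cser_ext. intros k.
  unfold X. rewrite Cser_scal by (apply cabs_rad1; [now apply rad1_cpow|assumption]).
  f_equal. now apply ev_cpow.
Qed.

Lemma rad1_expco a : rad1 a -> rad1 (expco a).
Proof.
  intros Ha. apply rad1_cabs. intros r Hr.
  eapply cabs_ext; [|apply (exp_ps a r Ha)].
  - intros; reflexivity.
  - rewrite Cmod_R, Rabs_pos_eq; lra.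
Qed.

Lemma expco_0 (a : nat -> C) : a O = 0 -> expco a 0 = 1.
Proof.
  intros H. unfold expco. rewrite (Cser_fin _ 1).
  - simpl. unfold ifact. simpl. rewrite Rinv_1. ring.
  - intros [|m] Hm; [lia|]. rewrite cpow_0, H, Cpow_S. ring.
Qed.

Lemma ex_series_geom_lin r : (0 <= r < 1)%R -> ex_series (fun n => INR n * r ^ n)%R.
Proof.
  intros Hr. set (d := ((1 - r) / 2)%R).
  assert (0 < d)%R by (unfold d; lra).
  apply (ex_series_le (K := R_AbsRing) (V := R_CompleteNormedModule) _ (fun n => / d * (r + d) ^ n)%R).
  - intros n. unfold norm; simpl; unfold abs; simpl.
    rewrite Rabs_pos_eq by (apply Rmult_le_pos; [apply pos_INR|apply pow_le; lra]).
    pose proof (pow_der_bound r d n ltac:(lra) H) as B.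
    apply Rmult_le_reg_l with d; [assumption|]. replace (d * (/ d * (r + d) ^ n))%R with ((r + d) ^ n)%R by (field; lra).
    eapply Rle_trans; [|exact B]. rewrite (Rmult_comm d). apply Rmult_le_compat_r; [lra|].
    apply Rmult_le_compat_l; [apply pos_INR|]. destruct n as [|n]; [simpl; lra|].
    replace (S n - 1)%nat with n by lia. simpl. assert (0 <= r ^ n)%R by (apply pow_le; lra). nra.
  - apply (ex_series_scal_l (/ d)%R (fun n => (r + d) ^ n)%R). apply ex_series_geom.
    rewrite Rabs_pos_eq; unfold d; lra.
Qed.

Lemma Series_Cmod_spread k x : (0 < k)%nat -> cabs x ->
  Series (fun n => Cmod (spread k x n)) = Series (fun n => Cmod (x n)).
Proof.
  intros Hk Hx. apply RtoC_inj.
  rewrite <- !RtoC_Series; try (intros; apply Cmod_ge_0); [| exact Hx | now apply (cabs_spread k x Hk)].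
  rewrite <- (Cser_spread k (fun n => RtoC (Cmod (x n))) Hk).
  - apply Cser_ext. intros n. unfold spread. destruct (_ =? _)%nat; [reflexivity|now rewrite Cmod_0].
  - apply cabs_le with (fun n => Cmod (x n)); [|exact Hx]. intros n.
    rewrite Cmod_R, Rabs_pos_eq by apply Cmod_ge_0. lra.
Qed.

(** From [(d + 1) * (j + 1) >= d + (j + 1)]. It separates the two indices of a Lambert series, so
    that a product of two one-variable series dominates it. *)
Lemma pow_shift_le (r : R) d j : (0 <= r <= 1)%R -> ((r ^ S d) ^ S j <= r ^ d * r ^ S j)%R.
Proof.
  intros Hr. rewrite <- pow_mult, <- pow_add.
  replace (S d * S j)%nat with (d + S j + d * j)%nat by lia. rewrite (pow_add _ (d + S j)).
  assert (r ^ (d * j) <= 1)%R.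
  { rewrite <- (pow1 (d * j)). apply pow_incr. lra. }
  assert (0 <= r ^ (d + S j))%R by (apply pow_le; lra). nra.
Qed.

(** * Lambert series and the eta product *)

(** The divisor sum of [y d (n / (d + 1))] over the [d] with [d + 1] dividing [n]. For [n > 0] only
    finitely many [d] contribute; for [n = 0] all do, through the values [y d 0], which the
    hypothesis of [lambert] forces to be zero. *)
Definition lamb (y : nat -> nat -> C) (n : nat) : C := Cser (fun d => spread (S d) (y d) n).

Lemma lambert_rows y x : (forall d j, (Cmod (y d j) <= INR j)%R) -> (Cmod x < 1)%R ->
  (forall d, cabs (fun j => y d j * (x ^ S d) ^ j)) /\
  ex_series (fun d => Series (fun j => Cmod (y d j * (x ^ S d) ^ j))).
Proof.
  intros Hy Hx. pose proof (Cmod_ge_0 x) as H0. set (r := Cmod x) in *.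
  assert (B : forall d j, (Cmod (y d j * (x ^ S d) ^ j) <= r ^ d * (INR j * r ^ j))%R).
  { intros d j. rewrite Cmod_mult, !Cmod_pow. fold r. destruct j as [|j].
    - specialize (Hy d O). simpl INR in *. pose proof (Cmod_ge_0 (y d O)). simpl.
      replace (Cmod (y d 0%nat)) with 0%R by lra. lra.
    - pose proof (pow_shift_le r d j ltac:(lra)). specialize (Hy d (S j)). pose proof (Cmod_ge_0 (y d (S j))).
      replace (r ^ d * (INR (S j) * r ^ S j))%R with (INR (S j) * (r ^ d * r ^ S j))%R by ring.
      apply Rmult_le_compat; try assumption. apply pow_le, pow_le. assumption. }
  pose proof (ex_series_geom_lin r ltac:(lra)) as G.
  assert (R1 : forall d, cabs (fun j => y d j * (x ^ S d) ^ j)).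
  { intros d. apply cabs_le with (fun j => r ^ d * (INR j * r ^ j))%R; [apply B|].
    now apply (ex_series_scal_l (r ^ d)%R (fun j => INR j * r ^ j)%R). }
  split; [exact R1|].
  apply (ex_series_le (K := R_AbsRing) (V := R_CompleteNormedModule) _ (fun d => r ^ d * Series (fun j => INR j * r ^ j))%R).
  - intros d. unfold norm; simpl; unfold abs; simpl. rewrite Rabs_pos_eq.
    + rewrite <- Series_scal_l. apply Series_le.
      * intros j. split; [apply Cmod_ge_0|apply B].
      * now apply (ex_series_scal_l (r ^ d)%R (fun j => INR j * r ^ j)%R).
    + apply (rsum_le_Series _ 0 (R1 d)). intros; apply Cmod_ge_0.
  - apply ex_series_scal_r. apply ex_series_geom. rewrite Rabs_pos_eq; lra.
Qed.

Lemma lambert y x : (forall d j, (Cmod (y d j) <= INR j)%R) -> (Cmod x < 1)%R ->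
  cabs (fun n => lamb y n * x ^ n) /\
  ev (lamb y) x = Cser (fun d => Cser (fun j => y d j * (x ^ S d) ^ j)) /\
  cabs (fun d => Cser (fun j => y d j * (x ^ S d) ^ j)).
Proof.
  intros Hy Hx. destruct (lambert_rows y x Hy Hx) as [R1 R2].
  pose (X d n := spread (S d) (fun j => y d j * (x ^ S d) ^ j) n).
  assert (EX : forall d n, X d n = x ^ n * spread (S d) (y d) n).
  { intros d n. unfold X, spread. destruct (n mod S d =? 0)%nat eqn:E; [|ring].
    apply Nat.eqb_eq in E. rewrite <- Cpow_mult_r. pose proof (Nat.div_mod_eq n (S d)) as Q.
    rewrite E, Nat.add_0_r in Q. rewrite <- Q. ring. }
  assert (K1 : forall d, cabs (X d)) by (intros d; apply cabs_spread; [lia|apply R1]).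
  destruct (fubini X K1) as (C1 & C2 & C3 & C4).
  { eapply ex_series_ext; [|exact R2]. intros d. symmetry. apply Series_Cmod_spread; [lia|apply R1]. }
  assert (ER : forall d, Cser (X d) = Cser (fun j => y d j * (x ^ S d) ^ j)).
  { intros d. apply Cser_spread; [lia|apply R1]. }
  assert (EC : forall n, Cser (fun d => X d n) = lamb y n * x ^ n).
  { intros n. rewrite (Cser_ext _ _ (fun d => EX d n)). rewrite Cmult_comm. apply Cser_scal.
    destruct n as [|n].
    - apply cabs_fin with O. intros d _. unfold spread.
      rewrite Nat.Div0.mod_0_l, Nat.eqb_refl, Nat.Div0.div_0_l. apply Cmod_eq_0.
      specialize (Hy d O). pose proof (Cmod_ge_0 (y d O)). simpl in Hy. lra.
    - apply cabs_fin with (S n). intros d Hd. unfold spread.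
      rewrite Nat.mod_small by lia. reflexivity. }
  split; [eapply cabs_ext; [exact EC|exact C3]|]. split.
  - unfold ev. rewrite <- (Cser_ext _ _ EC), C4. apply Cser_ext, ER.
  - eapply cabs_ext; [exact ER|exact C2].
Qed.

Local Notation i := Coquelicot.Complex.Ci.

(** * Powers of q *)

Lemma qpowE r z : qpow r z = cexp (RtoC (2 * PI * r) * i * z).
Proof. reflexivity. Qed.

Lemma qpow_plus r s z : qpow (r + s) z = qpow r z * qpow s z.
Proof.
  rewrite !qpowE, <- cexp_plus. f_equal. replace (2 * PI * (r + s))%R with (2 * PI * r + 2 * PI * s)%R by ring.
  rewrite RtoC_plus. ring.
Qed.

Lemma qpow_0 z : qpow 0 z = 1.
Proof. rewrite qpowE, Rmult_0_r. replace (0 * i * z) with (RtoC 0) by ring. apply cexp_0. Qed.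

Lemma qpow_neq0 r z : qpow r z <> 0.
Proof. apply cexp_neq0. Qed.

Lemma qpow_INR r n z : qpow (r * INR n) z = qpow r z ^ n.
Proof.
  rewrite !qpowE, <- cexp_INR. f_equal.
  replace (2 * PI * (r * INR n))%R with (INR n * (2 * PI * r))%R by ring. rewrite (RtoC_mult (INR n)). ring.
Qed.

Lemma qpow_nat n z : qpow (INR n) z = qpow 1 z ^ n.
Proof. rewrite <- qpow_INR. f_equal. ring. Qed.

Lemma Cmod_qpow r z : Cmod (qpow r z) = exp (- (2 * PI * r * Im z)).
Proof.
  rewrite qpowE, Cmod_cexp. f_equal. destruct z as [a b]. unfold Cmult, RtoC, i; simpl. ring.
Qed.

Lemma qpow_zplus r z w : qpow r (z + w) = qpow r z * qpow r w.
Proof. rewrite !qpowE, <- cexp_plus. f_equal. ring. Qed.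

Lemma qpow_zscal r (s : R) z : qpow r (s * z) = qpow (r * s) z.
Proof.
  rewrite !qpowE. f_equal. replace (2 * PI * (r * s))%R with (2 * PI * r * s)%R by ring. rewrite (RtoC_mult (2 * PI * r) s). ring.
Qed.

Lemma qpow_real r (s : R) : qpow r s = cexp (RtoC (2 * PI * (r * s)) * i).
Proof.
  rewrite qpowE. f_equal. replace (2 * PI * (r * s))%R with (2 * PI * r * s)%R by ring. rewrite (RtoC_mult (2 * PI * r) s). ring.
Qed.

Lemma Cmod_q_lt1 z : UHP z -> (Cmod (qpow 1 z) < 1)%R.
Proof.
  intros H. rewrite Cmod_qpow. rewrite <- exp_0 at 2. apply exp_increasing.
  unfold UHP in H. pose proof PI_RGT_0. nra.
Qed.

Lemma Cmod_pow_lt1 x n : (Cmod x < 1)%R -> (Cmod (x ^ S n) < 1)%R.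
Proof.
  intros H. rewrite Cmod_pow. pose proof (Cmod_ge_0 x).
  assert (Cmod x ^ n <= 1)%R by (rewrite <- (pow1 n); apply pow_incr; lra).
  assert (0 <= Cmod x ^ n)%R by (apply pow_le; lra).
  simpl. nra.
Qed.

Lemma one_minus_neq0 x : (Cmod x < 1)%R -> 1 - x <> 0.
Proof.
  intros H Z. assert (x = 1) as -> by (replace x with (1 - (1 - x)) by ring; rewrite Z; ring).
  rewrite Cmod_1 in H. lra.
Qed.

(** * Geometric and logarithmic series *)

Definition ones (n : nat) : C := 1.

Lemma rad1_ones : rad1 ones.
Proof.
  intros r Hr. unfold psabs. eapply ex_series_ext; [|apply (ex_series_geom r); rewrite Rabs_pos_eq; lra].
  intros n. unfold ones. now rewrite Cmod_1, Rmult_1_l.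
Qed.

Lemma ev_ones x : (Cmod x < 1)%R -> ev ones x = / (1 - x).
Proof.
  intros Hx. pose proof (cabs_rad1 _ x rad1_ones Hx) as H.
  apply (Cmult_reg_l (1 - x)); [now apply one_minus_neq0|].
  rewrite Cinv_r by now apply one_minus_neq0.
  assert (E : ev ones x = 1 + x * ev ones x).
  { unfold ev at 1. rewrite Cser_S_l by assumption. f_equal; [unfold ones; simpl; ring|].
    unfold ev. rewrite <- Cser_scal by assumption. apply Cser_ext. intros n. rewrite Cpow_S. unfold ones. ring. }
  replace ((1 - x) * ev ones x) with (ev ones x - x * ev ones x) by ring. rewrite E at 1. ring.
Qed.

Lemma qder_ones x : (Cmod x < 1)%R -> qder (fun y => / (1 - y)) x (/ ((1 - x) * (1 - x))).
Proof.
  intros Hx. eapply qder_val; [apply (qder_comp (fun y => / y) (fun y => 1 - y))|].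
  - apply (qder_ext_loc (fun y => 1 + (-(1)) * y) _ x _ 1); [lra|intros; ring|].
    apply qder_plus; [apply qder_const|apply qder_scal, qder_id].
  - apply qder_inv. now apply one_minus_neq0.
  - cbv beta. field. now apply one_minus_neq0.
Qed.

(** The Euler operator [x * d/dx] on coefficients. *)
Lemma Cser_dco c x : rad1 c -> (Cmod x < 1)%R ->
  cabs (fun n => INR n * c n * x ^ n) /\ Cser (fun n => INR n * c n * x ^ n) = x * ev (dco c) x.
Proof.
  intros Hc Hx. pose proof (Cmod_ge_0 x).
  assert (A : cabs (fun n => dco c n * x ^ n)).
  { apply cabs_dco with ((1 + Cmod x) / 2)%R; [apply Hc; lra|lra]. }
  assert (B : cabs (fun n => INR n * c n * x ^ n)).
  { apply (cabs_shift _ 1). apply cabs_ext with (fun n => x * (dco c n * x ^ n)).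
    - intros n. unfold dco. rewrite (Cpow_S x). change (1 + n)%nat with (S n). ring.
    - now apply cabs_scal. }
  split; [exact B|]. rewrite Cser_S_l by exact B. change (INR 0) with 0%R.
  replace (0 * c O * x ^ 0) with (RtoC 0) by ring. rewrite Cplus_0_l. unfold ev. rewrite <- Cser_scal by exact A.
  apply Cser_ext. intros n. unfold dco. rewrite (Cpow_S x). ring.
Qed.

Lemma Cser_lin_geom x : (Cmod x < 1)%R -> Cser (fun n => INR n * x ^ n) = x / ((1 - x) * (1 - x)).
Proof.
  intros Hx. pose proof (Cmod_ge_0 x). destruct (Cser_dco ones x rad1_ones Hx) as [_ E].
  rewrite (Cser_ext _ (fun n => INR n * ones n * x ^ n)) by (intros; unfold ones; ring).
  rewrite E. unfold Cdiv. f_equal. apply (qder_unique (fun y => / (1 - y)) x); [|now apply qder_ones].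
  apply (qder_ext_loc (ev ones) _ x _ ((1 - Cmod x) / 2)).
  - lra.
  - intros h Hh. apply ev_ones. pose proof (Cmod_triangle x h). lra.
  - apply qder_ev with ((1 + Cmod x) / 2)%R; [apply rad1_ones; lra|lra].
Qed.

(** Coefficients of [- log (1 - x)]. No branch of the logarithm is chosen: only the exponential
    relation [cexp_lam] is used. *)
Definition lamco (n : nat) : C := match n with O => 0 | S m => RtoC (/ INR (S m)) end.

Lemma Cmod_RtoC_inv_le1 m : (Cmod (RtoC (/ INR (S m))) <= 1)%R.
Proof.
  rewrite Cmod_R, Rabs_pos_eq.
  - rewrite <- Rinv_1. apply Rinv_le_contravar; [lra|]. rewrite S_INR. pose proof (pos_INR m). lra.
  - apply Rlt_le, Rinv_0_lt_compat, lt_0_INR. lia.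
Qed.

Lemma rad1_bounded (c : nat -> C) : (forall n, (Cmod (c n) <= 1)%R) -> rad1 c.
Proof.
  intros H. apply rad1_cabs. intros r Hr. apply cabs_le with (fun n => r ^ n)%R.
  - intros n. rewrite Cmod_mult, Cmod_pow, Cmod_R, Rabs_pos_eq by lra.
    assert (0 <= r ^ n)%R by (apply pow_le; lra). specialize (H n). nra.
  - apply ex_series_geom. rewrite Rabs_pos_eq; lra.
Qed.

Lemma rad1_lamco : rad1 lamco.
Proof.
  apply rad1_bounded. intros [|n]; [simpl; rewrite Cmod_0; lra|apply Cmod_RtoC_inv_le1].
Qed.

Lemma cexp_lam x : (Cmod x < 1)%R -> cexp (- ev lamco x) = 1 - x.
Proof.
  intros Hx.
  (* The derivative of the exponent is the geometric series [1 / (1 - y)], so this product is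
     constant on the segment from [0] to [x]. *)
  assert (E : cexp (ev lamco 0) * (1 - 0) = cexp (ev lamco x) * (1 - x)).
  { apply (qder_zero_const (fun y => cexp (ev lamco y) * (1 - y))). intros t Ht.
    replace (0 + t * (x - 0)) with (t * x) by ring.
    assert (Hm : (Cmod (t * x) < 1)%R).
    { rewrite Cmod_mult, Cmod_R, Rabs_pos_eq by lra. pose proof (Cmod_ge_0 x). nra. }
    pose proof (Cmod_ge_0 (t * x)).
    eapply qder_val; [apply qder_mult|].
    - eapply (qder_comp cexp (ev lamco)); [|apply qder_cexp].
      apply qder_ev with ((1 + Cmod (t * x)) / 2)%R; [apply rad1_lamco; lra|lra].
    - apply (qder_ext_loc (fun y => 1 + (-(1)) * y) _ _ (0 + (-(1)) * 1) 1); [lra|intros; ring|].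
      apply qder_plus; [apply qder_const|apply qder_scal, qder_id].
    - cbv beta. replace (ev (dco lamco) (t * x)) with (/ (1 - t * x)).
      + field. now apply one_minus_neq0.
      + rewrite <- ev_ones by assumption. apply Cser_ext. intros n. unfold ones, dco, lamco.
        rewrite <- RtoC_mult, Rinv_r by (apply not_0_INR; lia). reflexivity. }
  assert (ev lamco 0 = 0) as E0.
  { unfold ev. rewrite (Cser_fin _ O); [reflexivity|]. intros [|m] _; simpl; ring. }
  rewrite E0, cexp_0 in E. rewrite cexp_opp. apply (Cmult_reg_l (cexp (ev lamco x))); [apply cexp_neq0|].
  rewrite <- E. field. apply cexp_neq0.
Qed.

(** * Divisor sums and the logarithm of the eta product *)

Definition yA (d j : nat) : C := match j with O => 0 | _ => RtoC (/ INR (S d)) end.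
Definition yB (d j : nat) : C := RtoC (INR j).

(* The coefficients [sigma_(-1)(n)] of [- log (prod (1 - q^n))] and the coefficients [sigma_1(n)]. *)
Definition Lco : nat -> C := lamb yA.
Definition Sco : nat -> C := lamb yB.

Lemma yA_le d j : (Cmod (yA d j) <= INR j)%R.
Proof.
  destruct j as [|j]; [simpl; rewrite Cmod_0; lra|].
  eapply Rle_trans; [apply Cmod_RtoC_inv_le1|]. rewrite S_INR. pose proof (pos_INR j). lra.
Qed.

Lemma yB_le d j : (Cmod (yB d j) <= INR j)%R.
Proof. unfold yB. rewrite Cmod_R, Rabs_pos_eq by apply pos_INR. lra. Qed.

Lemma rad1_Lco : rad1 Lco.
Proof.
  apply rad1_cabs. intros r Hr. apply (lambert yA r yA_le). rewrite Cmod_R, Rabs_pos_eq; lra.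
Qed.

Lemma Lco_0 : Lco 0 = 0.
Proof.
  unfold Lco, lamb. rewrite (Cser_fin _ O); [reflexivity|]. intros d _. unfold spread.
  now rewrite Nat.Div0.mod_0_l, Nat.eqb_refl, Nat.Div0.div_0_l.
Qed.

(** For a divisor [d] of [n] the complementary divisor is [n / d]. This is why the logarithmic
    derivative of the eta product is an Eisenstein series of weight 2. *)
Lemma Lco_Sco n : INR n * Lco n = Sco n.
Proof.
  unfold Lco, Sco, lamb. destruct n as [|n].
  - simpl INR. rewrite (Cser_fin (fun d => spread (S d) (yB d) 0) O); [simpl; ring|].
    intros d _. unfold spread. now rewrite Nat.Div0.mod_0_l, Nat.eqb_refl, Nat.Div0.div_0_l.
  - rewrite <- Cser_scal.
    + apply Cser_ext. intros d. unfold spread. destruct (S n mod S d =? 0)%nat eqn:E; [|ring].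
      apply Nat.eqb_eq in E. pose proof (Nat.div_mod_eq (S n) (S d)) as Q. rewrite E, Nat.add_0_r in Q.
      unfold yA, yB. destruct (S n / S d)%nat as [|j]; [lia|].
      rewrite Q, mult_INR, <- RtoC_mult. f_equal. field. apply not_0_INR. lia.
    + apply cabs_fin with (S n). intros d Hd. unfold spread. rewrite Nat.mod_small by lia. reflexivity.
Qed.

Lemma ev_Sco x : (Cmod x < 1)%R ->
  x * ev (dco Lco) x = Cser (fun d => x ^ S d / ((1 - x ^ S d) * (1 - x ^ S d))) /\
  cabs (fun d => x ^ S d / ((1 - x ^ S d) * (1 - x ^ S d))).
Proof.
  intros Hx. destruct (lambert yB x yB_le Hx) as (_ & E2 & E3).
  assert (E : forall d, Cser (fun j => yB d j * (x ^ S d) ^ j) = x ^ S d / ((1 - x ^ S d) * (1 - x ^ S d))).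
  { intros d. apply Cser_lin_geom. now apply Cmod_pow_lt1. }
  split; [|eapply cabs_ext; [exact E|exact E3]].
  rewrite <- (Cser_ext _ _ E), <- E2. destruct (Cser_dco Lco x rad1_Lco Hx) as [_ <-].
  apply Cser_ext. intros n. fold Sco. now rewrite Lco_Sco.
Qed.

(** The Lambert array of [yA] is summed the other way: for a fixed exponent [j + 1] the sum over [d]
    is the logarithmic series at [x^(j + 1)], one factor of the eta product. *)
Lemma ev_Lco x : (Cmod x < 1)%R -> csums (fun j => ev lamco (x ^ S j)) (ev Lco x).
Proof.
  intros Hx. destruct (lambert yA x yA_le Hx) as (_ & E2 & _).
  destruct (lambert_rows yA x yA_le Hx) as [R1 R2].
  destruct (fubini _ R1 R2) as (C1 & _ & C3 & C4).
  unfold Lco. rewrite E2, <- C4.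
  assert (Z : forall j, Cser (fun m => yA m (S j) * (x ^ S m) ^ S j) = ev lamco (x ^ S j)).
  { intros j. unfold ev. rewrite (Cser_S_l (fun n => lamco n * (x ^ S j) ^ n)).
    - simpl lamco at 1. rewrite Cmult_0_l, Cplus_0_l. apply Cser_ext. intros m.
      unfold yA, lamco. f_equal. rewrite <- !Cpow_mult_r. f_equal. lia.
    - apply cabs_rad1; [apply rad1_lamco|now apply Cmod_pow_lt1]. }
  rewrite Cser_S_l by exact C3. rewrite (Cser_fin (fun m => yA m 0 * _) O), Cplus_0_l.
  - rewrite (Cser_ext _ _ Z). apply csums_Cser. eapply cabs_ext; [exact Z|].
    apply (cabs_shift (fun n => Cser (fun m => yA m n * (x ^ S m) ^ n)) 1). exact C3.
  - intros m _. simpl. ring.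
Qed.

Definition Lam (z : C) : C := ev Lco (qpow 1 z).

Lemma clim_qder f u l m : qder f l m -> clim u l -> clim (fun n => f (u n)) (f l).
Proof.
  intros D H. destruct (qder_lip _ _ _ D) as (d & L & Hd & HL & HH).
  intros eps He. destruct (H (Rmin d (eps / (L + 1)))) as [N HN].
  { apply Rmin_pos; [assumption|apply Rdiv_lt_0_compat; lra]. }
  exists N. intros n Hn. specialize (HN n Hn).
  assert (Cmod (u n - l) <= d)%R as A1 by (pose proof (Rmin_l d (eps / (L + 1))); lra).
  assert (Cmod (u n - l) < eps / (L + 1))%R as A2 by (pose proof (Rmin_r d (eps / (L + 1))); lra).
  specialize (HH (u n - l) A1). replace (l + (u n - l)) with (u n) in HH by ring.
  apply Rlt_div_r in A2; [|lra]. pose proof (Cmod_ge_0 (u n - l)). nra.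
Qed.

Lemma clim_cexp u l : clim u l -> clim (fun n => cexp (u n)) (cexp l).
Proof. apply (clim_qder cexp _ _ _ (qder_cexp l)). Qed.

Lemma eta_prodE z : UHP z -> eta_prod z = cexp (- Lam z).
Proof.
  intros Hz. pose proof (Cmod_q_lt1 z Hz) as Hq.
  assert (E : forall N, eta_partial z N = cexp (- csum (fun j => ev lamco (qpow 1 z ^ S j)) N)).
  { induction N as [|N IH].
    - simpl. replace (- (0)) with (RtoC 0) by ring. now rewrite cexp_0.
    - change (eta_partial z (S N)) with (eta_partial z N * (1 - qpow (INR (S N)) z)).
      rewrite IH, qpow_nat, <- cexp_lam by now apply Cmod_pow_lt1.
      rewrite <- cexp_plus. f_equal. cbn [csum]. ring. }
  assert (L : clim (eta_partial z) (cexp (- Lam z))).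
  { eapply clim_ext; [intros N; symmetry; apply E|]. apply clim_cexp.
    apply (clim_ext (fun n => (-(1)) * csum (fun j => ev lamco (qpow 1 z ^ S j)) n)); [intros; ring|].
    replace (- Lam z) with ((-(1)) * Lam z) by ring. apply clim_scal. now apply ev_Lco. }
  unfold eta_prod.
  (* [epsilon] returns a limit only because one exists; uniqueness of limits then identifies it. *)
  assert (X : exists w : C, filterlim (eta_partial z) eventually (locally (T := C_UniformSpace) w))
    by (exists (cexp (- Lam z)); now apply filterlim_clim).
  pose proof (epsilon_spec (inhabits (RtoC 0)) _ X) as S. apply filterlim_clim in S.
  eapply clim_unique; eassumption.
Qed.

Lemma UHP_open z h : UHP z -> (Cmod h < Im z)%R -> UHP (z + h).
Proof.
  intros Hz Hh. unfold UHP in *. change (Im (z + h)) with (Im z + Im h)%R.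
  pose proof (im_le_Cmod h) as B. apply Rabs_le_between in B. lra.
Qed.

Lemma qder_qpow r z : qder (qpow r) z (RtoC (2 * PI * r) * i * qpow r z).
Proof.
  eapply qder_val.
  - apply (qder_comp cexp (fun z => RtoC (2 * PI * r) * i * z)); [apply qder_scal, qder_id|apply qder_cexp].
  - cbv beta. rewrite qpowE. ring.
Qed.

Lemma qder_ps c z : rad1 c -> UHP z ->
  qder (fun z => ev c (qpow 1 z)) z (RtoC (2 * PI) * i * qpow 1 z * ev (dco c) (qpow 1 z)).
Proof.
  intros Hc Hz. pose proof (Cmod_q_lt1 z Hz) as Hq. pose proof (Cmod_ge_0 (qpow 1 z)).
  eapply qder_val.
  - apply (qder_comp (ev c) (qpow 1)); [apply qder_qpow|].
    apply qder_ev with ((1 + Cmod (qpow 1 z)) / 2)%R; [apply Hc; lra|lra].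
  - rewrite Rmult_1_r. ring.
Qed.

(** * Partial fractions of the cotangent *)

Lemma clim_inv u (l : C) : l <> 0 -> clim u l -> clim (fun n => / u n) (/ l).
Proof. intros Hl H. exact (clim_qder (fun y => / y) u l _ (qder_inv l Hl) H). Qed.

Lemma cexp_2PIi : cexp (RtoC (2 * PI) * i) = 1.
Proof.
  unfold cexp, Cmult, RtoC, Complex.Ci; simpl.
  replace (2 * PI * 0 - 0 * 1)%R with 0%R by ring. replace (2 * PI * 1 + 0 * 0)%R with (2 * PI)%R by ring.
  rewrite exp_0, cos_2PI, sin_2PI. f_equal; ring.
Qed.

Lemma cexp_2PIi_INR n : cexp (RtoC (2 * PI * INR n) * i) = 1.
Proof.
  replace (RtoC (2 * PI * INR n) * i) with (INR n * (RtoC (2 * PI) * i)) by (rewrite (RtoC_mult (2 * PI)); ring).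
  now rewrite cexp_INR, cexp_2PIi, Cpow_1_l.
Qed.

Lemma cexp_2PIi_IZR n : cexp (RtoC (2 * PI * IZR n) * i) = 1.
Proof.
  destruct (Z.le_gt_cases 0 n) as [H|H].
  - rewrite <- (Z2Nat.id n H), <- INR_IZR_INZ. apply cexp_2PIi_INR.
  - rewrite <- (Z.opp_involutive n), opp_IZR, <- (Z2Nat.id (- n)), <- INR_IZR_INZ by lia.
    replace (RtoC (2 * PI * - INR (Z.to_nat (- n))) * i) with (- (RtoC (2 * PI * INR (Z.to_nat (- n))) * i)).
    + rewrite cexp_opp, cexp_2PIi_INR. field.
    + rewrite Ropp_mult_distr_r_reverse, RtoC_opp. ring.
Qed.

Lemma qpow_1_IZR z n : qpow 1 (z + IZR n) = qpow 1 z.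
Proof. rewrite qpow_zplus, (qpow_real 1 (IZR n)), Rmult_1_l, cexp_2PIi_IZR. ring. Qed.

Lemma qpow_1_INR z n : qpow 1 (z + INR n) = qpow 1 z.
Proof. rewrite INR_IZR_INZ. apply qpow_1_IZR. Qed.

Lemma root_neq1 (a N : R) : (0 < a < N)%R -> qpow (a / N) 1 <> 1.
Proof.
  intros H E. rewrite qpow_real, Rmult_1_r in E.
  assert (H0 : (0 < a / N < 1)%R).
  { split; [apply Rdiv_lt_0_compat; lra|]. apply Rlt_div_l; lra. }
  set (x := (a / N)%R) in *. pose proof PI_RGT_0.
  apply (f_equal Re) in E. revert E. unfold cexp, Cmult, RtoC, Complex.Ci; simpl.
  replace (2 * PI * x * 0 - 0 * 1)%R with 0%R by ring. replace (2 * PI * x * 1 + 0 * 0)%R with (2 * (PI * x))%R by ring.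
  rewrite exp_0, Rmult_1_l, cos_2a_sin. intros E.
  assert (0 < sin (PI * x))%R by (apply sin_gt_0; nra). nra.
Qed.

Lemma geom_csum (x : C) n : (1 - x) * csum (fun k => x ^ k) n = 1 - x ^ n.
Proof. induction n as [|n IH]; [simpl; ring|]. cbn [csum]. rewrite Cmult_plus_distr_l, IH, Cpow_S. ring. Qed.

(* [qpow (j / N) (INR k)] is the power [e(jk/N)] of a root of unity. *)
Lemma roots_sum (N : nat) (j : Z) : (0 < N)%nat ->
  csum (fun k => qpow (IZR j / INR N) (INR k)) N = if (j mod Z.of_nat N =? 0)%Z then INR N else 0.
Proof.
  intros HN. assert (0 < INR N)%R as HN' by now apply lt_0_INR.
  pose (w := qpow (IZR (j mod Z.of_nat N) / INR N) 1).
  assert (E : forall k, qpow (IZR j / INR N) (INR k) = w ^ k).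
  { intros k. unfold w. rewrite <- qpow_INR, !qpow_real, Rmult_1_r.
    rewrite (Z.div_mod j (Z.of_nat N)) at 1 by lia. rewrite plus_IZR, mult_IZR, <- INR_IZR_INZ.
    replace (2 * PI * ((INR N * IZR (j / Z.of_nat N) + IZR (j mod Z.of_nat N)) / INR N * INR k))%R with
      (2 * PI * IZR (j / Z.of_nat N * Z.of_nat k) + 2 * PI * (IZR (j mod Z.of_nat N) / INR N * INR k))%R
      by (rewrite mult_IZR, <- INR_IZR_INZ; field; lra).
    rewrite RtoC_plus, Cmult_plus_distr_r, cexp_plus, cexp_2PIi_IZR. ring. }
  rewrite (csum_ext _ (fun k => w ^ k)) by (intros; apply E).
  pose proof (Z.mod_pos_bound j (Z.of_nat N) ltac:(lia)) as B.
  destruct (j mod Z.of_nat N =? 0)%Z eqn:Ej.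
  - apply Z.eqb_eq in Ej. unfold w. rewrite Ej. replace (0 / INR N)%R with 0%R by (field; lra). rewrite qpow_0.
    rewrite (csum_ext _ (fun _ => 1)) by (intros; apply Cpow_1_l). rewrite csum_const. ring.
  - apply Z.eqb_neq in Ej. assert (w <> 1) as Hw.
    { apply root_neq1. split; [apply (IZR_lt 0); lia|]. rewrite INR_IZR_INZ. apply IZR_lt. lia. }
    assert (w ^ N = 1) as HwN.
    { unfold w. rewrite <- qpow_INR, qpow_real. replace (IZR (j mod Z.of_nat N) / INR N * INR N * 1)%R with
        (IZR (j mod Z.of_nat N)) by (field; lra). apply cexp_2PIi_IZR. }
    apply (Cmult_reg_l (1 - w)).
    + intros Z. apply Hw. replace w with (1 - (1 - w)) by ring. rewrite Z. ring.
    + rewrite geom_csum, HwN. ring.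
Qed.

(* This is [pi * cot (pi w)]. *)
Definition cotp (w : C) : C := - RtoC PI * i * ((1 + qpow 1 w) / (1 - qpow 1 w)).

(** The numbers [y = x * qpow (1 / N) k] are the [N]-th roots of [q]. Expanding [1 / (1 - y)] as
    [(1 + y + ... + y^(N-1)) / (1 - q)] and summing over [k], only the power [j = 0] survives. *)
Lemma cot_finite (w : C) (N : nat) : (0 < N)%nat -> qpow 1 w <> 1 ->
  csum (fun k => cotp ((w + INR k) / INR N)) N = INR N * cotp w.
Proof.
  intros HN Hq. assert (0 < INR N)%R as HN' by now apply lt_0_INR.
  assert (RtoC (INR N) <> 0) as HNC by (apply RtoC_neq0; lra).
  pose (x := qpow (1 / INR N) w).
  assert (Ey : forall k, qpow 1 ((w + INR k) / INR N) = x * qpow (1 / INR N) (INR k)).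
  { intros k. unfold x. rewrite <- qpow_zplus.
    replace ((w + INR k) / INR N) with (RtoC (/ INR N) * (w + INR k)) by (rewrite RtoC_inv by lra; field; assumption).
    rewrite qpow_zscal. reflexivity. }
  assert (EyN : forall k, (x * qpow (1 / INR N) (INR k)) ^ N = qpow 1 w).
  { intros k. rewrite <- Ey, <- qpow_nat. replace ((w + INR k) / INR N) with (RtoC (/ INR N) * (w + INR k))
      by (rewrite RtoC_inv by lra; field; assumption). rewrite qpow_zscal.
    replace (INR N * / INR N)%R with 1%R by (field; lra). apply qpow_1_INR. }
  assert (Hy1 : forall k, 1 - x * qpow (1 / INR N) (INR k) <> 0).
  { intros k Z. apply Hq. rewrite <- (EyN k). replace (x * qpow (1 / INR N) (INR k)) with
      (1 - (1 - x * qpow (1 / INR N) (INR k))) by ring. rewrite Z.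
    replace (1 - 0) with (RtoC 1) by ring. apply Cpow_1_l. }
  assert (Hq1 : 1 - qpow 1 w <> 0).
  { intros Z. apply Hq. replace (qpow 1 w) with (1 - (1 - qpow 1 w)) by ring. rewrite Z. ring. }
  assert (K : csum (fun k => / (1 - x * qpow (1 / INR N) (INR k))) N = INR N / (1 - qpow 1 w)).
  { apply (Cmult_reg_l (1 - qpow 1 w)); [assumption|]. rewrite <- csum_scal.
    rewrite (csum_ext _ (fun k => csum (fun j => (x * qpow (1 / INR N) (INR k)) ^ j) N)).
    2:{ intros k _. rewrite <- (EyN k), <- geom_csum. field. apply Hy1. }
    rewrite csum_swap.
    rewrite (csum_ext _ (fun j => x ^ j * (if (Z.of_nat j mod Z.of_nat N =? 0)%Z then INR N else 0))).
    2:{ intros j Hj. rewrite <- roots_sum by assumption. rewrite <- csum_scal. apply csum_ext. intros k _.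
        rewrite Cpow_mult_l, <- (qpow_INR (1 / INR N) j). do 2 f_equal. rewrite <- INR_IZR_INZ. field. lra. }
    destruct N as [|N]; [lia|]. rewrite csum_S_l.
    rewrite (csum_ext (fun k => x ^ S k * _) (fun _ => 0)).
    - rewrite csum_const. change (Z.of_nat 0 mod Z.of_nat (S N) =? 0)%Z with true. cbv iota. simpl Cpow.
      field. assumption.
    - intros j Hj. rewrite Z.mod_small by lia. destruct (Z.eqb_spec (Z.of_nat (S j)) 0); [lia|ring]. }
  unfold cotp. rewrite csum_scal.
  rewrite (csum_ext _ (fun k => 2 * (/ (1 - x * qpow (1 / INR N) (INR k))) - 1)).
  - rewrite csum_minus, csum_scal, K, csum_const. field. assumption.
  - intros k _. rewrite Ey. field. apply Hy1.
Qed.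

Lemma csum_symm (F : R -> C) M :
  csum (fun k => F (INR k - INR M)%R) (2 * M + 1) = F 0%R + csum (fun k => F (INR (S k)) + F (- INR (S k))%R) M.
Proof.
  induction M as [|M IH].
  - simpl. rewrite Rminus_0_r. ring.
  - replace (2 * S M + 1)%nat with (S (S (2 * M + 1)))%nat by lia.
    rewrite csum_S_l. cbn [csum].
    rewrite (csum_ext _ (fun k => F (INR k - INR M)%R)).
    2:{ intros k _. f_equal. rewrite !S_INR. ring. }
    rewrite IH. replace (INR 0 - INR (S M))%R with (- INR (S M))%R by (change (INR 0) with 0%R; ring).
    replace (INR (S (2 * M + 1)) - INR (S M))%R with (INR (S M)).
    2:{ rewrite !S_INR, plus_INR, mult_INR. simpl. ring. }
    ring.
Qed.

Lemma cotp_period w n : cotp (w + IZR n) = cotp w.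
Proof. unfold cotp. now rewrite qpow_1_IZR. Qed.

(** An odd number [2 M + 1] of terms lets the residues run from [- M] to [M]; pairing [k] with [- k]
    is what makes the limit absolutely convergent. *)
Lemma cot_finite_symm (w : C) (M : nat) : qpow 1 w <> 1 ->
  cotp w = / INR (2 * M + 1) * (cotp (w / INR (2 * M + 1)) +
    csum (fun k => cotp ((w + INR (S k)) / INR (2 * M + 1)) + cotp ((w - INR (S k)) / INR (2 * M + 1))) M).
Proof.
  intros Hq. set (N := (2 * M + 1)%nat).
  assert (RtoC (INR N) <> 0) as HNC by (apply RtoC_neq0, not_0_INR; unfold N; lia).
  assert (E : cotp (w - INR M) = cotp w).
  { replace (w - INR M) with (w + IZR (- Z.of_nat M)); [apply cotp_period|].
    rewrite opp_IZR, <- INR_IZR_INZ, RtoC_opp. reflexivity. }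
  rewrite <- E. apply (Cmult_reg_l (INR N)); [assumption|].
  rewrite <- cot_finite.
  - rewrite (csum_ext _ (fun k => (fun x : R => cotp ((w + x) / INR N)) (INR k - INR M)%R)).
    + unfold N. rewrite (csum_symm (fun x : R => cotp ((w + x) / INR (2 * M + 1)))). fold N.
      rewrite Cmult_assoc, Cinv_r, Cmult_1_l by assumption. f_equal; [do 2 f_equal; ring|].
      apply csum_ext. intros k _. rewrite RtoC_opp. reflexivity.
    + intros k _. cbv beta. rewrite RtoC_minus. do 2 f_equal. ring.
  - unfold N; lia.
  - replace (w - INR M) with (w + IZR (- Z.of_nat M)).
    + rewrite qpow_1_IZR. assumption.
    + rewrite opp_IZR, <- INR_IZR_INZ, RtoC_opp. reflexivity.
Qed.

Lemma qpow_1_C0 : qpow 1 0 = 1.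
Proof. rewrite qpowE. rewrite Cmult_0_r. apply cexp_0. Qed.

Lemma is_lim_seq_inv_odd : is_lim_seq (fun M => / INR (2 * M + 1))%R 0.
Proof.
  apply (is_lim_seq_le_le (fun _ => 0%R) _ (fun M => / INR (S M))%R).
  - intros M. split; [apply Rlt_le, Rinv_0_lt_compat, lt_0_INR; lia|].
    apply Rinv_le_contravar; [apply lt_0_INR; lia|apply le_INR; lia].
  - apply is_lim_seq_const.
  - replace (Finite 0) with (Rbar_inv p_infty) by reflexivity.
    apply is_lim_seq_inv; [|discriminate]. apply (is_lim_seq_incr_1 INR). apply is_lim_seq_INR.
Qed.

Lemma clim_div_odd (w : C) : clim (fun M => w / INR (2 * M + 1)) 0.
Proof.
  apply clim_squeeze with (fun M => (Cmod w * / INR (2 * M + 1))%R).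
  - intros M. replace (w / INR (2 * M + 1) - 0) with (w * / INR (2 * M + 1)) by (unfold Cdiv; ring).
    rewrite Cmod_mult, Cmod_inv by (apply RtoC_neq0, not_0_INR; lia).
    rewrite Cmod_R, Rabs_pos_eq by apply pos_INR. lra.
  - replace (Finite 0) with (Rbar_mult (Cmod w) 0) by (simpl; f_equal; ring).
    apply (is_lim_seq_scal_l _ (Cmod w) 0), is_lim_seq_inv_odd.
Qed.

Lemma clim_q_lin (w : C) :
  clim (fun M => INR (2 * M + 1) * (1 - qpow 1 (w / INR (2 * M + 1)))) (- (RtoC (2 * PI) * i * w)).
Proof.
  pose proof (qder_qpow 1 0) as (d & K & Hd & HK & H). rewrite qpow_1_C0, Rmult_1_r in H.
  apply (clim_shift _ _ 0). intros eps He.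
  destruct (clim_div_odd w (Rmin d (eps / (K * Cmod w + 1)))) as [N0 HN0].
  { pose proof (Cmod_ge_0 w). apply Rmin_pos; [assumption|apply Rdiv_lt_0_compat; nra]. }
  exists N0. intros M HM. cbn [Nat.add] in *. specialize (HN0 M HM). set (N := (M + (M + 0) + 1)%nat) in *.
  assert (RtoC (INR (2 * M + 1)) <> 0) as HNC by (apply RtoC_neq0, not_0_INR; lia).
  replace (w / INR (2 * M + 1) - 0) with (w / INR (2 * M + 1)) in HN0 by ring.
  set (h := w / INR (2 * M + 1)) in *.
  assert (Cmod h <= d)%R as A1 by (pose proof (Rmin_l d (eps / (K * Cmod w + 1))); lra).
  assert (Cmod h < eps / (K * Cmod w + 1))%R as A2 by (pose proof (Rmin_r d (eps / (K * Cmod w + 1))); lra).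
  specialize (H h A1). rewrite Cplus_0_l in H.
  replace (INR (2 * M + 1) * (1 - qpow 1 h) - - (RtoC (2 * PI) * i * w)) with
    (- (INR (2 * M + 1) * (qpow 1 h - 1 - h * (RtoC (2 * PI) * i * 1)))) by (unfold h; field; assumption).
  rewrite Cmod_opp, Cmod_mult.
  assert (Ew : (Cmod (INR (2 * M + 1)) * Cmod h = Cmod w)%R).
  { rewrite <- Cmod_mult. f_equal. unfold h. field. assumption. }
  pose proof (Cmod_ge_0 h). pose proof (Cmod_ge_0 w). pose proof (Cmod_ge_0 (INR (2 * M + 1))).
  apply Rlt_div_r in A2; [|nra].
  apply Rle_lt_trans with (Cmod (INR (2 * M + 1)) * (K * Cmod h ^ 2))%R.
  - apply Rmult_le_compat_l; assumption.
  - replace (Cmod (INR (2 * M + 1)) * (K * Cmod h ^ 2))%R with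
      (K * (Cmod (INR (2 * M + 1)) * Cmod h) * Cmod h)%R by ring. rewrite Ew. nra.
Qed.

Lemma twoPIi_neq0 : RtoC (2 * PI) * i <> 0.
Proof.
  apply Cmult_neq_0; [apply RtoC_neq0; pose proof PI_RGT_0; lra|].
  intros H. apply (f_equal Cmod) in H. rewrite Cmod_Ci, Cmod_0 in H. lra.
Qed.

Lemma clim_cotp_lin (w : C) : w <> 0 ->
  clim (fun M => / INR (2 * M + 1) * cotp (w / INR (2 * M + 1))) (/ w).
Proof.
  intros Hw. pose proof twoPIi_neq0 as Hp.
  assert (E : / w = - RtoC PI * i * ((1 + 1) * / (- (RtoC (2 * PI) * i * w)))).
  { rewrite RtoC_mult in Hp. rewrite RtoC_mult. field. repeat split; try assumption.
    - intros Z. apply Hp. rewrite Z. ring. - intros Z. apply Hp. rewrite Z. ring. }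
  rewrite E.
  apply (clim_ext (fun M => - RtoC PI * i * ((1 + qpow 1 (w / INR (2 * M + 1))) *
     / (INR (2 * M + 1) * (1 - qpow 1 (w / INR (2 * M + 1))))))).
  { intros M. unfold cotp, Cdiv. assert (RtoC (INR (2 * M + 1)) <> 0) as HNC by (apply RtoC_neq0, not_0_INR; lia).
    (* Where the denominator vanishes both sides are zero, since the inverse of [0] is [0]. *)
    destruct (excluded_middle_informative (1 - qpow 1 (w * / INR (2 * M + 1)) = 0)) as [Z|Z].
    - rewrite Z. rewrite Cmult_0_r. unfold Cinv, RtoC; simpl. unfold Cmult; simpl. f_equal; lra.
    - field. now split. }
  apply clim_scal, clim_mult.
  - apply clim_plus; [apply clim_const|]. rewrite <- qpow_1_C0.
    apply (clim_qder (qpow 1) _ 0 _ (qder_qpow 1 0)), clim_div_odd.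
  - apply clim_inv; [|apply clim_q_lin].
    intros Z. apply (Cmult_neq_0 _ _ Hp Hw). replace (RtoC (2 * PI) * i * w) with (- - (RtoC (2 * PI) * i * w)) by ring. rewrite Z. ring.
Qed.

Lemma is_series_rsum (f : nat -> R) (l : R) : is_lim_seq (rsum f) l -> is_series f l.
Proof.
  intros H. change (is_lim_seq (sum_n f) l). apply is_lim_seq_ext with (fun n => rsum f (S n)).
  - intros n. now rewrite sum_n_rsum.
  - now apply (is_lim_seq_incr_1 (rsum f)).
Qed.

Lemma ex_series_inv_sq : ex_series (fun k => / INR (S k) ^ 2)%R.
Proof.
  apply (ex_series_le (K := R_AbsRing) (V := R_CompleteNormedModule) _
    (fun k => 2 * (/ INR (S k) - / INR (S (S k))))%R).
  - intros k. unfold norm; simpl; unfold abs; simpl. fold (INR (S k)).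
    assert (0 < INR (S k))%R by (apply lt_0_INR; lia).
    change (match k with 0%nat => 1 | S _ => INR k + 1 end)%R with (INR (S k)).
    rewrite Rabs_pos_eq.
    2:{ apply Rlt_le, Rinv_0_lt_compat. nra. }
    set (x := INR (S k)) in *. assert (1 <= x)%R by (unfold x; rewrite S_INR; pose proof (pos_INR k); lra).
    replace (2 * (/ x - / (x + 1)))%R with (/ (x * (x + 1) / 2))%R by (field; lra).
    apply Rinv_le_contravar; nra.
  - exists 2%R. apply is_series_rsum.
    apply is_lim_seq_ext with (fun n => 2 - 2 * / INR (S n))%R.
    { induction n as [|n IH]; [simpl; field|]. cbn [rsum]. rewrite <- IH. ring. }
    replace (Finite 2) with (Finite (2 - 2 * 0))%R by (f_equal; ring).
    apply is_lim_seq_minus'; [apply is_lim_seq_const|].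
    apply (is_lim_seq_scal_l _ 2 0).
    replace (Finite 0) with (Rbar_inv p_infty) by reflexivity.
    apply is_lim_seq_inv; [|discriminate]. apply (is_lim_seq_incr_1 INR). apply is_lim_seq_INR.
Qed.

Lemma ex_series_inv_sq_scal (A : R) : ex_series (fun k => A * / INR (S k) ^ 2)%R.
Proof. apply (ex_series_scal_l A (fun k => / INR (S k) ^ 2)%R), ex_series_inv_sq. Qed.

(** Up to [PI / 3] the cosine is at least [1/2]; beyond, the sine is at least [1/2], which suffices
    because [u <= PI / 2 <= 2]. *)
Lemma sin_lower u : (0 <= u <= PI / 2)%R -> (u / 4 <= sin u)%R.
Proof.
  intros Hu. pose proof PI_4. pose proof PI_RGT_0.
  destruct (Rle_lt_dec u (PI / 3)) as [H1|H1].
  - destruct (MVT_gen sin 0 u cos) as (c & Hc & E).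
    + intros t _. apply is_derive_Reals, derivable_pt_lim_sin.
    + intros t _. apply continuity_sin.
    + rewrite Rmin_left, Rmax_right in Hc by lra.
      assert (1 / 2 <= cos c)%R by (rewrite <- cos_PI3; apply cos_decr_1; lra).
      rewrite sin_0 in E. nra.
  - assert (sin (PI / 6) <= sin u)%R by (apply sin_incr_1; lra). rewrite sin_PI6 in *. lra.
Qed.

Lemma sin_lower_abs a : (Rabs a <= 1 / 2)%R -> (Rabs a / 2 <= Rabs (sin (PI * a)))%R.
Proof.
  intros H. pose proof PI2_1. pose proof (Rabs_pos a).
  assert (E : Rabs (sin (PI * a)) = sin (PI * Rabs a)).
  { unfold Rabs at 2. destruct (Rcase_abs a).
    - replace (PI * - a)%R with (- (PI * a))%R by ring. rewrite sin_neg.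
      rewrite Rabs_left1; [reflexivity|]. rewrite Rabs_left in * by lra.
      assert (0 <= sin (PI * - a))%R by (apply sin_ge_0; nra).
      replace (PI * - a)%R with (- (PI * a))%R in H2 by ring. rewrite sin_neg in H2. lra.
    - rewrite Rabs_pos_eq; [reflexivity|]. rewrite Rabs_pos_eq in * by lra. apply sin_ge_0; nra. }
  rewrite E. pose proof (sin_lower (PI * Rabs a)) as L. nra.
Qed.

Lemma pow_le_reg2 (x y : R) : (0 <= y)%R -> (x ^ 2 <= y ^ 2)%R -> (x <= y)%R.
Proof. intros H1 H2. apply Rnot_lt_le. intros H. simpl in H2. nra. Qed.

(** For [q = rho * e^(i th)] one has [|1 - q|^2 = (1 - rho)^2 + 4 * rho * sin (th / 2)^2]; the
    second term is kept and the sine bounded below linearly. *)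
Lemma one_minus_q_lower (w : C) : (Rabs (Re w) <= 1 / 2)%R ->
  (exp (- PI * Rabs (Im w)) * Rabs (Re w) <= Cmod (1 - qpow 1 w)%C)%R.
Proof.
  intros H. set (a := Re w) in *. set (b := Im w).
  set (rho := exp (- (2 * PI * b))). set (th := (2 * (PI * a))%R).
  assert (Eq : qpow 1 w = (rho * cos th, rho * sin th)%R).
  { rewrite qpowE. unfold cexp. f_equal; f_equal.
    - unfold rho. f_equal. unfold b. destruct w as [x y]; unfold Cmult, RtoC, i; simpl; ring.
    - f_equal. unfold th, a. destruct w as [x y]; unfold Cmult, RtoC, i; simpl; ring.
    - unfold rho. f_equal. unfold b. destruct w as [x y]; unfold Cmult, RtoC, i; simpl; ring.
    - f_equal. unfold th, a. destruct w as [x y]; unfold Cmult, RtoC, i; simpl; ring. }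
  assert (Hr : (0 < rho)%R) by apply exp_pos.
  apply pow_le_reg2; [apply Cmod_ge_0|].
  rewrite Cmod2_alt, Eq.
  change (Re (1 - (rho * cos th, rho * sin th)%R)) with (1 + - (rho * cos th))%R.
  change (Im (1 - (rho * cos th, rho * sin th)%R)) with (0 + - (rho * sin th))%R.
  apply Rle_trans with (4 * rho * sin (PI * a) ^ 2)%R.
  - pose proof (sin_lower_abs a H) as S.
    rewrite <- (pow2_abs (sin (PI * a))). pose proof (Rabs_pos a).
    assert (Rabs a ^ 2 <= 4 * Rabs (sin (PI * a)) ^ 2)%R by (simpl; nra).
    assert (exp (- PI * Rabs b) ^ 2 <= rho)%R.
    { simpl. rewrite Rmult_1_r, <- exp_plus. unfold rho.
      pose proof (Rle_abs b). pose proof PI_RGT_0.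
      destruct (Req_dec (- PI * Rabs b + - PI * Rabs b) (- (2 * PI * b))) as [->|Hne]; [lra|].
      apply Rlt_le, exp_increasing. nra. }
    rewrite Rpow_mult_distr. pose proof (pow2_ge_0 (Rabs a)). pose proof (pow2_ge_0 (exp (- PI * Rabs b))).
    apply Rle_trans with (rho * (4 * Rabs (sin (PI * a)) ^ 2))%R; [apply Rmult_le_compat; lra|lra].
  - unfold th. rewrite cos_2a_sin, sin_2a. set (s := sin (PI * a)). set (c := cos (PI * a)).
    assert (c ^ 2 = 1 - s ^ 2)%R as E2.
    { pose proof (sin2_cos2 (PI * a)) as Q. unfold Rsqr in Q. fold s c in Q. simpl. lra. }
    replace ((1 + - (rho * (1 - 2 * s * s))) ^ 2 + (0 + - (rho * (2 * s * c))) ^ 2)%R with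
      ((1 - rho + 2 * rho * s ^ 2) ^ 2 + 4 * rho ^ 2 * s ^ 2 * c ^ 2)%R by ring.
    rewrite E2. replace ((1 - rho + 2 * rho * s ^ 2) ^ 2 + 4 * rho ^ 2 * s ^ 2 * (1 - s ^ 2))%R with
      ((1 - rho) ^ 2 + 4 * rho * s ^ 2)%R by ring.
    pose proof (pow2_ge_0 (1 - rho)). lra.
Qed.

Definition cpair (w : C) (k : nat) : C := / (w + INR (S k)) + / (w - INR (S k)).

Lemma div_RtoC (w : C) (r : R) : r <> 0%R -> w / r = RtoC (/ r) * w.
Proof. intros H. rewrite RtoC_inv by assumption. unfold Cdiv. ring. Qed.

Lemma Re_scal_R (r : R) (w : C) : Re (r * w) = (r * Re w)%R.
Proof. unfold Cmult, RtoC, Re, Im; simpl. ring. Qed.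

Lemma Im_scal_R (r : R) (w : C) : Im (r * w) = (r * Im w)%R.
Proof. unfold Cmult, RtoC, Re, Im; simpl. ring. Qed.

Lemma clim_ext_ev (u v : nat -> C) l N : (forall n, (N <= n)%nat -> u n = v n) -> clim u l -> clim v l.
Proof.
  intros H Hu. apply (clim_shift _ _ N). apply (clim_ext (fun n => u (N + n)%nat)).
  - intros; apply H; lia.
  - now apply clim_shift.
Qed.

(** The limit [M -> infinity] of [cot_finite_symm], by Tannery's theorem. A pair of cotangents with
    exponentials [e1], [e2] combines to a multiple of [(1 - e1 * e2) / ((1 - e1) * (1 - e2))]; the
    numerator is [O(1/N)] and each factor of the denominator at least a multiple of [k / N], which
    gives a majorant in [1 / k^2] independent of [M]. *)
Lemma cot_strip (w : C) : (Rabs (Re w) <= 1 / 2)%R -> qpow 1 w <> 1 ->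
  cabs (cpair w) /\ / w + Cser (cpair w) = cotp w.
Proof.
  intros Hw Hq.
  assert (w <> 0) as Hw0 by (intros ->; apply Hq, qpow_1_C0).
  pose (N M := INR (2 * M + 1)).
  assert (HN : forall M, (0 < N M)%R) by (intros; apply lt_0_INR; lia).
  assert (HNC : forall M, RtoC (N M) <> 0) by (intros; apply RtoC_neq0; specialize (HN M); lra).
  pose (F M k := if (k <? M)%nat then
     / N M * (cotp ((w + INR (S k)) / N M) + cotp ((w - INR (S k)) / N M)) else 0).
  (* As [e1 * e2 = qpow 1 (2 * w / N)], this [B] bounds [N * |1 - e1 * e2|] for all [M]. *)
  destruct (clim_bounded _ _ (clim_q_lin (2 * w))) as [B HB].
  set (E := exp (- PI * Rabs (Im w))). assert (HE : (0 < E)%R) by apply exp_pos.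
  set (A := (8 * PI * B / E ^ 2)%R).
  assert (HB0 : (0 <= B)%R) by (eapply Rle_trans; [apply Cmod_ge_0|apply (HB O)]).
  pose proof PI_RGT_0 as HPI.
  assert (LB : forall M k (s : R), (k < M)%nat -> Rabs s = INR (S k) ->
     (E * (INR (S k) / 2) / N M <= Cmod (1 - qpow 1 ((w + s) / N M))%C)%R).
  { intros M k s Hk Hs. specialize (HN M). rewrite div_RtoC by lra.
    pose proof (one_minus_q_lower (RtoC (/ N M) * (w + s))) as L.
    assert (Hi : (0 < / N M <= 1)%R).
    { split; [now apply Rinv_0_lt_compat|]. rewrite <- Rinv_1. apply Rinv_le_contravar; [lra|].
      unfold N. apply (le_INR 1). lia. }
    rewrite Re_scal_R, Im_scal_R in L.
    change (Re (w + s)) with (Re w + s)%R in L. replace (Im (w + s)) with (Im w) in L by (change (Im w = Im w + 0)%R; ring).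
    rewrite !Rabs_mult, (Rabs_pos_eq (/ N M)) in L by lra.
    assert (INR (S k) <= INR M)%R by (apply le_INR; lia).
    assert (NE : (N M = 2 * INR M + 1)%R) by (unfold N; rewrite plus_INR, mult_INR; simpl; ring).
    assert (INR (S k) - 1/2 <= Rabs (Re w + s))%R.
    { pose proof (Rabs_triang_inv s (- Re w)) as T. rewrite Rabs_Ropp in T.
      replace (s - - Re w)%R with (Re w + s)%R in T by ring. lra. }
    assert (Rabs (Re w + s) <= INR (S k) + 1/2)%R by (pose proof (Rabs_triang (Re w) s); lra).
    assert (1 <= INR (S k))%R by (rewrite S_INR; pose proof (pos_INR k); lra).
    (* The restriction to the strip is needed here: [k + 1 <= M] and [|Re w| <= 1/2] keep the
       rescaled argument within the range of [one_minus_q_lower]. *)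
    assert (Hle : (/ N M * Rabs (Re w + s) <= 1 / 2)%R).
    { apply Rmult_le_reg_l with (N M); [lra|]. rewrite <- Rmult_assoc, Rinv_r by lra. lra. }
    specialize (L Hle). eapply Rle_trans; [|exact L].
    assert (E <= exp (- PI * (/ N M * Rabs (Im w))))%R.
    { unfold E. pose proof (Rabs_pos (Im w)).
      destruct (Req_dec (- PI * Rabs (Im w)) (- PI * (/ N M * Rabs (Im w)))) as [Q|Q]; [rewrite Q at 1; lra|].
      apply Rlt_le, exp_increasing.
      assert (/ N M * Rabs (Im w) <= Rabs (Im w))%R by nra. nra. }
    replace (E * (INR (S k) / 2) / N M)%R with (E * (/ N M * (INR (S k) / 2)))%R by (field; lra).
    apply Rmult_le_compat; [lra| |assumption|apply Rmult_le_compat_l; lra].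
    apply Rmult_le_pos; lra. }
  assert (HF : forall M k, (Cmod (F M k) <= A * / INR (S k) ^ 2)%R).
  { intros M k. assert (0 < INR (S k))%R as HSk by (apply lt_0_INR; lia). unfold F. destruct (Nat.ltb_spec k M) as [Hk|Hk].
    2:{ rewrite Cmod_0. unfold A. apply Rmult_le_pos.
        - apply Rmult_le_pos; [nra|]. apply Rlt_le, Rinv_0_lt_compat, pow_lt, HE.
        - apply Rlt_le, Rinv_0_lt_compat, pow_lt, HSk. }
    pose proof (LB M k (INR (S k)) Hk (Rabs_pos_eq _ (Rlt_le _ _ HSk))) as L1.
    pose proof (LB M k (- INR (S k))%R Hk ltac:(rewrite Rabs_Ropp; apply Rabs_pos_eq; lra)) as L2.
    rewrite RtoC_opp in L2. replace (w + - INR (S k)) with (w - INR (S k)) in L2 by ring.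
    specialize (HN M). specialize (HNC M).
    set (e1 := qpow 1 ((w + INR (S k)) / N M)) in *. set (e2 := qpow 1 ((w - INR (S k)) / N M)) in *.
    assert (E12 : e1 * e2 = qpow 1 (2 * w / N M)).
    { unfold e1, e2. rewrite <- qpow_zplus. f_equal. field. assumption. }
    set (lb := (E * (INR (S k) / 2) / N M)%R) in *.
    assert (Hlb : (0 < lb)%R) by (unfold lb; apply Rdiv_lt_0_compat; nra).
    assert (1 - e1 <> 0) as N1 by (apply Cmod_gt_0; lra).
    assert (1 - e2 <> 0) as N2 by (apply Cmod_gt_0; lra).
    specialize (HB M). change (INR (2 * M + 1)) with (N M) in HB. rewrite <- E12, Cmod_mult, Cmod_R, Rabs_pos_eq in HB by lra.
    unfold cotp. fold e1 e2.
    replace (/ N M * (- RtoC PI * i * ((1 + e1) / (1 - e1)) + - RtoC PI * i * ((1 + e2) / (1 - e2)))) with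
      (RtoC (-2 * PI) * i * (/ (N M * N M) * (N M * (1 - e1 * e2))) * / ((1 - e1) * (1 - e2))).
    2:{ rewrite RtoC_mult. replace (RtoC (-2)) with (-(2)) by (rewrite <- RtoC_opp; reflexivity).
        field. repeat split; assumption. }
    rewrite !Cmod_mult, !Cmod_inv by (apply Cmult_neq_0; assumption). rewrite !Cmod_mult, Cmod_Ci, !Cmod_R.
    rewrite (Rabs_pos_eq (N M)) by lra. rewrite (Rabs_left (-2 * PI)) by lra.
    assert (I : (/ (Cmod (1 - e1)%C * Cmod (1 - e2)%C) <= / (lb * lb))%R).
    { apply Rinv_le_contravar; [nra|]. apply Rmult_le_compat; lra. }
    apply Rle_trans with (2 * PI * (/ (N M * N M) * B) * / (lb * lb))%R.
    - assert (0 < / (N M * N M))%R by (apply Rinv_0_lt_compat; nra).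
      apply Rmult_le_compat.
      + apply Rmult_le_pos; [lra|]. apply Rmult_le_pos; [lra|]. apply Rmult_le_pos; [lra|apply Cmod_ge_0].
      + apply Rlt_le, Rinv_0_lt_compat. apply Rmult_lt_0_compat; lra.
      + replace (- (-2 * PI) * 1)%R with (2 * PI)%R by ring. apply Rmult_le_compat_l; [lra|]. apply Rmult_le_compat_l; lra.
      + exact I.
    - unfold lb, A. apply Req_le. field. repeat split; lra. }
  assert (HL : forall k, clim (fun M => F M k) (cpair w k)).
  { intros k. assert (P : forall s : R, Rabs s = INR (S k) -> w + s <> 0).
    { intros s Hs Z. apply (f_equal Re) in Z. change (Re w + s = 0)%R in Z.
      assert (1 <= INR (S k))%R by (rewrite S_INR; pose proof (pos_INR k); lra).
      replace s with (- Re w)%R in Hs by lra. rewrite Rabs_Ropp in Hs. lra. }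
    assert (0 < INR (S k))%R as HSk by (apply lt_0_INR; lia).
    apply (clim_ext_ev (fun M => / N M * cotp ((w + INR (S k)) / N M) + / N M * cotp ((w - INR (S k)) / N M)) _ _ (S k)).
    - intros M HM. unfold F. rewrite (proj2 (Nat.ltb_lt _ _)) by lia. ring.
    - apply clim_plus; apply clim_cotp_lin.
      + apply P. apply Rabs_pos_eq. lra.
      + replace (w - INR (S k)) with (w + RtoC (- INR (S k))) by (rewrite RtoC_opp; ring).
        apply P. rewrite Rabs_Ropp. apply Rabs_pos_eq. lra. }
  pose proof (ex_series_inv_sq_scal A) as HA.
  split.
  - apply cabs_le with (fun k => A * / INR (S k) ^ 2)%R; [|exact HA].
    intros k. apply clim_Cmod_le with (fun M => F M k); [intros; apply HF|apply HL].
  - apply (clim_unique (fun _ => cotp w)); [|apply clim_const].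
    apply (clim_ext (fun M => / N M * cotp (w / N M) + Cser (F M))).
    + intros M. rewrite (Cser_fin _ M).
      * rewrite (cot_finite_symm w M Hq). change (INR (2 * M + 1)) with (N M). rewrite Cmult_plus_distr_l, <- csum_scal. f_equal.
        apply csum_ext. intros k Hk. unfold F. now rewrite (proj2 (Nat.ltb_lt _ _)) by lia.
      * intros k Hk. unfold F. now rewrite (proj2 (Nat.ltb_ge _ _)) by lia.
    + apply clim_plus; [apply clim_cotp_lin; assumption|]. now apply tannery with (fun k => A * / INR (S k) ^ 2)%R.
Qed.

(** The imaginary part controls [m], and then the triangle inequality controls [x]. One constant
    serves all lattice points, hence all the series over [m z + n] below. *)
Lemma lattice_lower (z : C) : UHP z -> exists dl : R, (0 < dl)%R /\
  forall m x : R, (0 <= m)%R -> (dl * (m + Rabs x) <= Cmod (m * z + x)%C)%R.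
Proof.
  intros Hz. unfold UHP in Hz. pose proof (Cmod_ge_0 z) as H0.
  assert (HK : (0 < 1 + (Cmod z + 1) / Im z)%R).
  { assert (0 < (Cmod z + 1) / Im z)%R by (apply Rdiv_lt_0_compat; lra). lra. }
  exists (/ (1 + (Cmod z + 1) / Im z))%R. split; [now apply Rinv_0_lt_compat|].
  intros m x Hm. set (v := Cmod (m * z + x)).
  assert (Hi : (m * Im z <= v)%R).
  { unfold v. eapply Rle_trans; [|apply im_le_Cmod].
    replace (Im (m * z + x)) with (m * Im z)%R by (change (Im (m * z + x)) with (Im (m * z) + 0)%R; rewrite Im_scal_R; ring).
    apply Rle_abs. }
  assert (Hx : (Rabs x <= v + m * Cmod z)%R).
  { assert (E : Rabs x = Cmod ((m * z + x) - m * z)) by (rewrite <- Cmod_R; f_equal; ring).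
    rewrite E. eapply Rle_trans; [apply Cmod_sub_le|]. fold v. rewrite (Cmod_mult m z), Cmod_R, (Rabs_pos_eq m) by lra. lra. }
  apply Rmult_le_reg_l with (1 + (Cmod z + 1) / Im z)%R; [assumption|].
  rewrite <- Rmult_assoc, Rinv_r, Rmult_1_l by lra.
  assert (m <= v / Im z)%R by (apply Rle_div_r; lra).
  replace ((1 + (Cmod z + 1) / Im z) * v)%R with (v + v / Im z * (Cmod z + 1))%R by (field; lra).
  assert (m * (Cmod z + 1) <= v / Im z * (Cmod z + 1))%R by (apply Rmult_le_compat_r; lra). lra.
Qed.

Lemma UHP_real_neq0 (w : C) (s : R) : UHP w -> w + s <> 0.
Proof. intros H Z. apply (f_equal Im) in Z. change (Im w + 0 = 0)%R in Z. unfold UHP in H. lra. Qed.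

Lemma UHP_minus_neq0 (w : C) (s : R) : UHP w -> w - s <> 0.
Proof.
  intros H. replace (w - s) with (w + RtoC (- s)) by (rewrite RtoC_opp; ring). now apply UHP_real_neq0.
Qed.

Lemma UHP_neq0 (w : C) : UHP w -> w <> 0.
Proof. intros H Z. rewrite Z in H. unfold UHP in H. simpl in H. lra. Qed.

Lemma UHP_shift (w : C) (s : R) : UHP w -> UHP (w + s).
Proof. unfold UHP. change (Im (w + s)) with (Im w + 0)%R. lra. Qed.

Lemma inv_bounds (w : C) (dl : R) k : UHP w -> (0 < dl)%R ->
  (forall m x : R, (0 <= m)%R -> (dl * (m + Rabs x) <= Cmod (m * w + x)%C)%R) ->
  (Cmod (/ (w + INR (S k))) <= / (dl * INR (S k)) /\ Cmod (/ (w - INR (S k))) <= / (dl * INR (S k)))%R.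
Proof.
  intros Hw Hd H. assert (0 < INR (S k))%R as HS by (apply lt_0_INR; lia).
  split; rewrite Cmod_inv by (first [now apply UHP_real_neq0|now apply UHP_minus_neq0]).
  - apply Rinv_le_contravar; [nra|]. specialize (H 1%R (INR (S k)) ltac:(lra)).
    rewrite Cmult_1_l, Rabs_pos_eq in H by lra. nra.
  - apply Rinv_le_contravar; [nra|]. specialize (H 1%R (- INR (S k))%R ltac:(lra)).
    rewrite Cmult_1_l, Rabs_Ropp, Rabs_pos_eq, RtoC_opp in H by lra. unfold Cminus. nra.
Qed.

Lemma cabs_cpair (w : C) : UHP w -> cabs (cpair w).
Proof.
  intros Hw. destruct (lattice_lower w Hw) as (dl & Hd & H).
  apply cabs_le with (fun k => 2 * Cmod w / dl ^ 2 * / INR (S k) ^ 2)%R; [|apply ex_series_inv_sq_scal].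
  intros k. assert (0 < INR (S k))%R as HS by (apply lt_0_INR; lia).
  destruct (inv_bounds w dl k Hw Hd H) as [B1 B2].
  replace (cpair w k) with (2 * w * (/ (w + INR (S k)) * / (w - INR (S k)))).
  2:{ unfold cpair. field. split; [now apply UHP_minus_neq0|now apply UHP_real_neq0]. }
  rewrite !Cmod_mult, Cmod_R, Rabs_pos_eq by lra.
  replace (2 * Cmod w / dl ^ 2 * / INR (S k) ^ 2)%R with (2 * Cmod w * (/ (dl * INR (S k)) * / (dl * INR (S k))))%R
    by (field; lra).
  apply Rmult_le_compat_l; [pose proof (Cmod_ge_0 w); lra|].
  apply Rmult_le_compat; try apply Cmod_ge_0; assumption.
Qed.

Lemma clim_inv_lin (w : C) (s : R) : Rabs s = 1%R -> clim (fun M => / (w + s * INR M)) 0.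
Proof.
  intros Hs. intros eps He.
  destruct (archimed_cor1 eps He) as (n0 & H1 & H2).
  destruct (INR_unbounded (Cmod w + INR n0)) as [N HN]. exists N. intros M HM.
  replace (/ (w + s * INR M) - 0) with (/ (w + s * INR M)) by ring.
  assert (INR N <= INR M)%R by now apply le_INR.
  assert (L : (INR n0 < Cmod (w + s * INR M))%R).
  { replace (w + s * INR M) with (s * INR M - - w) by ring. pose proof (Cmod_sub_ge (s * INR M) (- w)) as T.
    rewrite Cmod_opp, Cmod_mult, !Cmod_R, Hs, Rabs_pos_eq in T by apply pos_INR. lra. }
  assert (0 < INR n0)%R by now apply lt_0_INR.
  rewrite Cmod_inv by (apply Cmod_gt_0; lra).
  apply Rlt_trans with (/ INR n0)%R; [apply Rinv_lt_contravar; [nra|assumption]|assumption].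
Qed.

Lemma RtoC_m1 : RtoC (-1) = -(1).
Proof. rewrite <- RtoC_opp. reflexivity. Qed.

(** Passage from the strip to the half-plane: replacing [w] by [w + 1] changes a symmetric partial
    sum by two boundary terms only, and these tend to zero. *)
Lemma cot_UHP (w : C) : UHP w -> / w + Cser (cpair w) = cotp w.
Proof.
  intros Hw.
  pose (S M (w : C) := / w + csum (cpair w) M).
  assert (D : forall w M, UHP w -> S M (w + 1) = S M w + (/ ((w + 1) + 1%R * INR M) - / (w + (-1)%R * INR M))).
  { clear w Hw. intros w M Hw. unfold S. induction M as [|M IH].
    - simpl. replace (w + 1 + 1 * 0) with (w + 1) by ring. replace (w + (-1)%R * 0) with w by ring. ring.
    - cbn [csum]. unfold cpair at 2 4. rewrite Cplus_assoc, IH.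
      replace (w + 1 + 1%R * INR M) with (w + INR (Datatypes.S M)) by (rewrite S_INR, RtoC_plus; ring).
      replace (w + (-1)%R * INR M) with (w + 1 - INR (Datatypes.S M)).
      2:{ rewrite S_INR, RtoC_plus, RtoC_m1. ring. }
      replace (w + 1 + 1%R * INR (Datatypes.S M)) with (w + 1 + INR (Datatypes.S M)) by ring.
      replace (w + (-1)%R * INR (Datatypes.S M)) with (w - INR (Datatypes.S M)) by (rewrite RtoC_m1; ring).
      ring. }
  assert (L : forall w, clim (fun M => / ((w + 1) + 1%R * INR M) - / (w + (-1)%R * INR M)) 0).
  { intros v. replace (RtoC 0) with (0 - 0) by ring. apply clim_minus; apply clim_inv_lin.
    - apply Rabs_R1. - rewrite Rabs_left; lra. }
  pose (P (w : C) := UHP w -> clim (fun M => S M w) (cotp w)).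
  assert (P1 : forall w n, P w -> P (w + INR n)).
  { intros v n Hv. induction n as [|n IH].
    - simpl. replace (v + 0) with v by ring. exact Hv.
    - intros H. rewrite S_INR, RtoC_plus, Cplus_assoc in *.
      assert (UHP (v + INR n)) as H' by (unfold UHP in *; simpl in *; lra).
      rewrite (cotp_period (v + INR n) 1).
      eapply clim_ext; [intros M; symmetry; now apply D|].
      replace (cotp (v + INR n)) with (cotp (v + INR n) + 0) by ring.
      apply clim_plus; [now apply IH|apply L]. }
  assert (P2 : forall w n, P w -> P (w - INR n)).
  { intros v n Hv. induction n as [|n IH].
    - simpl. replace (v - 0) with v by ring. exact Hv.
    - intros H. set (u := v - INR (Datatypes.S n)) in *.
      assert (E : v - INR n = u + 1) by (unfold u; rewrite S_INR, RtoC_plus; ring).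
      rewrite E in IH. rewrite <- (cotp_period u 1).
      apply (clim_ext (fun M => S M (u + 1) - (/ ((u + 1) + 1%R * INR M) - / (u + (-1)%R * INR M)))).
      + intros M. rewrite D by assumption. ring.
      + replace (cotp (u + 1)) with (cotp (u + 1) - 0) by ring. apply clim_minus; [|apply L].
        apply IH. now apply UHP_shift. }
  assert (Pw : P w).
  { pose (n := up (Re w - 1 / 2)). destruct (archimed (Re w - 1 / 2)) as [U1 U2]. fold n in U1, U2.
    assert (P0 : P (w - IZR n)).
    { intros H. assert (Hq : qpow 1 (w - IZR n) <> 1).
      { intros Z. pose proof (Cmod_q_lt1 _ H) as B. rewrite Z, Cmod_1 in B. lra. }
      destruct (cot_strip (w - IZR n)) as [C1 C2].
      - change (Re (w - IZR n)) with (Re w + - IZR n)%R. apply Rabs_le. lra.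
      - assumption.
      - rewrite <- C2. unfold S. apply clim_plus; [apply clim_const|]. now apply csums_Cser. }
    destruct (Z.le_gt_cases 0 n) as [Hn|Hn].
    - replace w with (w - IZR n + INR (Z.to_nat n)); [now apply P1|].
      rewrite INR_IZR_INZ, Z2Nat.id by assumption. ring.
    - replace w with (w - IZR n - INR (Z.to_nat (- n))); [now apply P2|].
      rewrite INR_IZR_INZ, Z2Nat.id, opp_IZR, RtoC_opp by lia. ring. }
  apply (clim_unique (fun M => S M w)); [|now apply Pw].
  unfold S. apply clim_plus; [apply clim_const|]. apply csums_Cser. now apply cabs_cpair.
Qed.

(** * The weight 2 Eisenstein series and eta *)

Definition kpair (w : C) (k : nat) : C :=
  / ((w + INR (S k)) * (w + INR (S k))) + / ((w - INR (S k)) * (w - INR (S k))).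

Lemma Cinv2 (a : C) : a <> 0 -> / (a * a) = / a * / a.
Proof. intros H. now field. Qed.

Lemma cabs_kpair (w : C) : UHP w -> cabs (kpair w).
Proof.
  intros Hw. destruct (lattice_lower w Hw) as (dl & Hd & H).
  apply cabs_le with (fun k => 2 / dl ^ 2 * / INR (S k) ^ 2)%R; [|apply ex_series_inv_sq_scal].
  intros k. assert (0 < INR (S k))%R as HS by (apply lt_0_INR; lia).
  destruct (inv_bounds w dl k Hw Hd H) as [B1 B2]. unfold kpair.
  rewrite !Cinv2 by (first [now apply UHP_real_neq0|now apply UHP_minus_neq0]).
  eapply Rle_trans; [apply Cmod_triangle|]. rewrite !Cmod_mult.
  replace (2 / dl ^ 2 * / INR (S k) ^ 2)%R with
    (/ (dl * INR (S k)) * / (dl * INR (S k)) + / (dl * INR (S k)) * / (dl * INR (S k)))%R by (field; lra).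
  apply Rplus_le_compat; apply Rmult_le_compat; try apply Cmod_ge_0; assumption.
Qed.

Lemma inv_quad (a h : C) : a <> 0 -> a + h <> 0 ->
  / (a + h) - / a + h * / (a * a) = h * h * (/ a * / a * / (a + h)).
Proof. intros H1 H2. now field. Qed.

(** Termwise differentiation: by [inv_quad] the remainder of [1 / (a + h)] is exactly
    [h^2 / (a^2 * (a + h))]. For [|h| <= Im w / 2] the last factor costs at most [2 / Im w], so the
    remainders are summable like [1 / k^2]. *)
Lemma qder_cpair (w : C) : UHP w -> qder (fun w => Cser (cpair w)) w (- Cser (kpair w)).
Proof.
  intros Hw. destruct (lattice_lower w Hw) as (dl & Hd & H). pose proof Hw as Hw'. unfold UHP in Hw'.
  pose (B := fun k => (4 / (Im w * dl ^ 2) * / INR (S k) ^ 2)%R).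
  assert (HB : ex_series B) by apply ex_series_inv_sq_scal.
  assert (B0 : forall k, (0 <= B k)%R).
  { intros k. unfold B. apply Rmult_le_pos.
    - apply Rlt_le, Rdiv_lt_0_compat; [lra|]. apply Rmult_lt_0_compat; [lra|now apply pow_lt].
    - apply Rlt_le, Rinv_0_lt_compat, pow_lt, lt_0_INR. lia. }
  exists (Im w / 2)%R, (Series B). split; [lra|]. split; [exact (rsum_le_Series B 0 HB B0)|].
  intros h Hh. assert (Hwh : UHP (w + h)) by (apply UHP_open; [assumption|lra]).
  replace (Cser (cpair (w + h)) - Cser (cpair w) - h * - Cser (kpair w)) with
    (Cser (cpair (w + h)) - Cser (cpair w) + h * Cser (kpair w)) by ring.
  rewrite <- Cser_minus, <- Cser_scal, <- Cser_plus;
    try (first [now apply cabs_cpair|now apply cabs_kpair|now apply cabs_scal, cabs_kpair]).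
  2:{ apply cabs_minus; now apply cabs_cpair. }
  rewrite Rmult_comm, <- Series_scal_l. apply Cser_Cmod_le.
  2:{ now apply (ex_series_scal_l (Cmod h ^ 2)%R B). }
  intros k. assert (0 < INR (S k))%R as HS by (apply lt_0_INR; lia).
  destruct (inv_bounds w dl k Hw Hd H) as [B1 B2].
  set (a := w + INR (S k)) in *. set (b := w - INR (S k)) in *.
  assert (a <> 0) as Ha by now apply UHP_real_neq0. assert (b <> 0) as Hb by now apply UHP_minus_neq0.
  assert (Lw : forall s : R, (Cmod (/ ((w + h) + s)) <= 2 / Im w)%R).
  { intros s. rewrite Cmod_inv by now apply UHP_real_neq0.
    replace (2 / Im w)%R with (/ (Im w / 2))%R by (field; lra). apply Rinv_le_contravar; [lra|].
    eapply Rle_trans; [|apply im_le_Cmod]. change (Im (w + h + s)) with (Im w + Im h + 0)%R.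
    pose proof (im_le_Cmod h) as Q. apply Rabs_le_between in Q. rewrite Rabs_pos_eq; lra. }
  pose proof (Lw (INR (S k))) as L1. pose proof (Lw (- INR (S k))%R) as L2. rewrite RtoC_opp in L2.
  replace (w + h + INR (S k)) with (a + h) in L1 by (unfold a; ring).
  replace (w + h + - INR (S k)) with (b + h) in L2 by (unfold b; ring).
  replace (cpair (w + h) k - cpair w k + h * kpair w k) with
    (h * h * (/ a * / a * / (a + h)) + h * h * (/ b * / b * / (b + h))).
  2:{ rewrite <- !inv_quad; try assumption.
      - unfold cpair, kpair. fold a b. replace (w + h + INR (S k)) with (a + h) by (unfold a; ring).
        replace (w + h - INR (S k)) with (b + h) by (unfold b; ring). ring.
      - replace (b + h) with ((w + h) - INR (S k)) by (unfold b; ring). now apply UHP_minus_neq0.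
      - replace (a + h) with ((w + h) + INR (S k)) by (unfold a; ring). now apply UHP_real_neq0. }
  eapply Rle_trans; [apply Cmod_triangle|]. rewrite !Cmod_mult.
  unfold B. set (t := (/ (dl * INR (S k)))%R) in *.
  replace (Cmod h ^ 2 * (4 / (Im w * dl ^ 2) * / INR (S k) ^ 2))%R with
    (Cmod h * Cmod h * (t * t * (2 / Im w)) + Cmod h * Cmod h * (t * t * (2 / Im w)))%R by (unfold t; field; lra).
  pose proof (Cmod_ge_0 h).
  apply Rplus_le_compat; (apply Rmult_le_compat_l; [nra|]); repeat apply Rmult_le_compat;
    try apply Cmod_ge_0; try assumption; apply Rmult_le_pos; apply Cmod_ge_0.
Qed.

(** This is [pi^2 / sin^2 (pi w)], the sum of [1 / (w + n)^2] over all integers [n]: a single row of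
    the Eisenstein series, which is the sum of [E2 (m z)] over [m]. *)
Definition E2 (w : C) : C := - (RtoC (4 * PI ^ 2) * (qpow 1 w / ((1 - qpow 1 w) * (1 - qpow 1 w)))).

Lemma ii : i * i = -(1).
Proof. unfold i, Cmult, Copp, RtoC; simpl. f_equal; ring. Qed.

Lemma qder_cotp (w : C) : UHP w -> qder cotp w (- E2 w).
Proof.
  intros Hw. pose proof (one_minus_neq0 _ (Cmod_q_lt1 w Hw)) as Hn.
  assert (D : qder (fun w => - RtoC PI * i * (2 * (/ (1 - qpow 1 w)) + -(1))) w
     (- RtoC PI * i * (2 * (RtoC (2 * PI * 1) * i * qpow 1 w * / ((1 - qpow 1 w) * (1 - qpow 1 w))) + 0))).
  { apply qder_scal, qder_plus; [|apply qder_const]. apply qder_scal.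
    apply (qder_comp (fun y => / (1 - y)) (qpow 1)); [apply qder_qpow|]. apply qder_ones. now apply Cmod_q_lt1. }
  eapply qder_val; [eapply qder_ext_loc; [|intros h Hh|exact D]|].
  - exact (Rdiv_lt_0_compat _ 2 Hw ltac:(lra)).
  - unfold cotp. pose proof (one_minus_neq0 _ (Cmod_q_lt1 (w + h) ltac:(apply UHP_open; [assumption|unfold UHP in Hw; lra]))).
    field. assumption.
  - unfold E2. replace (RtoC (4 * PI ^ 2)) with (- (i * i) * (4 * RtoC PI * RtoC PI)).
    + rewrite Rmult_1_r, RtoC_mult. field. assumption.
    + rewrite ii, RtoC_mult, RtoC_pow. ring.
Qed.

Lemma E2_UHP (w : C) : UHP w -> / (w * w) + Cser (kpair w) = E2 w.
Proof.
  intros Hw. pose proof (UHP_neq0 w Hw) as Hw0.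
  assert (- / (w * w) + - Cser (kpair w) = - E2 w) as E.
  { apply (qder_unique cotp w); [|now apply qder_cotp].
    eapply qder_ext_loc; [|intros h Hh|apply qder_plus; [apply (qder_inv w Hw0)|apply (qder_cpair w Hw)]].
    - exact (Rdiv_lt_0_compat _ 2 Hw ltac:(lra)).
    - apply cot_UHP, UHP_open; [assumption|unfold UHP in Hw; lra]. }
  replace (/ (w * w) + Cser (kpair w)) with (- (- / (w * w) + - Cser (kpair w))) by ring. rewrite E. ring.
Qed.

Definition zeta2 : R := Series (fun k => / INR (S k) ^ 2)%R.

Lemma csum_pairs f n : csum f (2 * n) = csum (fun k => f (2 * k)%nat + f (2 * k + 1)%nat) n.
Proof.
  induction n as [|n IH]; [reflexivity|].
  replace (2 * S n)%nat with (S (S (2 * n))) by lia. cbn [csum]. rewrite IH.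
  replace (S (2 * n)) with (2 * n + 1)%nat by lia. ring.
Qed.

Lemma half_plus (k : nat) : (RtoC (1 / 2) + INR (S k)) = RtoC (INR (2 * S k + 1) / 2) /\
  (RtoC (1 / 2) - INR (S k)) = - RtoC (INR (2 * k + 1) / 2).
Proof.
  split; [rewrite <- RtoC_plus|rewrite <- RtoC_minus, <- RtoC_opp]; f_equal;
  rewrite !plus_INR, !mult_INR, !S_INR; simpl; field.
Qed.

(* Let [w = 1/2 + i t] tend to [1/2] in [E2_UHP]: the sum of [1/n^2] over odd [n] is [pi^2/8]. *)
Lemma basel : zeta2 = (PI ^ 2 / 6)%R.
Proof.
  pose (w n := RtoC (1 / 2) + / INR (S n) * i).
  assert (Rw : forall n, Re (w n) = (1 / 2)%R /\ Im (w n) = (/ INR (S n))%R).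
  { intros n. unfold w. rewrite <- RtoC_inv by (apply not_0_INR; lia).
    split; [change (1 / 2 + (/ INR (S n) * 0 - 0 * 1) = 1 / 2)%R|
            change (0 + (/ INR (S n) * 1 + 0 * 0) = / INR (S n))%R]; ring. }
  assert (Uw : forall n, UHP (w n)).
  { intros n. unfold UHP. rewrite (proj2 (Rw n)). apply Rinv_0_lt_compat, lt_0_INR. lia. }
  assert (Lw : clim w (RtoC (1 / 2))).
  { apply clim_squeeze with (fun n => / INR (S n))%R.
    - intros n. unfold w. replace (RtoC (1 / 2) + / INR (S n) * i - RtoC (1 / 2)) with (/ INR (S n) * i) by ring.
      rewrite Cmod_mult, Cmod_Ci, Cmod_inv, Cmod_R, Rabs_pos_eq by (try apply pos_INR; apply INR_S_neq0). lra.
    - replace (Finite 0) with (Rbar_inv p_infty) by reflexivity.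
      apply is_lim_seq_inv; [|discriminate]. apply (is_lim_seq_incr_1 INR). apply is_lim_seq_INR. }
  assert (NZ : forall k, RtoC (1 / 2) + INR (S k) <> 0 /\ RtoC (1 / 2) - INR (S k) <> 0).
  { intros k. destruct (half_plus k) as [-> ->]. rewrite <- RtoC_opp. split; apply RtoC_neq0.
    - pose proof (lt_0_INR (2 * S k + 1) ltac:(lia)). lra.
    - pose proof (lt_0_INR (2 * k + 1) ltac:(lia)). lra. }
  assert (LB : forall n k, (/ (4 : R) * INR (S k) ^ 2 <= Cmod ((w n + INR (S k)) * (w n + INR (S k)))%C /\
     / 4 * INR (S k) ^ 2 <= Cmod ((w n - INR (S k)) * (w n - INR (S k)))%C)%R).
  { intros n k. rewrite !Cmod_mult. assert (1 <= INR (S k))%R by (rewrite S_INR; pose proof (pos_INR k); lra).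
    assert (Q1 : (INR (S k) / 2 <= Cmod (w n + INR (S k))%C)%R).
    { eapply Rle_trans; [|apply re_le_Cmod]. change (Re (w n + INR (S k))) with (Re (w n) + INR (S k))%R.
      rewrite (proj1 (Rw n)), Rabs_pos_eq; lra. }
    assert (Q2 : (INR (S k) / 2 <= Cmod (w n - INR (S k))%C)%R).
    { eapply Rle_trans; [|apply re_le_Cmod]. change (Re (w n - INR (S k))) with (Re (w n) + - INR (S k))%R.
      rewrite (proj1 (Rw n)), Rabs_left1; lra. }
    split; nra. }
  assert (HT : clim (fun n => Cser (kpair (w n))) (Cser (kpair (RtoC (1 / 2))))).
  { apply tannery with (fun k => 8 * / INR (S k) ^ 2)%R; [|apply ex_series_inv_sq_scal|].
    - intros n k. destruct (LB n k) as [B1 B2]. assert (0 < INR (S k))%R as HS by (apply lt_0_INR; lia).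
      unfold kpair. eapply Rle_trans; [apply Cmod_triangle|].
      pose proof (UHP_real_neq0 (w n) (INR (S k)) (Uw n)). pose proof (UHP_minus_neq0 (w n) (INR (S k)) (Uw n)).
      rewrite !Cmod_inv by (apply Cmult_neq_0; assumption).
      assert (0 < / 4 * INR (S k) ^ 2)%R by (pose proof (pow_lt _ 2 HS); lra).
      replace (8 * / INR (S k) ^ 2)%R with (/ (/ 4 * INR (S k) ^ 2) + / (/ 4 * INR (S k) ^ 2))%R by (field; lra).
      apply Rplus_le_compat; apply Rinv_le_contravar; assumption.
    - intros k. destruct (NZ k) as [N1 N2]. unfold kpair. apply clim_plus; apply clim_inv.
      + now apply Cmult_neq_0.
      + apply clim_mult; (apply clim_plus; [exact Lw|apply clim_const]).
      + now apply Cmult_neq_0.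
      + apply clim_mult; (apply clim_minus; [exact Lw|apply clim_const]). }
  assert (qh : qpow 1 (RtoC (1 / 2)) = -(1)).
  { rewrite qpow_real. unfold cexp, Cmult, RtoC, i, Copp; simpl.
    replace (2 * PI * (1 * (1 / 2)) * 0 - 0 * 1)%R with 0%R by ring.
    replace (2 * PI * (1 * (1 / 2)) * 1 + 0 * 0)%R with PI by field.
    rewrite exp_0, cos_PI, sin_PI. f_equal; ring. }
  assert (Lq : clim (fun n => qpow 1 (w n)) (-(1))).
  { rewrite <- qh. apply (clim_qder (qpow 1) w _ _ (qder_qpow 1 _) Lw). }
  assert (HE : clim (fun n => E2 (w n)) (PI ^ 2)%R).
  { replace (RtoC (PI ^ 2)) with (-(1) * (RtoC (4 * PI ^ 2) * (-(1) * / ((1 - -(1)) * (1 - -(1)))))).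
    2:{ replace (1 - -(1)) with (RtoC 2) by ring. rewrite (RtoC_mult 4). field. }
    apply (clim_ext (fun n => -(1) * (RtoC (4 * PI ^ 2) * (qpow 1 (w n) * / ((1 - qpow 1 (w n)) * (1 - qpow 1 (w n))))))).
    { intros n. unfold E2, Cdiv. ring. }
    apply clim_scal, clim_scal, clim_mult; [exact Lq|]. apply clim_inv.
    - replace (1 - -(1)) with (RtoC 2) by ring. rewrite <- RtoC_mult. apply RtoC_neq0. lra.
    - apply clim_mult; (apply clim_minus; [apply clim_const|exact Lq]). }
  assert (HS : 4 + Cser (kpair (RtoC (1 / 2))) = (PI ^ 2)%R).
  { apply (clim_unique (fun n => E2 (w n))); [|exact HE].
    apply (clim_ext (fun n => / (w n * w n) + Cser (kpair (w n)))); [intros n; now apply E2_UHP|].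
    apply clim_plus; [|exact HT].
    replace (RtoC 4) with (/ (RtoC (1 / 2) * RtoC (1 / 2))).
    - apply clim_inv; [rewrite <- RtoC_mult; apply RtoC_neq0; lra|]. now apply clim_mult.
    - rewrite <- RtoC_mult, <- RtoC_inv by lra. f_equal. field. }
  pose (a n := RtoC (/ INR (S n) ^ 2)).
  assert (Ca : cabs a).
  { apply cabs_le with (fun k => / INR (S k) ^ 2)%R; [|apply ex_series_inv_sq]. intros n. unfold a.
    rewrite Cmod_R, Rabs_pos_eq; [lra|]. apply Rlt_le, Rinv_0_lt_compat, pow_lt, lt_0_INR; lia. }
  assert (Za : Cser a = zeta2).
  { apply RtoC_Series; [apply ex_series_inv_sq|]. intros n. apply Rlt_le, Rinv_0_lt_compat, pow_lt, lt_0_INR; lia. }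
  pose (o n := a (2 * n)%nat).
  assert (Bo : forall n, (Cmod (o n) <= 1 * / INR (S n) ^ 2)%R).
  { intros n. unfold o, a. assert (0 < INR (S n))%R by (apply lt_0_INR; lia).
    assert (INR (S n) <= INR (S (2 * n)))%R by (apply le_INR; lia).
    rewrite Cmod_R, Rabs_pos_eq by (apply Rlt_le, Rinv_0_lt_compat, pow_lt; lra).
    rewrite Rmult_1_l. apply Rinv_le_contravar; [now apply pow_lt|]. apply pow_incr. lra. }
  assert (Co : cabs o) by (eapply cabs_le; [exact Bo|apply ex_series_inv_sq_scal]).
  (* Odd denominators give [o], even ones a quarter of the whole sum. *)
  assert (Eo : Cser a = Cser o + (/ 4) * Cser a).
  { apply Cser_unique; [exact Ca|].
    assert (C4 : cabs (fun n => (/ 4) * a n)) by now apply cabs_scal.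
    rewrite <- Cser_scal, <- Cser_plus by assumption.
    pose proof (csums_Cser _ (cabs_plus _ _ Co C4)) as H1.
    pose proof (csums_Cser _ Ca) as H2.
    assert (clim (fun n => csum a (2 * n)) (Cser a)) as H3.
    { apply (clim_subseq (csum a) _ (fun n => (2 * n)%nat)); [|exact H2]. intros M. exists M. intros; lia. }
    assert (Cser (fun n => o n + (/ 4) * a n) = Cser a) as ->; [|exact H2].
    apply (clim_unique (fun n => csum a (2 * n))); [|exact H3].
    eapply clim_ext; [|exact H1]. intros n. rewrite csum_pairs. apply csum_ext. intros k _. unfold o. f_equal.
    unfold a. replace (/ 4) with (RtoC (/ 4)) by (rewrite RtoC_inv by lra; reflexivity). rewrite <- RtoC_mult.
    f_equal. rewrite <- Rinv_mult. f_equal. rewrite !S_INR, plus_INR, mult_INR. simpl. ring. }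
  (* At [w = 1/2] every term is four times an odd reciprocal square, and both signs of the index run
     through all of them, up to the term [4] that is kept apart. *)
  assert (Ek : Cser (kpair (RtoC (1 / 2))) = 4 * (2 * Cser o - 1)).
  { rewrite (Cser_ext _ (fun k => 4 * (o (S k) + o k))).
    - rewrite Cser_scal, Cser_plus; try assumption.
      + pose proof (Cser_S_l o Co) as Q.
        assert (o O = 1) as O1 by (unfold o, a; simpl; f_equal; field). rewrite O1 in Q.
        replace (Cser (fun n => o (S n))) with (Cser o - 1) by (rewrite Q; ring). ring.
      + apply (cabs_shift o 1); assumption.
      + apply cabs_plus; [apply (cabs_shift o 1); assumption|assumption].
    - intros k. unfold kpair. destruct (half_plus k) as [-> ->]. unfold o, a.
      assert (INR (2 * S k + 1) <> 0)%R by (apply not_0_INR; lia).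
      assert (INR (2 * k + 1) <> 0)%R by (apply not_0_INR; lia).
      replace (S (2 * S k)) with (2 * S k + 1)%nat by lia. replace (S (2 * k)) with (2 * k + 1)%nat by lia.
      rewrite <- RtoC_opp, <- !RtoC_mult, <- !RtoC_inv, <- !RtoC_plus by (apply Rmult_integral_contrapositive_currified; lra).
      rewrite <- RtoC_mult. f_equal. field. split; assumption. }
  assert (F1 : RtoC (6 * zeta2) = RtoC (PI ^ 2)).
  { rewrite RtoC_mult, <- Za, <- HS, Ek.
    assert (Cser o = RtoC (3 / 4) * Cser a) as ->.
    { replace (Cser o) with (Cser a - (/ 4) * Cser a) by (rewrite Eo at 1; ring).
      rewrite RtoC_div by lra. field. }
    rewrite RtoC_div by lra. field. }
  apply RtoC_inj in F1. lra.
Qed.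

Lemma Cmod_sq_Re_Im (z : C) : (Cmod z ^ 2 = Re z * Re z + Im z * Im z)%R.
Proof. rewrite Cmod2_alt. ring. Qed.

Lemma Im_neg_inv (z : C) : z <> 0 -> Im (- / z) = (Im z / Cmod z ^ 2)%R.
Proof.
  intros H. assert (Cmod z ^ 2 <> 0)%R by (apply pow_nonzero; intros Z; apply H; now apply Cmod_eq_0).
  rewrite Cmod_sq_Re_Im in *. destruct z as [x y]. unfold Cinv, Copp in *; simpl in *. field.
  intros Z. apply H0. rewrite <- Z. ring.
Qed.

Lemma UHP_neg_inv (z : C) : UHP z -> UHP (- / z).
Proof.
  intros H. pose proof (UHP_neq0 z H) as H0. unfold UHP in *. rewrite Im_neg_inv by assumption.
  apply Rdiv_lt_0_compat; [assumption|]. apply pow_lt. now apply Cmod_gt_0.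
Qed.

Lemma UHP_scal (r : R) (z : C) : (0 < r)%R -> UHP z -> UHP (r * z).
Proof. unfold UHP. intros Hr H. rewrite Im_scal_R. nra. Qed.

Section Eisenstein.

Variable z : C.
Hypothesis Hz : UHP z.
Let z' := - / z.
Let m1 (m : nat) : R := INR (S m).
(** For [W = m z + n] the difference [1 / (W - 1/2) - 1 / (W + 1/2) = 1 / (W^2 - 1/4)] approximates
    [1 / W^2] up to [O(|W|^-4)]. Subtracting it, as [X] does, makes the double series absolutely
    convergent; the correction telescopes along [n] and sums to a cotangent along [m]. *)
Let g (m : nat) (x : R) : C := / (m1 m * z - x) - / (m1 m * z + x).
Let X (m n : nat) : C := kpair (m1 m * z) n - (g m (m1 n + / 2) - g m (m1 n - / 2)).

Let Hz0 : z <> 0 := UHP_neq0 z Hz.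
Let Hz' : UHP z' := UHP_neg_inv z Hz.

Lemma m1_pos m : (0 < m1 m)%R.
Proof. apply lt_0_INR. lia. Qed.

Lemma m1_ge1 m : (1 <= m1 m)%R.
Proof. unfold m1. rewrite S_INR. pose proof (pos_INR m). lra. Qed.

Lemma m1z_UHP m : UHP (m1 m * z).
Proof. apply UHP_scal; [apply m1_pos|exact Hz]. Qed.

Lemma X_bound : exists A : R, forall m n, (Cmod (X m n) <= A * / m1 m ^ 2 * / m1 n ^ 2)%R.
Proof.
  destruct (lattice_lower z Hz) as (dl & Hd & H). exists (/ dl ^ 4)%R. intros m n.
  pose proof (m1_ge1 m) as Hm. pose proof (m1_ge1 n) as Hn.
  (* The halving absorbs the shifts by [1/2], since [n - 1/2 >= n / 2]. *)
  set (lb := (dl * (m1 m + m1 n) / 2)%R).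
  assert (0 < lb)%R as Hlb by (unfold lb; nra).
  assert (L : forall x : R, (m1 n / 2 <= Rabs x)%R -> (lb <= Cmod (m1 m * z + x)%C)%R).
  { intros x Hx. eapply Rle_trans; [|apply H; lra]. unfold lb. nra. }
  assert (NZ : forall x : R, m1 m * z + x <> 0) by (intros x; apply UHP_real_neq0, m1z_UHP).
  assert (T : forall s : R, Rabs s = m1 n ->
    let W := m1 m * z + s in
    (Cmod (/ (W * W) - (/ (W - RtoC (/ 2)) - / (W + RtoC (/ 2))))%C <= / 2 * (/ dl ^ 4 * / m1 m ^ 2 * / m1 n ^ 2))%R).
  { intros s Hs W.
    assert (E1 : W - RtoC (/ 2) = m1 m * z + RtoC (s - / 2)) by (unfold W; rewrite RtoC_minus; ring).
    assert (E2' : W + RtoC (/ 2) = m1 m * z + RtoC (s + / 2)) by (unfold W; rewrite RtoC_plus; ring).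
    assert (L0 : (lb <= Cmod W)%R) by (apply L; rewrite Hs; lra).
    assert (L1 : (lb <= Cmod (W - RtoC (/ 2))%C)%R).
    { rewrite E1. apply L. pose proof (Rabs_triang_inv s (/ 2)). rewrite (Rabs_pos_eq (/ 2)) in * by lra. lra. }
    assert (L2 : (lb <= Cmod (W + RtoC (/ 2))%C)%R).
    { rewrite E2'. apply L. pose proof (Rabs_triang_inv s (- / 2)) as T0. rewrite Rabs_Ropp in T0.
      replace (s - - / 2)%R with (s + / 2)%R in T0 by ring. rewrite (Rabs_pos_eq (/ 2)) in * by lra. lra. }
    assert (N0 : W <> 0) by apply NZ. assert (N1 : W - RtoC (/ 2) <> 0) by (rewrite E1; apply NZ).
    assert (N2 : W + RtoC (/ 2) <> 0) by (rewrite E2'; apply NZ).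
    replace (/ (W * W) - (/ (W - RtoC (/ 2)) - / (W + RtoC (/ 2)))) with
      (RtoC (- / 4) * / (W * W * ((W - RtoC (/ 2)) * (W + RtoC (/ 2))))).
    2:{ replace (RtoC (- / 4)) with (- (RtoC (/ 2) * RtoC (/ 2))) by (rewrite <- RtoC_mult, <- RtoC_opp; f_equal; field).
        set (h := RtoC (/ 2)) in *. assert (h + h = 1) as E by (unfold h; rewrite <- RtoC_plus; f_equal; field).
        replace (/ (W - h) - / (W + h)) with ((h + h) * / ((W - h) * (W + h))) by (field; split; assumption).
        rewrite E. field. repeat split; assumption. }
    rewrite Cmod_mult, Cmod_R, Rabs_Ropp, (Rabs_pos_eq (/ 4)) by lra.
    rewrite Cmod_inv by (repeat apply Cmult_neq_0; assumption). rewrite !Cmod_mult.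
    apply Rle_trans with (/ 4 * / (lb * lb * (lb * lb)))%R.
    - apply Rmult_le_compat_l; [lra|]. assert (0 < lb * lb)%R by nra.
      apply Rinv_le_contravar; [nra|]. apply Rmult_le_compat; try nra; apply Rmult_le_compat; lra.
    (* The inequality of the means turns [(m + n)^-4] into a product of functions of [m] and of
       [n]. *)
    - assert (Q : (4 * (m1 m * m1 n) <= (m1 m + m1 n) ^ 2)%R).
      { pose proof (pow2_ge_0 (m1 m - m1 n)). simpl in *. nra. }
      assert (Q2 : (16 * (m1 m ^ 2 * m1 n ^ 2) <= ((m1 m + m1 n) ^ 2) ^ 2)%R).
      { replace (16 * (m1 m ^ 2 * m1 n ^ 2))%R with ((4 * (m1 m * m1 n)) ^ 2)%R by ring. apply pow_incr. nra. }
      replace (/ 2 * (/ dl ^ 4 * / m1 m ^ 2 * / m1 n ^ 2))%R with (/ 4 * / (dl ^ 4 * (m1 m ^ 2 * m1 n ^ 2) / 2))%R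
        by (field; repeat split; lra).
      apply Rmult_le_compat_l; [lra|].
      pose proof (pow_lt dl 4 Hd). assert (0 < m1 m ^ 2 * m1 n ^ 2)%R by (apply Rmult_lt_0_compat; apply pow_lt; lra).
      apply Rinv_le_contravar; [nra|].
      replace (lb * lb * (lb * lb))%R with (dl ^ 4 * ((m1 m + m1 n) ^ 2) ^ 2 / 16)%R by (unfold lb; field).
      nra. }
  pose proof (T (m1 n) ltac:(apply Rabs_pos_eq; lra)) as T1.
  pose proof (T (- m1 n)%R ltac:(rewrite Rabs_Ropp; apply Rabs_pos_eq; lra)) as T2. cbv zeta in T1, T2.
  rewrite RtoC_opp in T2.
  replace (X m n) with
   ((/ ((m1 m * z + m1 n) * (m1 m * z + m1 n)) - (/ (m1 m * z + m1 n - RtoC (/ 2)) - / (m1 m * z + m1 n + RtoC (/ 2)))) +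
    (/ ((m1 m * z + - m1 n) * (m1 m * z + - m1 n)) - (/ (m1 m * z + - m1 n - RtoC (/ 2)) - / (m1 m * z + - m1 n + RtoC (/ 2))))).
  - eapply Rle_trans; [apply Cmod_triangle|]. lra.
  - unfold X, kpair, g. fold (m1 n). rewrite RtoC_plus, RtoC_minus.
    replace (m1 m * z - (m1 n + RtoC (/ 2))) with (m1 m * z + - m1 n - RtoC (/ 2)) by ring.
    replace (m1 m * z + (m1 n + RtoC (/ 2))) with (m1 m * z + m1 n + RtoC (/ 2)) by ring.
    replace (m1 m * z - (m1 n - RtoC (/ 2))) with (m1 m * z + - m1 n + RtoC (/ 2)) by ring.
    replace (m1 m * z + (m1 n - RtoC (/ 2))) with (m1 m * z + m1 n - RtoC (/ 2)) by ring.
    replace (m1 m * z - m1 n) with (m1 m * z + - m1 n) by ring. ring.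
Qed.

(** From [m z - x = z * (x * z' + m)]: the substitution [z' = - / z] exchanges the two directions of
    the lattice. *)
Lemma g_cpair m (x : R) : (0 < x)%R -> g m x = / z * cpair (x * z') m.
Proof.
  intros Hx. unfold g, cpair. fold (m1 m).
  pose proof (UHP_real_neq0 _ x (m1z_UHP m)). pose proof (UHP_minus_neq0 _ x (m1z_UHP m)).
  assert (E1 : x * z' + m1 m = (m1 m * z - x) / z) by (unfold z'; field; assumption).
  assert (E3 : x * z' - m1 m = - ((m1 m * z + x) / z)) by (unfold z'; field; assumption).
  rewrite E1, E3. field. repeat split; try assumption.
Qed.

Lemma cabs_g (x : R) : (0 < x)%R -> cabs (fun m => g m x).
Proof.
  intros Hx. apply cabs_ext with (fun m => / z * cpair (x * z') m); [intros; now rewrite g_cpair|].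
  apply cabs_scal, cabs_cpair. now apply UHP_scal.
Qed.

Lemma Cser_g (x : R) : (0 < x)%R -> Cser (fun m => g m x) = / z * (cotp (x * z') - / (x * z')).
Proof.
  intros Hx. rewrite (Cser_ext _ (fun m => / z * cpair (x * z') m)) by (intros; now apply g_cpair).
  assert (UHP (x * z')) by now apply UHP_scal.
  rewrite Cser_scal by now apply cabs_cpair. rewrite <- cot_UHP by assumption. f_equal. ring.
Qed.

Lemma clim_inv_seq (a b : C) : b <> 0 -> clim (fun n => / (a + INR n * b)) 0.
Proof.
  intros Hb. apply (clim_ext (fun n => / b * / (a / b + 1%R * INR n))).
  - intros n. destruct (excluded_middle_informative (a + INR n * b = 0)) as [E|E].
    + rewrite E. replace (a / b + 1%R * INR n) with ((a + INR n * b) / b) by (field; assumption).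
      rewrite E. replace (0 / b) with (RtoC 0) by (unfold Cdiv; ring).
      unfold Cinv, RtoC, Cmult; simpl. f_equal; lra.
    + field. split; [exact E|assumption].
  - replace (RtoC 0) with (/ b * 0) by ring. apply clim_scal, clim_inv_lin. apply Rabs_R1.
Qed.

Lemma csums_dg m : csums (fun n => g m (m1 n + / 2) - g m (m1 n - / 2)) (- g m (/ 2)).
Proof.
  apply (clim_ext (fun N => g m (INR N + / 2)%R - g m (/ 2))).
  - intros N. rewrite <- (Rplus_0_l (/ 2)) at 2. change 0%R with (INR 0).
    rewrite <- (csum_telescope (fun n => g m (INR n + / 2)%R)). apply csum_ext. intros n _.
    unfold m1. do 2 f_equal. rewrite S_INR. field.
  - replace (- g m (/ 2)) with (0 - g m (/ 2)) by ring. apply clim_minus; [|apply clim_const].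
    unfold g. replace (RtoC 0) with (0 - 0) by ring. apply clim_minus.
    + apply (clim_ext (fun n => / ((m1 m * z - RtoC (/ 2)) + INR n * (-(1))))).
      * intros n. f_equal. rewrite RtoC_plus. ring.
      * apply clim_inv_seq. intros Z. apply C1_nz. replace (RtoC 1) with (-(-(1))) by ring. rewrite Z. ring.
    + apply (clim_ext (fun n => / ((m1 m * z + RtoC (/ 2)) + INR n * 1))).
      * intros n. f_equal. rewrite RtoC_plus. ring.
      * apply clim_inv_seq. apply C1_nz.
Qed.

Lemma clim_pow0 (x : C) : (Cmod x < 1)%R -> clim (fun n => x ^ n) 0.
Proof.
  intros H. apply clim_squeeze with (fun n => Cmod x ^ n)%R.
  - intros n. replace (x ^ n - 0) with (x ^ n) by ring. rewrite Cmod_pow. lra.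
  - apply is_lim_seq_geom. rewrite Rabs_pos_eq; [assumption|apply Cmod_ge_0].
Qed.

(** As [x] grows, [x * z'] tends to [i * infinity], where [pi * cot] tends to [- pi * i]. This limit
    is the origin of the anomalous term in [E2_transform]. *)
Lemma clim_Cser_g : clim (fun N => Cser (fun m => g m (INR N + / 2)%R)) (/ z * (- RtoC PI * i)).
Proof.
  assert (Hx : forall N, (0 < INR N + / 2)%R) by (intros N; pose proof (pos_INR N); lra).
  eapply clim_ext; [intros N; symmetry; now apply Cser_g|]. apply clim_scal.
  assert (Lq : clim (fun N => qpow 1 ((INR N + / 2)%R * z')) 0).
  { apply (clim_ext (fun N => qpow (/ 2) z' * qpow 1 z' ^ N)).
    - intros N. rewrite qpow_zscal, <- qpow_nat, <- qpow_plus. f_equal. ring.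
    - replace (RtoC 0) with (qpow (/ 2) z' * 0) by ring. apply clim_scal, clim_pow0. now apply Cmod_q_lt1. }
  replace (- RtoC PI * i) with (- RtoC PI * i * ((1 + 0) * / (1 - 0)) - 0) by field.
  apply clim_minus.
  - unfold cotp, Cdiv. apply clim_scal, clim_mult.
    + apply clim_plus; [apply clim_const|exact Lq].
    + apply clim_inv; [replace (1 - 0) with (RtoC 1) by ring; apply C1_nz|].
      apply clim_minus; [apply clim_const|exact Lq].
  - apply (clim_ext (fun n => / (RtoC (/ 2) * z' + INR n * z'))).
    + intros n. f_equal. rewrite RtoC_plus. ring.
    + apply clim_inv_seq. now apply UHP_neq0.
Qed.

Lemma kpair_swap m n : kpair (m1 m * z) n = / (z * z) * kpair (m1 n * z') m.
Proof.
  unfold kpair. fold (m1 m) (m1 n).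
  pose proof (UHP_real_neq0 _ (m1 n) (m1z_UHP m)). pose proof (UHP_minus_neq0 _ (m1 n) (m1z_UHP m)).
  assert (E1 : m1 n * z' + m1 m = (m1 m * z - m1 n) / z) by (unfold z'; field; assumption).
  assert (E3 : m1 n * z' - m1 m = - ((m1 m * z + m1 n) / z)) by (unfold z'; field; assumption).
  rewrite E1, E3. field. repeat split; assumption.
Qed.

Lemma cabs_E2 (w : C) : UHP w -> cabs (fun m => E2 (INR (S m) * w)) /\
  Cser (fun m => E2 (INR (S m) * w)) = - (RtoC (4 * PI ^ 2) * (qpow 1 w * ev (dco Lco) (qpow 1 w))).
Proof.
  intros Hw. destruct (ev_Sco _ (Cmod_q_lt1 w Hw)) as [E1 E2'].
  assert (E : forall m, E2 (INR (S m) * w) = RtoC (- (4 * PI ^ 2)) * (qpow 1 w ^ S m / ((1 - qpow 1 w ^ S m) * (1 - qpow 1 w ^ S m)))).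
  { intros m. unfold E2. rewrite qpow_zscal, Rmult_1_l, qpow_nat, RtoC_opp. ring. }
  split.
  - eapply cabs_ext; [intros m; symmetry; apply E|]. now apply cabs_scal.
  - rewrite (Cser_ext _ _ E), Cser_scal, <- E1, RtoC_opp by assumption. ring.
Qed.

Lemma cabs_inv_sq (w : C) : cabs (fun m => / (w * w) * RtoC (/ m1 m ^ 2)) /\
   Cser (fun m => / (w * w) * RtoC (/ m1 m ^ 2)) = / (w * w) * zeta2.
Proof.
  assert (P : forall n, (0 <= / m1 n ^ 2)%R) by (intros; apply Rlt_le, Rinv_0_lt_compat, pow_lt, m1_pos).
  assert (C0 : cabs (fun m => RtoC (/ m1 m ^ 2))).
  { apply cabs_le with (fun k => / m1 k ^ 2)%R; [|exact ex_series_inv_sq]. intros n.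
    rewrite Cmod_R, Rabs_pos_eq; [lra|apply P]. }
  split; [now apply cabs_scal|]. rewrite Cser_scal by exact C0. f_equal.
  apply RtoC_Series; [exact ex_series_inv_sq|exact P].
Qed.

Lemma E2_split (w : C) m : UHP w -> Cser (kpair (m1 m * w)) = E2 (m1 m * w) - / (w * w) * RtoC (/ m1 m ^ 2).
Proof.
  intros Hw. rewrite <- E2_UHP by (apply UHP_scal; [apply m1_pos|assumption]).
  pose proof (m1_pos m). rewrite RtoC_inv, RtoC_pow by (apply pow_nonzero; lra).
  assert (RtoC (m1 m) <> 0) by (apply RtoC_neq0; lra). pose proof (UHP_neq0 w Hw).
  field. split; assumption.
Qed.

(* Interchanging the two summations in [E2] costs the boundary term [pi i / z]. *)
Lemma E2_transform :
  Cser (fun m => E2 (m1 m * z)) - / (z * z) * zeta2 =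
  / (z * z) * Cser (fun m => E2 (m1 m * z')) - zeta2 + RtoC PI * i * / z.
Proof.
  destruct X_bound as [A HA].
  assert (R1 : forall m, cabs (X m)).
  { intros m. apply cabs_le with (fun n => A * / m1 m ^ 2 * / m1 n ^ 2)%R; [apply HA|].
    apply (ex_series_inv_sq_scal (A * / m1 m ^ 2)). }
  assert (A0 : (0 <= A)%R).
  { pose proof (HA O O) as H. pose proof (Cmod_ge_0 (X 0 0)). unfold m1 in H. simpl in H. rewrite !Rmult_1_r, Rinv_1 in H. lra. }
  assert (R2 : ex_series (fun m => Series (fun n => Cmod (X m n)))).
  { apply (ex_series_le (K := R_AbsRing) (V := R_CompleteNormedModule) _ (fun m => (A * zeta2) * / m1 m ^ 2)%R).
    - intros m. unfold norm; simpl; unfold abs; simpl. fold (m1 m). rewrite Rabs_pos_eq.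
      + replace (A * zeta2 * / (m1 m * (m1 m * 1)))%R with (A * / m1 m ^ 2 * zeta2)%R by (simpl; ring).
        unfold zeta2. rewrite <- Series_scal_l. apply Series_le.
        * intros n. split; [apply Cmod_ge_0|apply HA].
        * apply (ex_series_inv_sq_scal (A * / m1 m ^ 2)).
      + apply (rsum_le_Series _ 0 (R1 m)). intros; apply Cmod_ge_0.
    - apply (ex_series_inv_sq_scal (A * zeta2)). }
  destruct (fubini X R1 R2) as (C1 & C2 & C3 & C4).
  assert (Row : forall m, Cser (X m) = Cser (kpair (m1 m * z)) + g m (/ 2)).
  { intros m. apply Cser_unique; [apply R1|].
    eapply clim_ext; [intros n; symmetry; apply csum_minus|].
    replace (Cser (kpair (m1 m * z)) + g m (/ 2)) with (Cser (kpair (m1 m * z)) - - g m (/ 2)) by ring.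
    apply clim_minus; [|apply csums_dg]. apply csums_Cser, cabs_kpair, m1z_UHP. }
  destruct (cabs_E2 z Hz) as [CE _]. destruct (cabs_E2 z' Hz') as [CE' _].
  destruct (cabs_inv_sq z) as [CI EI]. destruct (cabs_inv_sq 1) as [CI1 EI1].
  assert (HG : forall N, (0 < INR N + / 2)%R) by (intros N; pose proof (pos_INR N); lra).
  assert (Col : forall n, Cser (fun m => X m n) =
     (/ (z * z) * E2 (m1 n * z') - / (1 * 1) * RtoC (/ m1 n ^ 2)) -
     (Cser (fun m => g m (INR (S n) + / 2)%R) - Cser (fun m => g m (INR n + / 2)%R))).
  { intros n. rewrite <- Cser_minus by (apply cabs_g, HG).
    assert (Hs : cabs (fun m => kpair (m1 m * z) n)).
    { apply cabs_ext with (fun m => / (z * z) * kpair (m1 n * z') m); [intros; now rewrite kpair_swap|].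
      apply cabs_scal, cabs_kpair, UHP_scal; [apply m1_pos|assumption]. }
    assert (Es : Cser (fun m => kpair (m1 m * z) n) = / (z * z) * E2 (m1 n * z') - / (1 * 1) * RtoC (/ m1 n ^ 2)).
    { rewrite (Cser_ext _ _ (fun m => kpair_swap m n)).
      rewrite Cser_scal by (apply cabs_kpair, UHP_scal; [apply m1_pos|assumption]).
      rewrite E2_split by assumption. unfold z'. field. assumption. }
    rewrite <- Es, <- Cser_minus.
    - apply Cser_ext. intros m. unfold X, m1. do 3 f_equal. rewrite S_INR. field.
    - exact Hs.
    - apply cabs_minus; apply cabs_g, HG. }
  assert (LHS : Cser (fun m => Cser (X m)) = Cser (fun m => E2 (m1 m * z)) - / (z * z) * zeta2 + Cser (fun m => g m (/ 2))).
  { assert (HR : forall m, Cser (X m) = (E2 (m1 m * z) - / (z * z) * RtoC (/ m1 m ^ 2)) + g m (/ 2)).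
    { intros m. rewrite Row, E2_split by assumption. reflexivity. }
    rewrite (Cser_ext _ _ HR), Cser_plus, Cser_minus, EI; try assumption; [reflexivity| |].
    - now apply cabs_minus. - apply cabs_g. lra. }
  assert (RHS : Cser (fun n => Cser (fun m => X m n)) =
     (/ (z * z) * Cser (fun n => E2 (m1 n * z')) - / (1 * 1) * zeta2) - (/ z * (- RtoC PI * i) - Cser (fun m => g m (/ 2)))).
  { apply Cser_unique; [exact C3|].
    eapply clim_ext; [intros N; symmetry; apply csum_ext; intros n _; apply Col|].
    eapply clim_ext; [intros N; symmetry; apply csum_minus|]. apply clim_minus.
    - rewrite <- EI1, <- Cser_scal by exact CE'. rewrite <- Cser_minus.
      + apply csums_Cser. apply cabs_minus; [now apply cabs_scal|exact CI1].
      + now apply cabs_scal.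
      + exact CI1.
    - eapply clim_ext; [intros N; symmetry; apply (csum_telescope (fun n => Cser (fun m => g m (INR n + / 2)%R)))|].
      apply clim_minus; [apply clim_Cser_g|]. simpl INR. rewrite Rplus_0_l. apply clim_const. }
  rewrite LHS, RHS in C4. set (a := Cser (fun m => E2 (m1 m * z))) in *. set (b := Cser (fun n => E2 (m1 n * z'))) in *.
  set (G := Cser (fun m => g m (/ 2))) in *.
  replace (a - / (z * z) * zeta2) with ((a - / (z * z) * zeta2 + G) - G) by ring.
  rewrite <- C4. field. assumption.
Qed.

End Eisenstein.

(** * The logarithm of eta squared and its behaviour under inversion *)

Definition ell (z : C) : C := RtoC (PI / 6) * i * z - 2 * Lam z.

(* This is [eta^2] on the upper half-plane, see [h2E]. *)
Definition etasq (z : C) : C := cexp (ell z).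

Lemma qder_ell (z : C) : UHP z ->
  qder ell z (RtoC (PI / 6) * i + RtoC (/ PI) * i * Cser (fun m => E2 (INR (S m) * z))).
Proof.
  intros Hz. pose proof PI_RGT_0.
  eapply qder_val.
  - apply (qder_ext_loc (fun z => RtoC (PI / 6) * i * z + (-(2)) * Lam z) _ z _ 1); [lra|intros; unfold ell; ring|].
    apply qder_plus; [apply qder_scal, qder_id|]. apply qder_scal. apply (qder_ps Lco z rad1_Lco Hz).
  - rewrite (proj2 (cabs_E2 z Hz)). rewrite RtoC_inv by lra. rewrite !RtoC_mult, RtoC_pow. field. apply RtoC_neq0. lra.
Qed.

Lemma etasq_S (z : C) : UHP z -> etasq (- / z) = - i * z * etasq z.
Proof.
  intros Hz. pose proof PI_RGT_0 as HPI.
  (* The quotient of the two sides of the transformation law has zero derivative on the segment from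
     [z] to the fixed point [i] of the inversion, where its value is known. *)
  assert (E : cexp (ell (- / z) - ell z) * / z = cexp (ell (- / i) - ell i) * / i).
  { apply (qder_zero_const (fun z => cexp (ell (- / z) - ell z) * / z)). intros t Ht.
    set (w := z + t * (i - z)).
    assert (Hw : UHP w).
    { unfold UHP in *. unfold w. change (Im (z + t * (i - z))) with (Im z + Im (t * (i - z)))%R.
      rewrite Im_scal_R. change (Im (i - z)) with (1 + - Im z)%R.
      destruct (Req_dec t 1) as [->|]; [lra|nra]. }
    pose proof (UHP_neq0 w Hw) as Hw0. pose proof (UHP_neg_inv w Hw) as Hw'.
    pose proof (E2_transform w Hw) as T. rewrite basel in T.
    pose proof (qder_ell w Hw) as D1. pose proof (qder_ell (- / w) Hw') as D2.
    set (G := Cser (fun m => E2 (INR (S m) * w))) in *.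
    set (G' := Cser (fun m => E2 (INR (S m) * - / w))) in *.
    assert (D3 : qder (fun z => - / z) w (/ (w * w))).
    { eapply qder_val; [apply (qder_ext_loc (fun z => (-(1)) * / z) _ w ((-(1)) * - / (w * w)) 1); [lra|intros; ring|]|].
      - apply qder_scal, qder_inv. assumption.
      - ring. }
    assert (D4 : qder (fun z => ell (- / z) + (-(1)) * ell z) w
       (/ (w * w) * (RtoC (PI / 6) * i + RtoC (/ PI) * i * G') + (-(1)) * (RtoC (PI / 6) * i + RtoC (/ PI) * i * G))).
    { apply qder_plus; [|now apply qder_scal]. exact (qder_comp ell _ w _ _ D3 D2). }
    (* The terms with [PI / 6] cancel against those with [zeta2], which is where its value is
       needed; the boundary term of [E2_transform] is all that remains. *)
    assert (ED : (/ (w * w) * (RtoC (PI / 6) * i + RtoC (/ PI) * i * G') + (-(1)) * (RtoC (PI / 6) * i + RtoC (/ PI) * i * G)) = / w).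
    { assert (RtoC PI <> 0) as HP by (apply RtoC_neq0; lra).
      replace G with (/ (w * w) * G' - RtoC (PI ^ 2 / 6) + RtoC PI * i * / w + / (w * w) * RtoC (PI ^ 2 / 6)).
      - rewrite RtoC_inv, !RtoC_div, RtoC_pow by lra.
        transitivity (- (i * i) * / w); [field; repeat split; assumption|rewrite ii; ring].
      - rewrite <- T. ring. }
    rewrite ED in D4.
    eapply qder_val.
    - apply (qder_ext_loc (fun z => cexp (ell (- / z) + (-(1)) * ell z) * / z) _ w _ 1); [lra| |].
      + intros h _. do 2 f_equal. ring.
      + apply qder_mult; [|apply qder_inv; assumption].
        apply (qder_comp cexp (fun z => ell (- / z) + (-(1)) * ell z)); [exact D4|apply qder_cexp].
    - cbv beta. field. assumption. }
  assert (Hi : i <> 0).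
  { intros Z. apply (f_equal Cmod) in Z. rewrite Cmod_Ci, Cmod_0 in Z. lra. }
  assert (- / i = i) as Ei.
  { apply (Cmult_reg_l i); [assumption|]. rewrite ii. field. assumption. }
  rewrite Ei in E. replace (ell i - ell i) with (RtoC 0) in E by ring. rewrite cexp_0 in E.
  pose proof (UHP_neq0 z Hz) as Hz0. unfold etasq.
  replace (ell (- / z)) with ((ell (- / z) - ell z) + ell z) by ring. rewrite cexp_plus.
  f_equal. replace (cexp (ell (- / z) - ell z)) with (z * (cexp (ell (- / z) - ell z) * / z)) by (field; assumption).
  rewrite E. rewrite <- Ei at 2. field. assumption.
Qed.

(** * The Fricke group *)

(** The boolean selects between the character and its conjugate, so that the two families of forms
    are treated by the same lemmas; [ich b 1] is the multiplier of [z -> z + 1]. *)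
Definition ich (b : bool) (e : Z) : C := if b then ipow e else Cconj (ipow e).

Definition chi (b : bool) (eps : R) : mat -> C := if b then nu eps else nubar eps.

Lemma ipow_mod e : ipow (e mod 4) = ipow e.
Proof. unfold ipow. now rewrite Z.mod_mod by lia. Qed.

Lemma ich_mod b e e' : (e mod 4 = e' mod 4)%Z -> ich b e = ich b e'.
Proof. intros H. unfold ich. rewrite <- (ipow_mod e), H, ipow_mod. reflexivity. Qed.

Lemma ipow_succ e : ipow (e + 1) = ipow e * i.
Proof.
  unfold ipow. rewrite Z.add_mod by lia. pose proof (Z.mod_pos_bound e 4 ltac:(lia)) as B.
  assert (e mod 4 = 0 \/ e mod 4 = 1 \/ e mod 4 = 2 \/ e mod 4 = 3)%Z as [E|[E|[E|E]]] by lia; rewrite E;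
  unfold Zmod, Z.modulo; simpl; unfold Cmult, RtoC, Copp, Defs.Ci, i; simpl; f_equal; ring.
Qed.

Lemma ich_0 b : ich b 0 = 1.
Proof. unfold ich, ipow. simpl. destruct b; [reflexivity|]. unfold Cconj, RtoC; simpl. f_equal; ring. Qed.

Lemma ich_succ b e : ich b (e + 1) = ich b e * ich b 1.
Proof.
  unfold ich. replace (ipow 1) with i by reflexivity. rewrite ipow_succ.
  destruct b; [reflexivity|]. apply Cmult_conj.
Qed.

Lemma ich_add b e n : ich b (e + n) = ich b e * ich b n.
Proof.
  assert (H : forall k : nat, ich b (e + Z.of_nat k) = ich b e * ich b (Z.of_nat k)).
  { induction k as [|k IH]; [simpl; rewrite Z.add_0_r, ich_0; ring|].
    rewrite Nat2Z.inj_succ, <- Z.add_1_r, Z.add_assoc, !ich_succ, IH. ring. }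
  rewrite (ich_mod b (e + n) (e + Z.of_nat (Z.to_nat (n mod 4)))), (ich_mod b n (Z.of_nat (Z.to_nat (n mod 4)))).
  - apply H.
  - rewrite Z2Nat.id by (apply Z.mod_pos_bound; lia). now rewrite Z.mod_mod by lia.
  - rewrite Z2Nat.id by (apply Z.mod_pos_bound; lia). now rewrite Zplus_mod_idemp_r.
Qed.

Lemma Cmod_ich b e : Cmod (ich b e) = 1%R.
Proof.
  assert (Cmod (ipow e) = 1%R) as H.
  { unfold ipow. destruct (e mod 4)%Z as [|[p|[p|p|]|]|p]; rewrite ?Cmod_opp, ?Cmod_R, ?Rabs_R1; try apply Cmod_Ci; try reflexivity.
    rewrite Rabs_left; lra. }
  unfold ich. destruct b; [assumption|]. now rewrite Cmod_conj.
Qed.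

Lemma chiE b eps m : chi b eps m =
  if Z.eqb (mdet m) 1 then ich b (md m * (mb m - mc m / 2))
  else RtoC eps * ich b ((mc m / 2) * (ma m / 2 + md m / 2)).
Proof.
  unfold chi, nubar, nu, ich. destruct b, (mdet m =? 1)%Z; try reflexivity.
  rewrite Cmult_conj. f_equal. unfold Cconj, RtoC; simpl. f_equal; ring.
Qed.

Definition aut (m : mat) (z : C) : C := RtoC (IZR (mc m)) * z + RtoC (IZR (md m)).

Lemma slash2E m f z : (0 <= mdet m)%Z ->
  slash 2 m f z = RtoC (IZR (mdet m)) * / (aut m z * aut m z) * f (mact m z).
Proof.
  intros H. unfold slash. fold (aut m z). do 2 f_equal.
  - rewrite <- RtoC_pow. simpl. rewrite Rmult_1_r, sqrt_sqrt; [reflexivity|]. now apply (IZR_le 0).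
  - f_equal. simpl. ring.
Qed.

Lemma aut_neq0 m z : (mdet m <> 0)%Z -> UHP z -> aut m z <> 0.
Proof.
  intros Hd Hz E. unfold aut in E.
  pose proof (f_equal Im E) as E1. rewrite <- (Cplus_0_r 0) in E1.
  change (Im (IZR (mc m) * z + IZR (md m))) with (Im (IZR (mc m) * z) + 0)%R in E1.
  rewrite Im_scal_R in E1. simpl in E1. unfold UHP in Hz.
  assert (IZR (mc m) = 0)%R as Ec by nra. apply eq_IZR_R0 in Ec.
  rewrite Ec, Cmult_0_l, Cplus_0_l in E. apply RtoC_inj, eq_IZR_R0 in E.
  apply Hd. unfold mdet. rewrite Ec, E. ring.
Qed.

Definition Tinv (b : bool) (f : C -> C) : Prop := forall z, UHP z -> f (z + 1) = ich b 1 * f z.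

(* For weight 2, [f | W2 = eps f] without denominators. *)
Definition Winv (eps : R) (f : C -> C) : Prop :=
  forall z, UHP z -> f (- / (2 * z)) = RtoC eps * (2 * z * z) * f z.

Lemma UHP_IZR z n : UHP z -> UHP (z + IZR n).
Proof. apply UHP_shift. Qed.

Lemma Tinv_Z b f n z : Tinv b f -> UHP z -> f (z + IZR n) = ich b n * f z.
Proof.
  intros HT Hz.
  assert (H : forall k : nat, f (z + INR k) = ich b (Z.of_nat k) * f z).
  { induction k as [|k IH].
    - simpl. replace (z + 0) with z by ring. rewrite ich_0. ring.
    - rewrite S_INR, RtoC_plus, Cplus_assoc, HT by now apply UHP_shift.
      rewrite IH, Nat2Z.inj_succ, <- Z.add_1_r, ich_succ. ring. }
  destruct (Z.le_gt_cases 0 n) as [Hn|Hn].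
  - specialize (H (Z.to_nat n)). rewrite INR_IZR_INZ, Z2Nat.id in H by assumption. exact H.
  - assert (H' : forall k : nat, f (z - INR k) = ich b (- Z.of_nat k) * f z).
    { induction k as [|k IH].
      - simpl. replace (z - 0) with z by ring. rewrite ich_0. ring.
      - set (w := z - INR (S k)).
        assert (E : z - INR k = w + 1) by (unfold w; rewrite S_INR, RtoC_plus; ring).
        assert (Hw : UHP w).
        { unfold w. replace (z - INR (S k)) with (z + RtoC (- INR (S k))) by (rewrite RtoC_opp; ring).
          now apply UHP_shift. }
        rewrite E, HT in IH by exact Hw.
        replace (- Z.of_nat k)%Z with (- Z.of_nat (S k) + 1)%Z in IH by lia. rewrite ich_succ in IH.
        apply (Cmult_reg_l (ich b 1)).
        + apply Cmod_gt_0. rewrite Cmod_ich. lra.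
        + rewrite IH. ring. }
    specialize (H' (Z.to_nat (- n))). rewrite INR_IZR_INZ, Z2Nat.id in H' by lia.
    rewrite opp_IZR, RtoC_opp in H'. replace (z - - IZR n) with (z + IZR n) in H' by ring.
    rewrite Z.opp_involutive in H'. exact H'.
Qed.

Lemma W_UHP z : UHP z -> UHP (- / (2 * z)).
Proof. intros H. apply UHP_neg_inv, UHP_scal; [lra|assumption]. Qed.

(** The map [z -> z / (2 s z + 1)] is the translation by [- s] conjugated by [W2]; the sign [eps]
    enters twice and cancels. *)
Lemma Rinv_form b eps f (s : Z) z : (eps * eps = 1)%R -> (s = 1 \/ s = -1)%Z -> Tinv b f -> Winv eps f -> UHP z ->
  let w := 2 * IZR s * z + 1 in
  w <> 0 /\ UHP (z / w) /\ f (z / w) = ich b (- s) * (w * w) * f z.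
Proof.
  intros He Hs HT HW Hz w. pose proof (UHP_neq0 z Hz) as Hz0.
  set (y := - / (2 * z) + IZR (- s)).
  assert (Hy : UHP y) by (apply UHP_IZR, W_UHP, Hz). pose proof (UHP_neq0 y Hy) as Hy0.
  assert (H2 : RtoC 2 <> 0) by (apply RtoC_neq0; lra).
  assert (Ey : 2 * z * y = - w).
  { unfold y, w. rewrite opp_IZR, RtoC_opp. field. assumption. }
  assert (Hw : w <> 0).
  { intros Z. apply (Cmult_neq_0 (2 * z) y); [now apply Cmult_neq_0|assumption|]. rewrite Ey, Z. ring. }
  assert (Ez : z / w = - / (2 * y)).
  { replace w with (- (2 * z * y)) by (rewrite Ey; ring). field. split; assumption. }
  split; [assumption|]. rewrite Ez. split; [now apply W_UHP|].
  rewrite HW by assumption. unfold y at 3. rewrite (Tinv_Z b) by (try apply W_UHP; assumption). rewrite HW by assumption.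
  replace (w * w) with ((2 * z * y) * (2 * z * y)) by (rewrite Ey; ring).
  transitivity (RtoC eps * RtoC eps * (ich b (- s) * (2 * z * y * (2 * z * y)) * f z)); [ring|].
  rewrite <- RtoC_mult, He. ring.
Qed.

Lemma odd_mod4 d : Z.Odd d -> ((d * d) mod 4 = 1)%Z.
Proof. intros [k ->]. replace ((2 * k + 1) * (2 * k + 1))%Z with (1 + (k * k + k) * 4)%Z by ring. now rewrite Z.mod_add by lia. Qed.

(** Euclidean algorithm on the bottom row [(2 c, d)]. As [d] is odd, the two entries differ in
    absolute value; adding [s * (2 c)] to [d], or [2 s d] to [2 c], with a suitable sign [s] reduces
    the larger one. The first is a translation, the second the map of [Rinv_form], and [c = 0]
    leaves a translation. *)
Lemma Gamma0_form b eps f : (eps * eps = 1)%R -> Tinv b f -> Winv eps f ->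
  forall m, in_Gamma0_2 m -> forall z, UHP z ->
  f (mact m z) = ich b (md m * (mb m - mc m / 2)) * (aut m z * aut m z) * f z.
Proof.
  intros He HT HW.
  assert (Main : forall k a b' c d, (Z.abs (2 * c) + Z.abs d < Z.of_nat k)%Z -> (a * d - b' * (2 * c) = 1)%Z ->
    forall z, UHP z -> f (mact (Mat a b' (2 * c) d) z) =
       ich b (d * (b' - c)) * (aut (Mat a b' (2 * c) d) z * aut (Mat a b' (2 * c) d) z) * f z).
  { induction k as [|k IH]; intros a b' c d Hk Hdet z Hz; [lia|].
    assert (Hodd : Z.Odd d).
    { destruct (Z.Even_or_Odd d) as [[e ->]|]; [|assumption]. exfalso.
      assert (2 * (a * e - b' * c) = 1)%Z by (rewrite <- Hdet; ring). lia. }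
    assert (Hao : Z.Odd a).
    { destruct (Z.Even_or_Odd a) as [[e ->]|]; [|assumption]. exfalso.
      assert (2 * (e * d - b' * c) = 1)%Z by (rewrite <- Hdet; ring). lia. }
    assert (Hd0 : d <> 0%Z) by (destruct Hodd; lia).
    pose proof (aut_neq0 (Mat a b' (2 * c) d) z ltac:(unfold mdet; cbn [ma mb mc md]; rewrite Hdet; discriminate) Hz) as Ha0.
    destruct (Z.eq_dec c 0) as [->|Hc].
    - assert (Had : (a = d /\ d * d = 1)%Z).
      { replace (b' * (2 * 0))%Z with 0%Z in Hdet by ring. assert (d = 1 \/ d = -1)%Z as [-> | ->]; [|lia|lia].
        apply Z.mul_eq_1 with a. lia. }
      destruct Had as [-> Hdd].
      replace (mact (Mat d b' (2 * 0) d) z) with (z + IZR (d * b')).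
      + rewrite (Tinv_Z b) by assumption. rewrite Z.sub_0_r.
        replace (aut (Mat d b' (2 * 0) d) z) with (RtoC (IZR d)) by (unfold aut; cbn [ma mb mc md]; rewrite Z.mul_0_r; ring).
        rewrite <- RtoC_mult, <- mult_IZR, Hdd. ring.
      + unfold mact; cbn [ma mb mc md]. assert (RtoC (IZR d) <> 0) by (apply RtoC_neq0, not_0_IZR; assumption).
        assert (E : RtoC (IZR d) * IZR d = 1) by (rewrite <- RtoC_mult, <- mult_IZR, Hdd; reflexivity).
        rewrite Z.mul_0_r, mult_IZR, RtoC_mult. transitivity ((IZR d * z + IZR b') / IZR d); [|f_equal; ring].
        apply (Cmult_reg_l (IZR d)); [assumption|].
        transitivity (IZR d * z + (RtoC (IZR d) * IZR d) * IZR b'); [ring|]. rewrite E. field. assumption.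
    - destruct (Z_lt_le_dec (Z.abs d) (Z.abs (2 * c))) as [Hlt|Hge].
      + assert (exists s, (s = 1 \/ s = -1)%Z /\ (Z.abs (2 * (c + s * d)) < Z.abs (2 * c))%Z) as (s & Hs & Hd).
        { destruct (Z_lt_le_dec 0 (c * d)); [exists (-1)%Z|exists 1%Z]; split; try lia; nia. }
        assert (Hs' : (- s = 1 \/ - s = -1)%Z) by lia.
        destruct (Rinv_form b eps f (- s) z He Hs' HT HW Hz) as (Hw0 & HU & Hf).
        set (w := 2 * IZR (- s) * z + 1) in *. set (y := z / w) in *.
        specialize (IH (a + 2 * s * b')%Z b' (c + s * d)%Z d ltac:(lia) ltac:(nia) y HU).
        rewrite Hf, Z.opp_involutive in IH.
        assert (Eaut : aut (Mat (a + 2 * s * b') b' (2 * (c + s * d)) d) y * w = aut (Mat a b' (2 * c) d) z).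
        { unfold aut, y; cbn [ma mb mc md]. transitivity (IZR (2 * (c + s * d)) * z + IZR d * w); [field; assumption|].
          unfold w. rewrite !mult_IZR, plus_IZR, mult_IZR, opp_IZR, RtoC_opp, !RtoC_mult, RtoC_plus, RtoC_mult. ring. }
        assert (Emact : mact (Mat (a + 2 * s * b') b' (2 * (c + s * d)) d) y = mact (Mat a b' (2 * c) d) z).
        { unfold mact. fold (aut (Mat (a + 2 * s * b') b' (2 * (c + s * d)) d) y) (aut (Mat a b' (2 * c) d) z).
          rewrite <- Eaut. rewrite <- Eaut in Ha0.
          assert (aut (Mat (a + 2 * s * b') b' (2 * (c + s * d)) d) y <> 0) by (intros Z; apply Ha0; rewrite Z; ring).
          unfold y at 1; cbn [ma mb mc md]. apply (Cmult_reg_l (aut (Mat (a + 2 * s * b') b' (2 * (c + s * d)) d) y * w)); [assumption|].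
          transitivity (IZR (a + 2 * s * b') * z + IZR b' * w); [field; split; assumption|].
          transitivity (IZR a * z + IZR b'); [|field; split; assumption].
          unfold w. rewrite plus_IZR, !mult_IZR, opp_IZR, RtoC_opp, !RtoC_plus, !RtoC_mult. ring. }
        rewrite Emact in IH. rewrite IH, <- Eaut.
        (* The exponents differ by [s * (1 - d^2)], which [4] divides because [d] is odd. *)
        assert (Eich : ich b (d * (b' - (c + s * d))) * ich b s = ich b (d * (b' - c))).
        { rewrite <- ich_add. apply ich_mod.
          replace (d * (b' - (c + s * d)) + s)%Z with (d * (b' - c) + s * (1 - d * d))%Z by ring.
          destruct Hodd as [e ->]. replace (s * (1 - (2 * e + 1) * (2 * e + 1)))%Z with ((- s * (e * e + e)) * 4)%Z by ring.
          now rewrite Z.mod_add by lia. }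
        rewrite <- Eich. ring.
      + assert (exists s, (s = 1 \/ s = -1)%Z /\ (Z.abs (d + s * (2 * c)) < Z.abs d)%Z) as (s & Hs & Hd).
        { assert (Z.abs d <> Z.abs (2 * c))%Z by (destruct Hodd; lia).
          destruct (Z_lt_le_dec 0 (c * d)); [exists (-1)%Z|exists 1%Z]; split; try lia; nia. }
        set (y := z + IZR (- s)). assert (HU : UHP y) by now apply UHP_IZR.
        specialize (IH a (b' + s * a)%Z c (d + s * (2 * c))%Z ltac:(lia) ltac:(nia) y HU).
        assert (Hf : f y = ich b (- s) * f z) by (now apply Tinv_Z).
        assert (Eaut : aut (Mat a (b' + s * a) (2 * c) (d + s * (2 * c))) y = aut (Mat a b' (2 * c) d) z).
        { unfold aut, y; cbn [ma mb mc md]. rewrite plus_IZR, !mult_IZR, opp_IZR, RtoC_opp, !RtoC_plus, !RtoC_mult. ring. }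
        assert (Emact : mact (Mat a (b' + s * a) (2 * c) (d + s * (2 * c))) y = mact (Mat a b' (2 * c) d) z).
        { unfold mact. fold (aut (Mat a (b' + s * a) (2 * c) (d + s * (2 * c))) y) (aut (Mat a b' (2 * c) d) z).
          rewrite Eaut. f_equal. unfold y; cbn [ma mb mc md]. rewrite plus_IZR, !mult_IZR, opp_IZR, RtoC_opp, !RtoC_plus, !RtoC_mult. ring. }
        rewrite Emact, Eaut, Hf in IH. rewrite IH.
        (* Modulo [4], and after using the determinant, the exponents differ by [2 c * (a - s c)];
           since [a] is odd, one of [c] and [a - s c] is even. *)
        assert (Eich : ich b ((d + s * (2 * c)) * (b' + s * a - c)) * ich b (- s) = ich b (d * (b' - c))).
        { rewrite <- ich_add. apply ich_mod.
          assert (E : ((d + s * (2 * c)) * (b' + s * a - c) + - s = d * (b' - c) + s * (a * d - b' * (2 * c) - 1) + 4 * s * (b' * c) + 2 * c * (s * s * a - s * c))%Z) by ring.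
          rewrite E, Hdet. replace (s * s)%Z with 1%Z by (destruct Hs; subst; reflexivity).
          assert (Ev : Z.Even (c * (1 * a - s * c))).
          { destruct (Z.Even_or_Odd c) as [[e He']|[e He']].
            - exists (e * (1 * a - s * c))%Z. rewrite He' at 1. ring.
            - destruct Hao as [a0 Ha']. destruct Hs as [-> | ->].
              + exists (c * (a0 - e))%Z. rewrite Ha'. rewrite He' at 2. ring.
              + exists (c * (a0 + e + 1))%Z. rewrite Ha'. rewrite He' at 2. ring. }
          destruct Ev as [t Ht].
          replace (d * (b' - c) + s * (1 - 1) + 4 * s * (b' * c) + 2 * c * (1 * a - s * c))%Z with
            (d * (b' - c) + (s * (b' * c) + t) * 4)%Z by (rewrite <- (Z.mul_assoc 2), Ht; ring).
          now rewrite Z.mod_add by lia. }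
        rewrite <- Eich. ring. }
  intros [a b' c d] [Hdet [c' Hc]] z Hz. unfold mdet in Hdet. cbn [ma mb mc md] in Hdet, Hc. subst c.
  rewrite (Main (S (Z.to_nat (Z.abs (2 * c') + Z.abs d))) a b' c' d); try assumption.
  - cbn [ma mb mc md]. rewrite (Z.mul_comm 2 c'), Z.div_mul by lia. reflexivity.
  - lia.
Qed.

Lemma GammaStar_form b eps f : (eps * eps = 1)%R -> Tinv b f -> Winv eps f ->
  forall m, in_GammaStar2 m -> forall z, UHP z -> slash 2 m f z = chi b eps m * f z.
Proof.
  intros He HT HW m Hm z Hz. rewrite chiE. destruct Hm as [Hm|(Hdet & [a' Ha] & [c' Hc] & [d' Hd])].
  - destruct (Hm) as [Hdet _]. rewrite slash2E by lia. rewrite Hdet, Z.eqb_refl.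
    rewrite (Gamma0_form b eps f He HT HW m Hm z Hz).
    pose proof (aut_neq0 m z ltac:(lia) Hz). field. assumption.
  - rewrite slash2E by lia. rewrite Hdet. change (2 =? 1)%Z with false. cbv iota.
    destruct m as [A B C' D]. cbn [ma mb mc md] in Ha, Hc, Hd. subst A C' D. unfold mdet in Hdet. cbn [ma mb mc md] in Hdet.
    pose proof (aut_neq0 (Mat (2 * a') B (2 * c') (2 * d')) z ltac:(unfold mdet; cbn [ma mb mc md]; rewrite Hdet; discriminate) Hz) as Ha0.
    pose proof (UHP_neq0 z Hz) as Hz0.
    (* This matrix times [W2] is the given one, so [Gamma0_form] is applied at the image of [z]
       under [W2]. *)
    assert (HG : in_Gamma0_2 (Mat (- B) a' (- (2 * d')) c')).
    { split; [|exists (- d')%Z; cbn [mc]; ring]. unfold mdet; cbn [ma mb mc md].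
      apply Z.mul_reg_l with 2%Z; [lia|]. transitivity (2 * a' * (2 * d') - B * (2 * c'))%Z; [ring|exact Hdet]. }
    pose proof (Gamma0_form b eps f He HT HW _ HG (- / (2 * z)) (W_UHP z Hz)) as G.
    assert (Eaut : aut (Mat (- B) a' (- (2 * d')) c') (- / (2 * z)) = aut (Mat (2 * a') B (2 * c') (2 * d')) z / (2 * z)).
    { unfold aut; cbn [ma mb mc md]. rewrite opp_IZR, !mult_IZR, RtoC_opp, !RtoC_mult. field. assumption. }
    assert (Emact : mact (Mat (- B) a' (- (2 * d')) c') (- / (2 * z)) = mact (Mat (2 * a') B (2 * c') (2 * d')) z).
    { unfold mact. fold (aut (Mat (- B) a' (- (2 * d')) c') (- / (2 * z))) (aut (Mat (2 * a') B (2 * c') (2 * d')) z).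
      rewrite Eaut. cbn [ma mb mc md]. rewrite opp_IZR, !mult_IZR, RtoC_opp, !RtoC_mult. field. repeat split; try assumption. }
    rewrite Emact, Eaut, HW in G by assumption. rewrite G. cbn [ma mb mc md].
    replace (- (2 * d') / 2)%Z with (- d')%Z.
    2:{ replace (- (2 * d'))%Z with (- d' * 2)%Z by ring. now rewrite Z.div_mul by lia. }
    rewrite (Z.mul_comm 2 c'), (Z.mul_comm 2 a'), (Z.mul_comm 2 d'), !Z.div_mul by lia.
    rewrite (Z.mul_comm 2 c'), (Z.mul_comm 2 a'), (Z.mul_comm 2 d') in Ha0.
    replace (a' - - d')%Z with (a' + d')%Z by ring.
    field. split; assumption.
Qed.

(** * Fourier series and eta quotients *)

(** A real leading exponent kept apart from a power series in [q]. The coefficient at [0] may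
    vanish; lemmas that need it state its value separately. *)
Definition qser (rho : R) (f : C -> C) (c : nat -> C) : Prop :=
  rad1 c /\ forall z, UHP z -> f z = qpow rho z * ev c (qpow 1 z).

Lemma qser_rho rho rho' f c : rho = rho' -> qser rho f c -> qser rho' f c.
Proof. now intros <-. Qed.

Lemma qser_ext rho f g c : (forall z, UHP z -> f z = g z) -> qser rho f c -> qser rho g c.
Proof. intros E [H1 H2]. split; [assumption|]. intros z Hz. rewrite <- E by assumption. auto. Qed.

Lemma rad1_plus a b : rad1 a -> rad1 b -> rad1 (fun n => a n + b n).
Proof.
  intros Ha Hb. apply rad1_cabs. intros r Hr.
  assert (Cmod r < 1)%R by (rewrite Cmod_R, Rabs_pos_eq; lra).
  apply cabs_ext with (fun n => a n * r ^ n + b n * r ^ n); [intros; ring|].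
  apply cabs_plus; now apply cabs_rad1.
Qed.

Lemma rad1_scal s a : rad1 a -> rad1 (fun n => s * a n).
Proof.
  intros Ha. apply rad1_cabs. intros r Hr.
  assert (Cmod r < 1)%R by (rewrite Cmod_R, Rabs_pos_eq; lra).
  apply cabs_ext with (fun n => s * (a n * r ^ n)); [intros; ring|]. apply cabs_scal. now apply cabs_rad1.
Qed.

Lemma ev_plus a b x : rad1 a -> rad1 b -> (Cmod x < 1)%R -> ev (fun n => a n + b n) x = ev a x + ev b x.
Proof.
  intros Ha Hb Hx. unfold ev. rewrite <- Cser_plus by now apply cabs_rad1. apply Cser_ext. intros; ring.
Qed.

Lemma ev_scal s a x : rad1 a -> (Cmod x < 1)%R -> ev (fun n => s * a n) x = s * ev a x.
Proof.
  intros Ha Hx. unfold ev. rewrite <- Cser_scal by now apply cabs_rad1. apply Cser_ext. intros; ring.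
Qed.

Lemma qser_plus rho f g a b : qser rho f a -> qser rho g b -> qser rho (fun z => f z + g z) (fun n => a n + b n).
Proof.
  intros [H1 H2] [H3 H4]. split; [now apply rad1_plus|]. intros z Hz.
  rewrite H2, H4, ev_plus by (try apply Cmod_q_lt1; assumption). ring.
Qed.

Lemma qser_scal rho s f a : qser rho f a -> qser rho (fun z => s * f z) (fun n => s * a n).
Proof.
  intros [H1 H2]. split; [now apply rad1_scal|]. intros z Hz.
  rewrite H2, ev_scal by (try apply Cmod_q_lt1; assumption). ring.
Qed.

Lemma qser_mult rho sg f g a b : qser rho f a -> qser sg g b -> qser (rho + sg) (fun z => f z * g z) (conv a b).
Proof.
  intros [H1 H2] [H3 H4]. split; [now apply rad1_conv|]. intros z Hz.
  rewrite H2, H4, ev_conv, qpow_plus by (try apply Cmod_q_lt1; assumption). ring.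
Qed.

Lemma qser_pow rho f a n : qser rho f a -> qser (rho * INR n) (fun z => f z ^ n) (cpow a n).
Proof.
  intros [H1 H2]. split; [now apply rad1_cpow|]. intros z Hz.
  rewrite H2, ev_cpow, qpow_INR, Cpow_mult_l by (try apply Cmod_q_lt1; assumption). reflexivity.
Qed.

Lemma spread_pow k a x n : spread (S k) a n * x ^ n = spread (S k) (fun j => a j * (x ^ S k) ^ j) n.
Proof.
  unfold spread. destruct (n mod S k =? 0)%nat eqn:E; [|ring].
  apply Nat.eqb_eq in E. rewrite <- Cpow_mult_r. pose proof (Nat.div_mod_eq n (S k)) as Q.
  rewrite E, Nat.add_0_r in Q. now rewrite <- Q.
Qed.

Lemma qser_dbl rho f a : qser rho f a -> qser (2 * rho) (fun z => f (2 * z)) (spread 2 a).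
Proof.
  intros [H1 H2].
  assert (HC : forall x, (Cmod x < 1)%R -> cabs (fun j => a j * (x ^ 2) ^ j))
    by (intros x Hx; apply cabs_rad1; [assumption|now apply Cmod_pow_lt1]).
  split.
  - apply rad1_cabs. intros r Hr. eapply cabs_ext; [intros n; symmetry; apply spread_pow|].
    apply cabs_spread; [lia|]. apply HC. rewrite Cmod_R, Rabs_pos_eq; lra.
  - intros z Hz. rewrite H2 by (apply UHP_scal; [lra|assumption]). rewrite !qpow_zscal.
    replace (rho * 2)%R with (2 * rho)%R by ring. f_equal. unfold ev.
    rewrite (Cser_ext (fun n => spread 2 a n * _) _ (fun n => spread_pow 1 a (qpow 1 z) n)).
    rewrite Cser_spread by (try lia; apply HC, Cmod_q_lt1, Hz). apply Cser_ext. intros n.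
    replace (1 * 2)%R with (1 * INR 2)%R by (simpl; ring). rewrite qpow_INR. reflexivity.
Qed.

Definition shift (k : nat) (a : nat -> C) (n : nat) : C := if (n <? k)%nat then 0 else a (n - k)%nat.

Lemma shift_lt k a n : (n < k)%nat -> shift k a n = 0.
Proof. intros H. unfold shift. now rewrite (proj2 (Nat.ltb_lt _ _)) by lia. Qed.

Lemma shift_add k a n : shift k a (k + n) = a n.
Proof. unfold shift. rewrite (proj2 (Nat.ltb_ge _ _)) by lia. f_equal. lia. Qed.

Lemma qser_shift rho f a k : qser (rho + INR k) f a -> qser rho f (shift k a).
Proof.
  intros [H1 H2].
  assert (HC : forall x, (Cmod x < 1)%R -> cabs (fun n => shift k a n * x ^ n)).
  { intros x Hx. apply (cabs_shift _ k). apply cabs_ext with (fun n => x ^ k * (a n * x ^ n)).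
    - intros n. rewrite shift_add, Cpow_add_r. ring.
    - apply cabs_scal. now apply cabs_rad1. }
  split.
  - apply rad1_cabs. intros r Hr. apply HC. rewrite Cmod_R, Rabs_pos_eq; lra.
  - intros z Hz. pose proof (Cmod_q_lt1 z Hz) as Hq. rewrite H2, qpow_plus, qpow_nat by assumption.
    rewrite <- Cmult_assoc. f_equal. unfold ev. rewrite (Cser_split (fun n => shift k a n * qpow 1 z ^ n) k) by now apply HC.
    rewrite (csum_ext _ (fun _ => 0)) by (intros n Hn; rewrite shift_lt by assumption; ring).
    rewrite csum_const, Cmult_0_r, Cplus_0_l, <- Cser_scal by now apply cabs_rad1.
    apply Cser_ext. intros n. rewrite shift_add, Cpow_add_r. ring.
Qed.

Lemma qder_qser rho f c z : qser rho f c -> UHP z -> exists l, qder f z l.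
Proof.
  intros [H1 H2] Hz. eexists. eapply (qder_ext_loc (fun z => qpow rho z * ev c (qpow 1 z))).
  - exact (Rdiv_lt_0_compat _ 2 Hz ltac:(lra)).
  - intros h Hh. symmetry. apply H2, UHP_open; [assumption|unfold UHP in Hz; lra].
  - apply qder_mult; [apply qder_qpow|]. now apply qder_ps.
Qed.

(** An arbitrary exponent [s] yields [eta^2] and its inverse alike ([s = -2] and [s = 2]), without
    inverting a power series. *)
Lemma qser_etasq (s : C) : exists c : nat -> C, c O = 1 /\ rad1 c /\
  forall z, UHP z -> cexp (s * Lam z) = ev c (qpow 1 z).
Proof.
  assert (R : rad1 (fun n => s * Lco n)) by apply rad1_scal, rad1_Lco.
  exists (expco (fun n => s * Lco n)). split; [apply expco_0; rewrite Lco_0; ring|].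
  split; [now apply rad1_expco|]. intros z Hz.
  rewrite (proj2 (exp_ps _ _ R (Cmod_q_lt1 z Hz))), ev_scal by (try apply rad1_Lco; now apply Cmod_q_lt1).
  reflexivity.
Qed.

Lemma qser_u : exists c : nat -> C, c O = 1 /\ qser (/ 12) etasq c.
Proof.
  destruct (qser_etasq (-(2))) as (c & H0 & H1 & H2). exists c. split; [assumption|]. split; [assumption|].
  intros z Hz. rewrite <- H2, qpowE, <- cexp_plus by assumption. unfold etasq, ell. f_equal.
  replace (2 * PI * / 12)%R with (PI / 6)%R by field. ring.
Qed.

Lemma qser_ui : exists c : nat -> C, c O = 1 /\ qser (- / 12) (fun z => / etasq z) c.
Proof.
  destruct (qser_etasq 2) as (c & H0 & H1 & H2). exists c. split; [assumption|]. split; [assumption|].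
  intros z Hz. rewrite <- H2, qpowE, <- cexp_plus by assumption. unfold etasq. rewrite <- cexp_opp. unfold ell. f_equal.
  replace (2 * PI * - / 12)%R with (- (PI / 6))%R by field. rewrite RtoC_opp. ring.
Qed.

(** * Eta quotients under the Fricke involution *)

Definition v2 (z : C) : C := etasq (2 * z).

Lemma etasq_neq0 z : etasq z <> 0.
Proof. apply cexp_neq0. Qed.

Lemma v2_neq0 z : v2 z <> 0.
Proof. apply cexp_neq0. Qed.

(** [W2] sends [z] to the inversion of [2 z], and [2 z] to the inversion of [z]; hence it exchanges
    [u] and [v] up to the factors of [etasq_S]. *)
Lemma u_W z : UHP z -> etasq (- / (2 * z)) = - i * (2 * z) * v2 z.
Proof. intros Hz. unfold v2. apply etasq_S. apply UHP_scal; [lra|assumption]. Qed.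

Lemma v2_W z : UHP z -> v2 (- / (2 * z)) = - i * z * etasq z.
Proof.
  intros Hz. pose proof (UHP_neq0 z Hz). unfold v2. rewrite <- etasq_S by assumption. f_equal. field. assumption.
Qed.

Lemma h2E z : UHP z -> h2 z = etasq z * v2 z.
Proof.
  intros Hz. assert (E : forall w, UHP w -> eta w ^ 2 = etasq w).
  { intros w Hw. unfold eta. rewrite eta_prodE, qpowE, <- cexp_plus by assumption. simpl. rewrite Cmult_1_r, <- cexp_plus.
    unfold etasq, ell. f_equal. replace (2 * PI * (1 / 24))%R with (PI / 12)%R by field.
    replace (PI / 6)%R with (PI / 12 + PI / 12)%R by field. rewrite RtoC_plus. ring. }
  unfold h2, v2. rewrite !E; [reflexivity|apply UHP_scal; [lra|assumption]|assumption].
Qed.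

(* [quo m n] is the eta quotient [eta(z)^(2m) / eta(2z)^(2n)] and [quo' m n] is [eta(2z)^(2m) / eta(z)^(2n)]. *)
Definition quo (m n : nat) (z : C) : C := etasq z ^ m * (/ v2 z) ^ n.
Definition quo' (m n : nat) (z : C) : C := v2 z ^ m * (/ etasq z) ^ n.

Lemma qser_quo m n : exists c : nat -> C, c O = 1 /\ qser ((INR m - 2 * INR n) / 12) (quo m n) c.
Proof.
  destruct qser_u as (cu & U0 & U). destruct qser_ui as (ci & I0 & I).
  pose proof (qser_mult _ _ _ _ _ _ (qser_pow _ _ _ m U) (qser_pow _ _ _ n (qser_dbl _ _ _ I))) as H.
  eexists. split; [|eapply qser_rho; [|exact H]].
  - rewrite conv_0, !cpow_0. unfold spread. simpl Nat.modulo. simpl Nat.eqb. cbv iota. simpl Nat.div.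
    rewrite U0, I0, !Cpow_1_l. ring.
  - field.
Qed.

Lemma qser_quo' m n : exists c : nat -> C, c O = 1 /\ qser ((2 * INR m - INR n) / 12) (quo' m n) c.
Proof.
  destruct qser_u as (cu & U0 & U). destruct qser_ui as (ci & I0 & I).
  pose proof (qser_mult _ _ _ _ _ _ (qser_pow _ _ _ m (qser_dbl _ _ _ U)) (qser_pow _ _ _ n I)) as H.
  eexists. split; [|eapply qser_rho; [|exact H]].
  - rewrite conv_0, !cpow_0. unfold spread. simpl Nat.modulo. simpl Nat.eqb. cbv iota. simpl Nat.div.
    rewrite U0, I0, !Cpow_1_l. ring.
  - field.
Qed.

Lemma i_neq0 : i <> 0.
Proof. intros Z. apply (f_equal Cmod) in Z. rewrite Cmod_Ci, Cmod_0 in Z. lra. Qed.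

Lemma mi_neq0 : - i <> 0.
Proof. intros Z. apply i_neq0. replace i with (- - i) by ring. rewrite Z. ring. Qed.

Lemma Cpow_quot (A B u v : C) m n : B <> 0 -> v <> 0 ->
  (A * u) ^ m * (/ (B * v)) ^ n = A ^ m * / B ^ n * (u ^ m * (/ v) ^ n).
Proof.
  intros HB Hv. rewrite (Cpow_mult_l A u), !Cpow_inv, (Cpow_mult_l B v) by (try apply Cmult_neq_0; assumption).
  pose proof (Cpow_nz B n HB). pose proof (Cpow_nz v n Hv). field. split; assumption.
Qed.

Lemma quo_W m n z : UHP z ->
  quo m n (- / (2 * z)) = (- i * (2 * z)) ^ m * / (- i * z) ^ n * quo' m n z.
Proof.
  intros Hz. unfold quo, quo'. rewrite u_W, v2_W by assumption. apply Cpow_quot.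
  - apply Cmult_neq_0; [apply mi_neq0|now apply UHP_neq0].
  - apply etasq_neq0.
Qed.

Lemma quo'_W m n z : UHP z ->
  quo' m n (- / (2 * z)) = (- i * z) ^ m * / (- i * (2 * z)) ^ n * quo m n z.
Proof.
  intros Hz. unfold quo, quo'. rewrite u_W, v2_W by assumption. apply Cpow_quot.
  - apply Cmult_neq_0; [apply mi_neq0|]. apply Cmult_neq_0; [apply RtoC_neq0; lra|now apply UHP_neq0].
  - apply v2_neq0.
Qed.

Lemma qser_h2 : exists c : nat -> C, c O = 1 /\ qser (1 / 4) h2 c.
Proof.
  destruct qser_u as (cu & U0 & U).
  pose proof (qser_mult _ _ _ _ _ _ U (qser_dbl _ _ _ U)) as H.
  eexists. split; [|eapply qser_rho; [|eapply qser_ext; [|exact H]]].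
  - rewrite conv_0. unfold spread. simpl Nat.modulo. simpl Nat.eqb. cbv iota. simpl Nat.div. rewrite U0. ring.
  - field.
  - intros z Hz. cbv beta. rewrite h2E by assumption. reflexivity.
Qed.

Lemma h2_W : Winv (-1) h2.
Proof.
  intros z Hz. rewrite !h2E by (try apply W_UHP; assumption). rewrite u_W, v2_W by assumption.
  rewrite RtoC_m1. transitivity ((i * i) * (2 * z * z) * (etasq z * v2 z)); [ring|]. rewrite ii. ring.
Qed.

(** [W2] takes [quo 7 5] to [- 128 z^2 * quo' 7 5], and [quo' 7 5] to [- z^2 / 32 * quo 7 5]. The
    factor [64 * s] makes the combination an eigenvector, with sign [- s]; the second quotient
    starts at [q^(3/4)] and leaves the principal part alone. *)
Definition base1 (s : R) (z : C) : C := quo 7 5 z + RtoC (64 * s) * quo' 7 5 z.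

Lemma qser_base1 s : exists c : nat -> C, c O = 1 /\ qser (- (1 / 4)) (base1 s) c.
Proof.
  destruct (qser_quo 7 5) as (c & C0 & H). destruct (qser_quo' 7 5) as (c' & C0' & H').
  eexists. split; [|apply qser_plus; [eapply qser_rho; [|exact H]|apply qser_scal, (qser_shift _ _ c' 1); eapply qser_rho; [|exact H']]].
  - cbv beta. rewrite C0, shift_lt by lia. ring.
  - simpl. field.
  - simpl. field.
Qed.

Lemma base1_W s : (s * s = 1)%R -> Winv (- s) (base1 s).
Proof.
  intros Hs z Hz. pose proof (UHP_neq0 z Hz) as Hz0. pose proof i_neq0 as Hi. unfold base1. rewrite quo_W, quo'_W by assumption.
  assert (E1 : (- i * (2 * z)) ^ 7 * / (- i * z) ^ 5 = (i * i) * (128 * z * z)).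
  { field. split; assumption. }
  assert (E2' : (- i * z) ^ 7 * / (- i * (2 * z)) ^ 5 = (i * i) * (z * z * / 32)).
  { field. split; assumption. }
  rewrite E1, E2', ii, RtoC_opp, !RtoC_mult.
  transitivity (- (z * z) * (2 * RtoC s * quo 7 5 z + RtoC (s * s) * 128 * quo' 7 5 z)); [rewrite Hs; field|].
  rewrite RtoC_mult. ring.
Qed.

(** [W2] replaces [t] by [4096 / t], where [4096 = 2^12] is the ratio of the twelfth powers of the
    factors in [u_W] and [v2_W]. So [Jf] is even and [Kf] is odd, and [Kf] reverses the sign of the
    form it multiplies. *)
Definition Jf (z : C) : C := quo 12 12 z + 4096 * quo' 12 12 z.
Definition Kf (z : C) : C := quo 12 12 z + -(4096) * quo' 12 12 z.

Lemma qser_JK (s : C) : exists c : nat -> C, c O = 1 /\ qser (- (1)) (fun z => quo 12 12 z + s * quo' 12 12 z) c.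
Proof.
  destruct (qser_quo 12 12) as (c & C0 & H). destruct (qser_quo' 12 12) as (c' & C0' & H').
  eexists. split; [|apply qser_plus; [eapply qser_rho; [|exact H]|apply qser_scal, (qser_shift _ _ c' 2); eapply qser_rho; [|exact H']]].
  - cbv beta. rewrite C0, shift_lt by lia. ring.
  - simpl. field.
  - simpl. field.
Qed.

Lemma quo12_W z : UHP z -> quo 12 12 (- / (2 * z)) = 4096 * quo' 12 12 z /\
  quo' 12 12 (- / (2 * z)) = / 4096 * quo 12 12 z.
Proof.
  intros Hz. pose proof (UHP_neq0 z Hz) as Hz0. pose proof i_neq0 as Hi. rewrite quo_W, quo'_W by assumption. split.
  - f_equal. field. split; assumption.
  - f_equal. field. split; assumption.
Qed.

Lemma Jf_W z : UHP z -> Jf (- / (2 * z)) = Jf z.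
Proof. intros Hz. unfold Jf. destruct (quo12_W z Hz) as [-> ->]. field. Qed.

Lemma Kf_W z : UHP z -> Kf (- / (2 * z)) = - Kf z.
Proof. intros Hz. unfold Kf. destruct (quo12_W z Hz) as [-> ->]. field. Qed.

Lemma qser_base3 : exists c : nat -> C, c O = 1 /\ qser (- (3 / 4)) (fun z => h2 z * Kf z) c.
Proof.
  destruct qser_h2 as (c & C0 & H). destruct (qser_JK (-(4096))) as (c' & C0' & H').
  eexists. split; [|eapply qser_rho; [|exact (qser_mult _ _ _ _ _ _ H H')]].
  - rewrite conv_0, C0, C0'. ring.
  - field.
Qed.

Lemma base3_W : Winv 1 (fun z => h2 z * Kf z).
Proof. intros z Hz. cbv beta. rewrite h2_W, Kf_W, RtoC_m1 by assumption. ring. Qed.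

Lemma Winv_lin eps f g (s : C) : Winv eps f -> Winv eps g -> Winv eps (fun z => f z + s * g z).
Proof. intros H1 H2 z Hz. cbv beta. rewrite H1, H2 by assumption. ring. Qed.

(* [Jf] is invariant with a simple pole, so multiplying by it raises the order of the pole by one; the unwanted
   coefficients are then removed with the forms of smaller pole order. *)
Lemma exists_normal rho0 eps f0 (c0 : nat -> C) : qser rho0 f0 c0 -> c0 O = 1 -> Winv eps f0 ->
  forall j, exists (f : C -> C) (c : nat -> C), qser (rho0 - INR j) f c /\ c O = 1 /\
    (forall k, (1 <= k <= j)%nat -> c k = 0) /\ Winv eps f.
Proof.
  intros H0 H00 HW0 j. induction j as [j IHj] using lt_wf_ind.
  destruct j as [|j].
  - exists f0, c0. repeat split; try assumption; try apply H0.
    + intros z Hz. simpl. rewrite Rminus_0_r. now apply H0.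
    + intros; lia.
  (* [k] counts the coefficients already cleared after the leading one. The next one is removed with
     the form of index [j - k]: its leading exponent is the one to be cleared, and it touches no
     earlier coefficient. *)
  - assert (Step : forall k, (k <= S j)%nat -> exists (f : C -> C) (c : nat -> C), qser (rho0 - INR (S j)) f c /\ c O = 1 /\
      (forall l, (1 <= l <= k)%nat -> c l = 0) /\ Winv eps f).
    { induction k as [|k IHk]; intros Hk.
      - destruct (IHj j ltac:(lia)) as (f & c & Hf & Hc & _ & HW).
        destruct (qser_JK 4096) as (c' & C0' & H').
        exists (fun z => f z * Jf z), (conv c c'). split; [|split; [|split]].
        + eapply qser_rho; [|exact (qser_mult _ _ _ _ _ _ Hf H')]. rewrite S_INR. ring.
        + rewrite conv_0, Hc, C0'. ring.
        + intros; lia.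
        + intros z Hz. cbv beta. rewrite HW, Jf_W by assumption. ring.
      - destruct (IHk ltac:(lia)) as (f & c & Hf & Hc & Hl & HW).
        destruct (IHj (j - k)%nat ltac:(lia)) as (g & e & Hg & He & Hel & HWg).
        exists (fun z => f z + - c (S k) * g z), (fun n => c n + - c (S k) * shift (S k) e n).
        split; [|split; [|split]].
        + apply qser_plus; [assumption|]. apply qser_scal, qser_shift. eapply qser_rho; [|exact Hg].
          rewrite minus_INR, !S_INR by lia. ring.
        + rewrite Hc, shift_lt by lia. ring.
        + intros l Hl'. destruct (Nat.eq_dec l (S k)) as [->|Hne].
          * replace (shift (S k) e (S k)) with (RtoC 1); [ring|]. rewrite <- He.
            rewrite <- (Nat.add_0_r (S k)) at 2. now rewrite shift_add.
          * rewrite Hl, shift_lt by lia. ring.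
        + now apply Winv_lin. }
    apply (Step (S j)). lia.
Qed.

Lemma qpow_quarter n : qpow (IZR n / 4) 1 = ipow n.
Proof.
  assert (H1 : qpow (1 / 4) 1 = i).
  { rewrite qpow_real, Rmult_1_r. unfold cexp, Cmult, RtoC, i; simpl.
    replace (2 * PI * (1 / 4) * 0 - 0 * 1)%R with 0%R by ring.
    replace (2 * PI * (1 / 4) * 1 + 0 * 0)%R with (PI / 2)%R by field.
    rewrite exp_0, cos_PI2, sin_PI2. f_equal; ring. }
  assert (H : forall k : nat, qpow (INR k / 4) 1 = ipow (Z.of_nat k)).
  { induction k as [|k IH]; [simpl; replace (0 / 4)%R with 0%R by field; apply qpow_0|].
    rewrite Nat2Z.inj_succ, <- Z.add_1_r, ipow_succ, <- IH, <- H1, <- qpow_plus. f_equal.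
    rewrite S_INR. field. }
  rewrite <- ipow_mod. pose proof (Z.mod_pos_bound n 4 ltac:(lia)).
  rewrite <- (Z2Nat.id (n mod 4)) by lia. rewrite <- H, INR_IZR_INZ, Z2Nat.id by lia.
  rewrite (Z.div_mod n 4) at 1 by lia. rewrite plus_IZR, mult_IZR.
  replace ((4 * IZR (n / 4) + IZR (n mod 4)) / 4)%R with (1 * IZR (n / 4) + IZR (n mod 4) / 4)%R by field.
  rewrite qpow_plus, (qpow_real (1 * IZR (n / 4))), Rmult_1_l, Rmult_1_r, cexp_2PIi_IZR. ring.
Qed.

Lemma qser_Tinv (b : bool) (n : Z) f c : (n mod 4 = if b then 1 else 3)%Z -> qser (IZR n / 4) f c -> Tinv b f.
Proof.
  intros Hn [_ H] z Hz. rewrite !H by (try apply UHP_shift; assumption).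
  rewrite (qpow_1_IZR z 1), qpow_zplus, qpow_quarter.
  assert (ipow n = ich b 1) as ->; [|ring].
  rewrite <- ipow_mod, Hn. destruct b; simpl; [reflexivity|].
  unfold ipow; simpl. unfold Cconj, Copp, Defs.Ci; simpl. f_equal; ring.
Qed.

(** * From series in q to the expansions in the definition of a form *)

Definition dense (N : nat) (f : C -> C) (c : nat -> C) : Prop :=
  forall z, UHP z -> csums (fun m => c m * qpow ((INR m - INR N) / 4) z) (f z).

Lemma qser_dense N f c : qser (- INR N / 4) f c -> dense N f (spread 4 c).
Proof.
  intros [H1 H2] z Hz.
  apply (clim_ext (csum (spread 4 (fun k => qpow (- INR N / 4) z * (c k * qpow 1 z ^ k))))).
  - intros M. apply csum_ext. intros m _. unfold spread. destruct (m mod 4 =? 0)%nat eqn:E; [|ring].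
    apply Nat.eqb_eq in E. pose proof (Nat.div_mod_eq m 4) as Q. rewrite E, Nat.add_0_r in Q.
    assert (INR m = 4 * INR (m / 4))%R as -> by (rewrite Q at 1; rewrite mult_INR; simpl; ring).
    replace ((4 * INR (m / 4) - INR N) / 4)%R with (- INR N / 4 + INR (m / 4))%R by field.
    rewrite qpow_plus, qpow_nat. ring.
  - apply csums_spread; [lia|]. rewrite H2 by assumption.
    eapply clim_ext; [intros M; symmetry; apply csum_scal|]. apply clim_scal, csums_Cser, cabs_rad1; [assumption|].
    now apply Cmod_q_lt1.
Qed.

(** [Gamma_0(2)] has two cusps and [W2] exchanges them. If the lower left entry is even, the matrix
    lies in the group and the expansion of [f] itself serves. Otherwise the value is that of [f] at
    [(z + k) / 2], with [k] chosen to make an entry even, and the denominator of the exponents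
    doubles from [4] to [8]. *)
Lemma mero_dense (b : bool) eps N f c : (eps * eps = 1)%R -> Tinv b f -> Winv eps f -> dense N f c -> mero_at_cusps 2 f.
Proof.
  intros He HT HW HD g Hg. destruct (Z.Even_or_Odd (mc g)) as [Hc|Hc].
  - exists 4%nat, N, (fun m => chi b eps g * c m). split; [lia|]. intros z Hz.
    rewrite (GammaStar_form b eps f He HT HW g (or_introl (conj Hg Hc)) z Hz).
    apply is_series_csums.
    apply (clim_ext (fun M => chi b eps g * csum (fun m => c m * qpow ((INR m - INR N) / 4) z) M)).
    + intros M. rewrite <- csum_scal. apply csum_ext. intros m _. replace (INR 4) with 4%R by (simpl; ring). ring.
    + apply clim_scal. now apply HD.
  - (* [2 g = G [[1,k],[0,2]]] with [G] in the nontrivial coset of [Gamma_0(2)] *)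
    destruct g as [p q r s]. cbn [mc] in Hc. unfold mdet in Hg. cbn [ma mb mc md] in Hg.
    pose (k := (s mod 2)%Z).
    assert (Hs : Z.Even (s - k * r)).
    { destruct Hc as [t ->]. unfold k. pose proof (Z.div_mod s 2 ltac:(lia)) as Q.
      exists (s / 2 - (s mod 2) * t)%Z. rewrite Q at 1. ring. }
    pose (G := Mat (2 * p) (q - k * p) (2 * r) (s - k * r)).
    assert (HdG : mdet G = 2%Z).
    { unfold G, mdet; cbn [ma mb mc md]. transitivity (2 * (p * s - q * r))%Z; [ring|]. rewrite Hg. reflexivity. }
    assert (HG : in_GammaStar2 G).
    { right. split; [exact HdG|]. unfold G; cbn [ma mb mc md]. split; [now exists p|]. split; [now exists r|exact Hs]. }
    exists 8%nat, N, (fun m => chi b eps G * / 2 * c m * qpow ((INR m - INR N) / 8) (IZR k)). split; [lia|]. intros z Hz.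
    set (w := RtoC (/ 2) * (z + IZR k)).
    assert (Hw : UHP w) by (apply UHP_scal; [lra|now apply UHP_IZR]).
    assert (H2 : RtoC 2 <> 0) by (apply RtoC_neq0; lra).
    assert (Ew : 2 * w = z + IZR k) by (unfold w; rewrite RtoC_inv by lra; field).
    pose proof (GammaStar_form b eps f He HT HW G HG w Hw) as S.
    rewrite slash2E, HdG in S by lia.
    assert (Eaut : aut G w = aut (Mat p q r s) z).
    { unfold aut, G; cbn [mc md]. rewrite mult_IZR, minus_IZR, mult_IZR, RtoC_minus, !RtoC_mult.
      transitivity (IZR r * (2 * w) + (IZR s - IZR k * IZR r)); [ring|]. rewrite Ew. ring. }
    assert (Emact : mact G w = mact (Mat p q r s) z).
    { unfold mact. fold (aut G w) (aut (Mat p q r s) z). rewrite Eaut. f_equal.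
      unfold G; cbn [ma mb]. rewrite mult_IZR, minus_IZR, mult_IZR, RtoC_minus, !RtoC_mult.
      transitivity (IZR p * (2 * w) + (IZR q - IZR k * IZR p)); [ring|]. rewrite Ew. ring. }
    rewrite Eaut, Emact in S.
    rewrite slash2E by (unfold mdet; cbn [ma mb mc md]; lia).
    unfold mdet at 1; cbn [ma mb mc md]. rewrite Hg.
    replace (1 * / (aut (Mat p q r s) z * aut (Mat p q r s) z) * f (mact (Mat p q r s) z)) with
      (/ 2 * (2 * / (aut (Mat p q r s) z * aut (Mat p q r s) z) * f (mact (Mat p q r s) z))).
    2:{ set (A := / (aut (Mat p q r s) z * aut (Mat p q r s) z)). field. }
    rewrite S. apply is_series_csums.
    apply (clim_ext (fun M => chi b eps G * / 2 * csum (fun m => c m * qpow ((INR m - INR N) / 4) w) M)).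
    + intros M. rewrite <- csum_scal. apply csum_ext. intros m _. unfold w.
      rewrite qpow_zscal, qpow_zplus.
      replace (INR 8) with 8%R by (simpl; ring).
      replace ((INR m - INR N) / 4 * / 2)%R with ((INR m - INR N) / 8)%R by field. ring.
    + replace (/ 2 * (chi b eps G * f w)) with (chi b eps G * / 2 * f w) by ring. apply clim_scal. now apply HD.
Qed.

Lemma is_form_of (b : bool) eps (d r L : Z) f (c : nat -> C) : (eps * eps = 1)%R -> (0 < d)%Z -> (1 <= L)%Z -> (r = if b then 1 else 3)%Z ->
  (- d mod 4 = r)%Z -> qser (- IZR d / 4) f c -> c O = 1 ->
  (forall k : nat, (1 <= k)%nat -> (4 * Z.of_nat k - d < L)%Z -> c k = 0) -> Winv eps f ->
  is_form d r L (chi b eps) f (fun n => c (Z.to_nat ((n + d) / 4))).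
Proof.
  intros He Hd HL Hr Hdr Hq H0 Hk HW.
  assert (HT : Tinv b f).
  { apply (qser_Tinv b (- d) f c); [now rewrite Hdr|]. now rewrite opp_IZR. }
  assert (HN : IZR d = INR (Z.to_nat d)) by (rewrite INR_IZR_INZ, Z2Nat.id by lia; reflexivity).
  assert (HD : dense (Z.to_nat d) f (spread 4 c)) by (apply qser_dense; now rewrite <- HN).
  split; [split; [|split]|].
  - intros z Hz. destruct (qder_qser _ _ _ z Hq Hz) as [l Hl]. exists l. now apply qder_is_derive.
  - intros g Hg z Hz. now apply GammaStar_form.
  - eapply mero_dense; eassumption.
  - exists (Z.to_nat d). rewrite Z2Nat.id by lia. split.
    + intros n Hn. unfold qcoef. rewrite (proj2 (Z.eqb_neq _ _)) by lia.
      now rewrite (proj2 (Z.leb_gt _ _)) by lia.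
    + intros z Hz. apply is_series_csums. eapply clim_ext; [|exact (HD z Hz)]. intros M. apply csum_ext. intros m _.
      f_equal. unfold spread, qcoef.
      destruct (m mod 4 =? 0)%nat eqn:E.
      * apply Nat.eqb_eq in E. pose proof (Nat.div_mod_eq m 4) as Q. rewrite E, Nat.add_0_r in Q.
        set (k := (m / 4)%nat) in *. replace (Z.of_nat m - d + d)%Z with (Z.of_nat m) by ring.
        replace (Z.to_nat (Z.of_nat m / 4)) with k.
        2:{ rewrite Q, Nat2Z.inj_mul, Z.mul_comm, Z.div_mul, Nat2Z.id by (simpl; lia). reflexivity. }
        destruct (Z.eqb_spec (Z.of_nat m - d) (- d)) as [E0|E0].
        -- replace k with O by lia. exact H0.
        -- assert (((Z.of_nat m - d) mod 4 =? r)%Z = true) as ->.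
           { apply Z.eqb_eq. rewrite <- Hdr, Q, Nat2Z.inj_mul. change (Z.of_nat 4) with 4%Z.
             replace (4 * Z.of_nat k - d)%Z with (- d + Z.of_nat k * 4)%Z by ring. apply Z.mod_add. lia. }
           destruct (Z.leb_spec L (Z.of_nat m - d)); simpl; [reflexivity|]. apply Hk; lia.
      * apply Nat.eqb_neq in E. rewrite (proj2 (Z.eqb_neq _ _)).
        -- assert (((Z.of_nat m - d) mod 4 =? r)%Z = false) as ->; [|now rewrite Bool.andb_false_r].
           apply Z.eqb_neq. intros Z0. apply E.
           assert (Z.of_nat m mod 4 = 0)%Z as Y.
           { replace (Z.of_nat m) with ((Z.of_nat m - d) - (- d))%Z by ring.
             rewrite Zminus_mod, Z0, Hdr, Z.sub_diag. reflexivity. }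
           change 4%Z with (Z.of_nat 4) in Y. rewrite <- Nat2Z.inj_mod in Y. lia.
        -- intros Z0. apply E. replace m with O by lia. reflexivity.
Qed.

(** The last hypothesis says that all exponents below [L] after the leading one have been cleared:
    the first one left free is [4 * (j + 1) - d]. *)
Lemma exists_form (b : bool) eps (d r L : Z) rho0 f0 (c0 : nat -> C) (j : nat) :
  (eps * eps = 1)%R -> (0 < d)%Z -> (1 <= L)%Z -> (r = if b then 1 else 3)%Z -> (- d mod 4 = r)%Z ->
  qser rho0 f0 c0 -> c0 O = 1 -> Winv eps f0 ->
  (rho0 - INR j = - IZR d / 4)%R -> (4 * (Z.of_nat j + 1) - d >= L)%Z ->
  exists f a, is_form d r L (chi b eps) f a.
Proof.
  intros He Hd HL Hr Hdr H0 H00 HW Hrho Hj.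
  destruct (exists_normal rho0 eps f0 c0 H0 H00 HW j) as (f & c & Hf & Hc & Hck & HWf).
  exists f. eexists. eapply (is_form_of b eps d r L f c); try eassumption.
  - now rewrite <- Hrho.
  - intros k Hk1 Hk2. apply Hck. lia.
Qed.

(** * Vanishing of forms *)

(* Averaging over the [N]-th roots of unity isolates the coefficients congruent to [m] modulo [N]. *)
Lemma cauchy_coef (c : nat -> C) (x : C) (B : R) (m : nat) :
  cabs (fun n => c n * x ^ n) ->
  (forall N l : nat, (0 < N)%nat -> (Cmod (ev c (x * qpow (/ INR N) (INR l))) <= B)%R) ->
  (Cmod (c m * x ^ m)%C <= B)%R.
Proof.
  intros Hc HB.
  pose (X N n l := c n * x ^ n * qpow (IZR (Z.of_nat n - Z.of_nat m) / INR N) (INR l)).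
  assert (Q1 : forall r (s : R), Cmod (qpow r s) = 1%R).
  { intros r s. rewrite Cmod_qpow. replace (- (2 * PI * r * Im s))%R with 0%R by (simpl; ring). apply exp_0. }
  assert (HX : forall N l, cabs (fun n => X N n l)).
  { intros N l. eapply cabs_le; [|exact Hc]. intros n. unfold X. cbv beta. rewrite (Cmod_mult (c n * x ^ n)), Q1. lra. }
  pose (F N n := / INR (S N) * csum (X (S N) n) (S N)).
  assert (EF : forall N n, F N n = if ((Z.of_nat n - Z.of_nat m) mod Z.of_nat (S N) =? 0)%Z then c n * x ^ n else 0).
  { intros N n. unfold F, X. rewrite csum_scal, roots_sum by lia.
    destruct (_ =? _)%Z; [field; apply INR_S_neq0|ring]. }
  (* As the number of roots of unity grows, [m] itself is eventually the only survivor at any fixed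
     index, by Tannery's theorem. *)
  assert (L : clim (fun N => Cser (F N)) (Cser (fun n => if (n =? m)%nat then c n * x ^ n else 0))).
  { apply tannery with (fun n => Cmod (c n * x ^ n)); [|exact Hc|].
    - intros N n. rewrite EF. destruct (_ =? _)%Z; [lra|]. rewrite Cmod_0. apply Cmod_ge_0.
    - intros n. apply (clim_ext_ev (fun _ => if (n =? m)%nat then c n * x ^ n else 0) _ _ (n + m)); [|apply clim_const].
      intros N HN. rewrite EF. destruct (Nat.eqb_spec n m) as [->|Hne].
      + rewrite Z.sub_diag, Z.mod_0_l by lia. reflexivity.
      + rewrite (proj2 (Z.eqb_neq _ _)); [reflexivity|]. intros Z0. apply Z.mod_divide in Z0; [|lia].
        destruct Z0 as [t Ht]. assert (t = 0 \/ 1 <= Z.abs t)%Z as [->|Ht'] by lia; [lia|]. nia. }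
  replace (Cser (fun n => if (n =? m)%nat then c n * x ^ n else 0)) with (c m * x ^ m) in L.
  2:{ rewrite (Cser_fin _ (S m)).
      - cbn [csum]. rewrite Nat.eqb_refl, (csum_ext _ (fun _ => 0)).
        + rewrite csum_const. ring.
        + intros k Hk. rewrite (proj2 (Nat.eqb_neq _ _)) by lia. reflexivity.
      - intros k Hk. rewrite (proj2 (Nat.eqb_neq _ _)) by lia. reflexivity. }
  refine (clim_Cmod_le _ _ B _ L). intros N. cbv beta.
  assert (HS : (0 < INR (S N))%R) by (apply lt_0_INR; lia).
  unfold F. destruct (csum_Cser (X (S N)) (S N) (HX (S N))) as [E1 E2]. rewrite Cser_scal by exact E2.
  rewrite <- E1, Cmod_mult, Cmod_inv, Cmod_R, Rabs_pos_eq by (try apply INR_S_neq0; lra).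
  apply Rmult_le_reg_l with (INR (S N)); [assumption|]. rewrite <- Rmult_assoc, Rinv_r, Rmult_1_l by lra.
  eapply Rle_trans; [apply (Cmod_csum_le _ (fun _ => B))|].
  - intros l _.
    rewrite (Cser_ext _ (fun n => qpow (- (INR m / INR (S N))) (INR l) * (c n * (x * qpow (/ INR (S N)) (INR l)) ^ n))).
    + rewrite Cser_scal.
      * rewrite Cmod_mult, Q1, Rmult_1_l. apply HB. lia.
      * eapply cabs_le; [|exact Hc]. intros n. cbv beta. rewrite !Cmod_mult, !Cmod_pow, Cmod_mult, Q1, Rmult_1_r. lra.
    + intros n. unfold X. rewrite Cpow_mult_l, <- qpow_INR, minus_IZR, <- !INR_IZR_INZ.
      replace ((INR n - INR m) / INR (S N))%R with (- (INR m / INR (S N)) + / INR (S N) * INR n)%R by (field; lra).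
      rewrite qpow_plus. ring.
  - clear. induction (S N) as [|k IH]; [simpl; lra|]. cbn [rsum]. rewrite S_INR. lra.
Qed.

Lemma exp_INR_mult n x : exp (INR n * x) = (exp x ^ n)%R.
Proof.
  induction n as [|n IH]; [simpl; rewrite Rmult_0_l; apply exp_0|].
  rewrite S_INR, Rmult_plus_distr_r, exp_plus, IH, Rmult_1_l. simpl. ring.
Qed.

(** Sixteen factors are accurate enough for the two numerical values needed in
    [contraction_const]. *)
Lemma exp_lower x : (0 <= x)%R -> ((1 + x / 16) ^ 16 <= exp x)%R.
Proof.
  intros Hx. replace x with (INR 16 * (x / 16))%R at 2 by (simpl; field). rewrite exp_INR_mult.
  apply pow_incr. split; [lra|apply exp_ineq1_le].
Qed.

Lemma exp_le_mono x y : (x <= y)%R -> (exp x <= exp y)%R.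
Proof. intros [H| ->]; [apply Rlt_le; now apply exp_increasing|lra]. Qed.

(** Only [3 <= PI] is used: [1.1025 = 3 * (3/4) * 0.49] and [1.47 = 3 * 0.49]. The product
    [7/10 * 4/3 = 14/15] of the two bounds is the contraction factor. *)
Lemma contraction_const y : (49 / 100 <= y)%R ->
  (2 * exp (- (PI * (3 / 4) * y)) <= 7 / 10 /\ / (1 - exp (- (PI * y))) <= 4 / 3)%R.
Proof.
  intros Hy. pose proof PI2_3_2 as HP.
  assert (A : (exp (- (11025 / 10000)) <= 35 / 100)%R).
  { rewrite exp_Ropp. replace (35 / 100)%R with (/ (100 / 35))%R by field. apply Rinv_le_contravar; [lra|].
    eapply Rle_trans; [|apply exp_lower; lra]. simpl. lra. }
  assert (B : (exp (- (147 / 100)) <= / 4)%R).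
  { rewrite exp_Ropp. apply Rinv_le_contravar; [lra|]. eapply Rle_trans; [|apply exp_lower; lra]. simpl. lra. }
  split.
  - assert (exp (- (PI * (3 / 4) * y)) <= exp (- (11025 / 10000)))%R by (apply exp_le_mono; nra). lra.
  - assert (exp (- (PI * y)) <= exp (- (147 / 100)))%R by (apply exp_le_mono; nra).
    replace (4 / 3)%R with (/ (3 / 4))%R by field. apply Rinv_le_contravar; lra.
Qed.

Lemma Cmod_qser_shift rho f c z n : qser rho f c -> UHP z -> Cmod (f (z + IZR n)) = Cmod (f z).
Proof.
  intros [_ H] Hz. rewrite !H by (try apply UHP_IZR; assumption).
  rewrite qpow_1_IZR, !Cmod_mult, !Cmod_qpow. do 4 f_equal.
  change (Im (z + IZR n)) with (Im z + 0)%R. ring.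
Qed.

(* [y^w |F|] is invariant, hence bounded by its supremum over [y >= 49/100]; there Cauchy's estimates on the
   line of height [y/2] improve any bound by the factor [14/15]. *)
Section Vanishing.

Variables (w : nat) (rho : R) (F : C -> C) (c : nat -> C).
Hypothesis Hw : (1 <= w)%nat.
Hypothesis Hrho : (3 / 4 * INR w <= rho)%R.
Hypothesis HF : qser rho F c.
Hypothesis HFW : forall z, UHP z -> (Cmod (F (- / (2 * z))) = (2 * Cmod z ^ 2) ^ w * Cmod (F z))%R.

Let phi (z : C) : R := (Im z ^ w * Cmod (F z))%R.

Lemma phi_pos z : UHP z -> (0 <= phi z)%R.
Proof. intros Hz. apply Rmult_le_pos; [apply pow_le; unfold UHP in Hz; lra|apply Cmod_ge_0]. Qed.

(** Below height [49/100], after a translation to [|Re z| <= 1/2], one has [2 * |z|^2 <= 0.9802], so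
    [W2] raises the height by more than [101/100]. The fixed gain is what makes [n] bound the number
    of steps. *)
Lemma phi_reduce n z : UHP z -> (49 / 100 <= Im z * (101 / 100) ^ n)%R ->
  exists z', UHP z' /\ (49 / 100 <= Im z')%R /\ phi z' = phi z.
Proof.
  revert z. induction n as [|n IH]; intros z Hz Hn.
  - exists z. simpl in Hn. repeat split; [assumption|lra].
  - destruct (Rle_lt_dec (49 / 100) (Im z)) as [H|H]; [exists z; repeat split; assumption|].
    pose (k := (- up (Re z - 1 / 2))%Z). destruct (archimed (Re z - 1 / 2)) as [U1 U2].
    set (z1 := z + IZR k).
    assert (Hz1 : UHP z1) by now apply UHP_IZR.
    assert (HR : (- (1 / 2) <= Re z1 <= 1 / 2)%R).
    { unfold z1, k. change (Re (z + IZR (- up (Re z - 1 / 2)))) with (Re z + IZR (- up (Re z - 1 / 2)))%R.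
      rewrite opp_IZR. lra. }
    assert (HI : Im z1 = Im z) by (unfold z1; change (Im z + 0 = Im z)%R; ring).
    assert (Hm : (0 < Cmod z1 ^ 2)%R) by (apply pow_lt, Cmod_gt_0; now apply UHP_neq0).
    assert (Hm2 : (Cmod z1 ^ 2 <= 1 / 4 + Im z ^ 2)%R) by (rewrite Cmod_sq_Re_Im, HI; nra).
    assert (HIW : Im (- / (2 * z1)) = (Im z / (2 * Cmod z1 ^ 2))%R).
    { rewrite Im_neg_inv by (apply UHP_neq0, UHP_scal; [lra|assumption]).
      rewrite Im_scal_R, Cmod_mult, Cmod_R, Rabs_pos_eq, HI by lra. field. 
      apply Rgt_not_eq, Rlt_gt. apply Cmod_gt_0. now apply UHP_neq0. }
    unfold UHP in Hz.
    assert (HG : (101 / 100 * Im z <= Im (- / (2 * z1)))%R).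
    { rewrite HIW. apply (Rle_div_r (101 / 100 * Im z) (Im z) (2 * Cmod z1 ^ 2)); [lra|].
      assert (Im z ^ 2 <= (49 / 100) ^ 2)%R by (apply pow_incr; lra).
      assert (0 <= Im z * (1 - 101 / 100 * (2 * Cmod z1 ^ 2)))%R by (apply Rmult_le_pos; lra). lra. }
    destruct (IH (- / (2 * z1)) (W_UHP z1 Hz1)) as (z' & Z1 & Z2 & Z3).
    { eapply Rle_trans; [exact Hn|]. simpl pow. rewrite <- Rmult_assoc.
      apply Rmult_le_compat_r; [apply pow_le; lra|lra]. }
    exists z'. repeat split; try assumption. rewrite Z3. unfold phi. rewrite HFW, HIW by assumption.
    unfold z1 at 3. rewrite (Cmod_qser_shift rho F c z k HF Hz). fold z1.
    unfold Rdiv. rewrite Rpow_mult_distr, pow_inv. field.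
    apply pow_nonzero. lra.
Qed.

Lemma phi_dominated z : UHP z -> exists z', UHP z' /\ (49 / 100 <= Im z')%R /\ phi z' = phi z.
Proof.
  intros Hz. pose proof Hz as Hz'. unfold UHP in Hz'.
  destruct (Pow_x_infinity (101 / 100) ltac:(rewrite Rabs_pos_eq; lra) (49 / 100 / Im z)) as [n Hn].
  apply (phi_reduce n z Hz). specialize (Hn n (Nat.le_refl _)). rewrite Rabs_pos_eq in Hn by (apply pow_le; lra).
  apply Rge_le in Hn. apply Rle_div_l in Hn; lra.
Qed.

(** At height at least [49/100] the power series is bounded, and [y^w * exp (- 2 PI rho y)] is the
    [w]-th power of [y * exp (- a y) <= 1 / a]. *)
Lemma phi_bounded : exists M, forall z, UHP z -> (phi z <= M)%R.
Proof.
  pose proof PI_RGT_0 as HPI. assert (HwR : (1 <= INR w)%R) by now apply (le_INR 1).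
  set (r0 := exp (- (2 * PI * (49 / 100)))).
  assert (Hr0 : (0 <= r0 < 1)%R).
  { split; [apply Rlt_le, exp_pos|]. unfold r0. rewrite <- exp_0. apply exp_increasing. nra. }
  set (B := nrm c r0).
  assert (HB0 : (0 <= B)%R) by (apply nrm_pos; [lra|now apply HF]).
  set (a := (2 * PI * rho / INR w)%R). assert (Ha : (0 < a)%R) by (unfold a; apply Rdiv_lt_0_compat; nra).
  exists ((/ a) ^ w * B)%R. intros z Hz. destruct (phi_dominated z Hz) as (z' & Hz' & Hy & <-). clear z Hz.
  set (y := Im z') in *. unfold phi. fold y. rewrite (proj2 HF z' Hz'), Cmod_mult, Cmod_qpow. fold y.
  assert (Hev : (Cmod (ev c (qpow 1 z')) <= B)%R).
  { apply Cser_Cmod_le; [|now apply HF]. intros n. rewrite Cmod_mult, Cmod_pow.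
    apply Rmult_le_compat_l; [apply Cmod_ge_0|]. apply pow_incr. split; [apply Cmod_ge_0|].
    rewrite Cmod_qpow. fold y. apply exp_le_mono. nra. }
  assert (E : exp (- (2 * PI * rho * y)) = (exp (- (a * y)) ^ w)%R).
  { rewrite <- exp_INR_mult. f_equal. unfold a. field. lra. }
  rewrite E, <- Rmult_assoc, <- Rpow_mult_distr. apply Rmult_le_compat; [|apply Cmod_ge_0| |exact Hev].
  - apply pow_le, Rmult_le_pos; [lra|apply Rlt_le, exp_pos].
  - apply pow_incr. split; [apply Rmult_le_pos; [lra|apply Rlt_le, exp_pos]|].
    rewrite exp_Ropp. pose proof (exp_ineq1_le (a * y)) as Q. pose proof (exp_pos (a * y)).
    apply Rmult_le_reg_r with (exp (a * y)); [assumption|]. rewrite Rmult_assoc, Rinv_l, Rmult_1_r by lra.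
    apply Rmult_le_reg_l with a; [assumption|]. rewrite <- Rmult_assoc, Rinv_r, Rmult_1_l by lra. nra.
Qed.

Lemma phi_contract M : (forall z, UHP z -> (phi z <= M)%R) -> forall z, UHP z -> (phi z <= 14 / 15 * M)%R.
Proof.
  intros HM z0 Hz0. destruct (phi_dominated z0 Hz0) as (z & Hz & Hy & <-). clear z0 Hz0.
  pose proof PI_RGT_0 as HPI. assert (HwR : (1 <= INR w)%R) by now apply (le_INR 1).
  (* Coefficients are estimated on the line of height [y / 2]; returning to height [y] leaves the
     geometric ratio [t = exp (- PI * y)]. *)
  set (y := Im z) in *. set (y' := (y / 2)%R). assert (Hy' : (0 < y')%R) by (unfold y'; lra).
  assert (HM0 : (0 <= M)%R) by (eapply Rle_trans; [apply (phi_pos z Hz)|now apply HM]).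
  set (z1 := ((0, y') : C)). assert (Hz1 : UHP z1) by exact Hy'.
  set (D := (M / y' ^ w * exp (2 * PI * rho * y'))%R).
  assert (Hyw : (0 < y' ^ w)%R) by now apply pow_lt.
  assert (HD0 : (0 <= D)%R).
  { unfold D. apply Rmult_le_pos; [apply Rmult_le_pos; [assumption|apply Rlt_le, Rinv_0_lt_compat, Hyw]|apply Rlt_le, exp_pos]. }
  assert (Hcoef : forall m, (Cmod (c m * qpow 1 z1 ^ m)%C <= D)%R).
  { intros m. apply cauchy_coef; [apply cabs_rad1; [apply HF|now apply Cmod_q_lt1]|].
    intros N l HN. set (z2 := z1 + RtoC (/ INR N * INR l)).
    assert (E : qpow 1 z1 * qpow (/ INR N) (INR l) = qpow 1 z2).
    { unfold z2. rewrite qpow_zplus, (qpow_real 1), (qpow_real (/ INR N)), Rmult_1_l. reflexivity. }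
    assert (Hz2 : UHP z2) by now apply UHP_shift.
    assert (I2 : Im z2 = y') by (unfold z2; change (y' + 0 = y')%R; ring).
    rewrite E. pose proof (HM z2 Hz2) as Q. unfold phi in Q. rewrite I2, (proj2 HF z2 Hz2), Cmod_mult, Cmod_qpow, I2 in Q.
    unfold D. pose proof (exp_pos (2 * PI * rho * y')). rewrite exp_Ropp in Q.
    apply Rmult_le_reg_l with (y' ^ w * / exp (2 * PI * rho * y'))%R.
    - apply Rmult_lt_0_compat; [assumption|now apply Rinv_0_lt_compat].
    - rewrite Rmult_assoc. eapply Rle_trans; [exact Q|]. apply Req_le. field. split; lra. }
  set (t := exp (- (PI * y))).
  destruct (contraction_const y Hy) as [K1 K2]. fold t in K2.
  assert (Ht : (0 < t < 1)%R).
  { split; [apply exp_pos|]. unfold t. rewrite <- exp_0. apply exp_increasing. nra. }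
  assert (Hev : (Cmod (ev c (qpow 1 z)) <= D * / (1 - t))%R).
  { rewrite <- (Series_geom t) by (rewrite Rabs_pos_eq; lra). rewrite <- Series_scal_l.
    apply Cser_Cmod_le; [|apply (ex_series_scal_l D (fun n => t ^ n)%R), ex_series_geom; rewrite Rabs_pos_eq; lra].
    intros m. specialize (Hcoef m). rewrite Cmod_mult, Cmod_pow, Cmod_qpow in *. change (Im z1) with y' in Hcoef. fold y.
    replace (exp (- (2 * PI * 1 * y))) with (exp (- (2 * PI * 1 * y')) * t)%R.
    - rewrite Rpow_mult_distr, <- Rmult_assoc. apply Rmult_le_compat_r; [apply pow_le; lra|exact Hcoef].
    - unfold t. rewrite <- exp_plus. f_equal. unfold y'. field. }
  unfold phi. fold y. rewrite (proj2 HF z Hz), Cmod_mult, Cmod_qpow. fold y.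
  set (e := exp (- (2 * PI * rho * y))).
  apply Rle_trans with (y ^ w * (e * (D * / (1 - t))))%R.
  { apply Rmult_le_compat_l; [apply pow_le; lra|]. apply Rmult_le_compat_l; [apply Rlt_le, exp_pos|exact Hev]. }
  (* The factor [2 ^ w] is the price of halving the height, and [exp (- PI * rho * y)] the decay
     gained on the way back. *)
  assert (Ee : (y ^ w * (e * (D * / (1 - t))) = 2 ^ w * exp (- (PI * rho * y)) * / (1 - t) * M)%R).
  { unfold D, e. replace y with (2 * y')%R at 1 by (unfold y'; field). rewrite Rpow_mult_distr.
    replace (exp (- (PI * rho * y))) with (exp (- (2 * PI * rho * y)) * exp (2 * PI * rho * y'))%R
      by (rewrite <- exp_plus; f_equal; unfold y'; field). field. split; lra. }
  rewrite Ee. apply Rmult_le_compat_r; [assumption|].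
  assert (P : (2 ^ w * exp (- (PI * rho * y)) <= 7 / 10)%R).
  { apply Rle_trans with ((2 * exp (- (PI * (3 / 4) * y))) ^ w)%R.
    - rewrite Rpow_mult_distr. apply Rmult_le_compat_l; [apply pow_le; lra|]. rewrite <- exp_INR_mult. apply exp_le_mono.
      assert (0 < PI * y)%R by nra. nra.
    - pose proof (exp_pos (- (PI * (3 / 4) * y))). destruct w as [|w']; [lia|].
      assert ((2 * exp (- (PI * (3 / 4) * y))) ^ w' <= 1)%R by (rewrite <- (pow1 w'); apply pow_incr; lra).
      assert (0 <= (2 * exp (- (PI * (3 / 4) * y))) ^ w')%R by (apply pow_le; lra). simpl pow. nra. }
  assert (0 <= / (1 - t))%R by (apply Rlt_le, Rinv_0_lt_compat; lra).
  assert (0 <= 2 ^ w * exp (- (PI * rho * y)))%R by (apply Rmult_le_pos; [apply pow_le; lra|apply Rlt_le, exp_pos]).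
  apply Rle_trans with (7 / 10 * (4 / 3))%R; [apply Rmult_le_compat; assumption|lra].
Qed.

Lemma vanishing z : UHP z -> F z = 0.
Proof.
  intros Hz. destruct phi_bounded as [M HM].
  assert (HMn : forall n z, UHP z -> (phi z <= (14 / 15) ^ n * M)%R).
  { induction n as [|n IH]; intros y Hy; [simpl; rewrite Rmult_1_l; now apply HM|].
    simpl pow. rewrite Rmult_assoc. now apply phi_contract. }
  assert (L : is_lim_seq (fun n => (14 / 15) ^ n * M)%R 0).
  { replace (Finite 0) with (Rbar_mult 0 M) by (simpl; f_equal; ring).
    apply (is_lim_seq_scal_r (fun n => (14 / 15) ^ n)%R M 0). apply is_lim_seq_geom. rewrite Rabs_pos_eq; lra. }
  assert (P : (phi z <= 0)%R).
  { apply (is_lim_seq_le (fun _ => phi z) (fun n => (14 / 15) ^ n * M)%R (phi z) 0); [intros n; now apply HMn| |exact L].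
    apply is_lim_seq_const. }
  apply Cmod_eq_0. pose proof (Cmod_ge_0 (F z)). unfold phi in P. unfold UHP in Hz.
  pose proof (pow_lt (Im z) w Hz). nra.
Qed.

End Vanishing.

(** * From expansions of forms back to power series, and uniqueness *)

Lemma rad1_of_csums (c : nat -> C) :
  (forall z, UHP z -> exists l, csums (fun k => c k * qpow 1 z ^ k) l) -> rad1 c.
Proof.
  (* Only convergence is given, not absolute convergence. At a point where [|q| = r' > r] it bounds
     the terms, and comparison with the ratio [r / r'] follows. *)
  intros H r Hr. pose proof PI_RGT_0 as HPI. set (r' := ((1 + r) / 2)%R). assert (Hr' : (r < r' < 1)%R) by (unfold r'; lra).
  set (z := ((0, - ln r' / (2 * PI))%R : C)).
  assert (Hz : UHP z).
  { unfold UHP, z; simpl. apply Rdiv_lt_0_compat; [|lra]. assert (ln r' < ln 1)%R by (apply ln_increasing; lra).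
    rewrite ln_1 in *. lra. }
  assert (Hq : Cmod (qpow 1 z) = r').
  { rewrite Cmod_qpow. unfold z; simpl. replace (- (2 * PI * 1 * (- ln r' / (2 * PI))))%R with (ln r') by (field; lra).
    apply exp_ln. lra. }
  destruct (H z Hz) as [l Hl]. destruct (clim_bounded _ _ Hl) as [M HM].
  assert (B : forall k, (Cmod (c k) * r' ^ k <= 2 * M)%R).
  { intros k. rewrite <- Hq, <- Cmod_pow, <- Cmod_mult.
    replace (c k * qpow 1 z ^ k) with (csum (fun k => c k * qpow 1 z ^ k) (S k) - csum (fun k => c k * qpow 1 z ^ k) k)
      by (cbn [csum]; ring).
    eapply Rle_trans; [apply Cmod_sub_le|]. pose proof (HM (S k)). pose proof (HM k). lra. }
  apply (ex_series_le (K := R_AbsRing) (V := R_CompleteNormedModule) _ (fun k => 2 * M * (r / r') ^ k)%R).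
  - intros k. unfold norm; simpl; unfold abs; simpl.
    rewrite Rabs_pos_eq by (apply Rmult_le_pos; [apply Cmod_ge_0|apply pow_le; lra]).
    replace (r ^ k)%R with (r' ^ k * (r / r') ^ k)%R by (rewrite <- Rpow_mult_distr; f_equal; field; lra).
    rewrite <- Rmult_assoc. apply Rmult_le_compat_r; [|apply B].
    apply pow_le, Rmult_le_pos; [lra|apply Rlt_le, Rinv_0_lt_compat; lra].
  - apply (ex_series_scal_l (2 * M)%R (fun k => (r / r') ^ k)%R), ex_series_geom.
    assert (0 <= r / r')%R by (apply Rmult_le_pos; [lra|apply Rlt_le, Rinv_0_lt_compat; lra]).
    rewrite Rabs_pos_eq by assumption. apply Rlt_div_l; lra.
Qed.

(** The starting index is explicit here, so that [qexpN_le] can align two expansions before they are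
    combined. *)
Definition qexpN (N : nat) (f : C -> C) (c : Z -> C) : Prop :=
  (forall n : Z, (n < - Z.of_nat N)%Z -> c n = 0) /\
  forall z, UHP z -> csums (fun m => c (Z.of_nat m - Z.of_nat N)%Z * qpow ((INR m - INR N) / 4) z) (f z).

Lemma has_qexpE f c : has_qexp 4 f c <-> exists N, qexpN N f c.
Proof.
  split; intros [N [H1 H2]]; exists N; (split; [assumption|]); intros z Hz; apply is_series_csums; now apply H2.
Qed.

Lemma qexpN_le N N' f c : (N <= N')%nat -> qexpN N f c -> qexpN N' f c.
Proof.
  intros HN [H1 H2]. split; [intros n Hn; apply H1; lia|]. intros z Hz.
  set (g := fun m : nat => c (Z.of_nat m - Z.of_nat N')%Z * qpow ((INR m - INR N') / 4) z).
  replace (f z) with (csum g (N' - N) + f z).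
  - apply csums_shift. eapply clim_ext; [|exact (H2 z Hz)]. intros M. apply csum_ext. intros m _. unfold g. f_equal.
    + f_equal. lia.
    + f_equal. rewrite plus_INR, minus_INR by lia. field.
  - rewrite (csum_ext _ (fun _ => 0)); [rewrite csum_const; ring|]. intros k Hk. unfold g. rewrite H1 by lia. ring.
Qed.

Lemma has_qexp_lin f g c e (s : C) : has_qexp 4 f c -> has_qexp 4 g e ->
  has_qexp 4 (fun z => f z + s * g z) (fun n => c n + s * e n).
Proof.
  rewrite !has_qexpE. intros [N HN] [M HM].
  apply (qexpN_le N (N + M)) in HN; [|lia]. apply (qexpN_le M (N + M)) in HM; [|lia].
  exists (N + M)%nat. destruct HN as [N1 N2], HM as [M1 M2]. split.
  - intros n Hn. rewrite N1, M1 by assumption. ring.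
  - intros z Hz. eapply clim_ext; [|apply clim_plus; [exact (N2 z Hz)|apply (clim_scal s); exact (M2 z Hz)]].
    intros K. cbv beta. rewrite <- csum_scal, <- csum_plus. apply csum_ext. intros; ring.
Qed.

(** Support in a single class modulo [4] makes the series in [q^(1/4)] a dilated series in [q]; the
    terms below [L] are dropped as zeros. *)
Lemma qexp_qser f (c : Z -> C) (L : nat) : has_qexp 4 f c ->
  (forall n : Z, (n < Z.of_nat L)%Z -> c n = 0) ->
  (forall n : Z, (n mod 4 <> Z.of_nat L mod 4)%Z -> c n = 0) ->
  qser (INR L / 4) f (fun k => c (Z.of_nat L + 4 * Z.of_nat k)%Z).
Proof.
  intros H HL Hs. apply has_qexpE in H. destruct H as [N [_ H2]].
  assert (K : forall z, UHP z -> csums (fun k => qpow (INR L / 4) z * (c (Z.of_nat L + 4 * Z.of_nat k)%Z * qpow 1 z ^ k)) (f z)).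
  { intros z Hz. specialize (H2 z Hz).
    set (g := fun m : nat => c (Z.of_nat m - Z.of_nat N)%Z * qpow ((INR m - INR N) / 4) z) in H2.
    replace (f z) with (csum g (N + L) + f z) in H2.
    - apply csums_shift in H2. apply (csums_spread 4); [lia|]. eapply clim_ext; [|exact H2].
      intros M. apply csum_ext. intros m _. unfold g, spread.
      replace (Z.of_nat (N + L + m) - Z.of_nat N)%Z with (Z.of_nat L + Z.of_nat m)%Z by lia.
      destruct (m mod 4 =? 0)%nat eqn:E.
      + apply Nat.eqb_eq in E. pose proof (Nat.div_mod_eq m 4) as Q. rewrite E, Nat.add_0_r in Q.
        assert (INR m = 4 * INR (m / 4))%R as Em by (rewrite Q at 1; rewrite mult_INR; simpl; ring).
        replace (Z.of_nat m) with (4 * Z.of_nat (m / 4))%Z by lia.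
        rewrite !plus_INR, Em. replace ((INR N + INR L + 4 * INR (m / 4) - INR N) / 4)%R with (INR L / 4 + INR (m / 4))%R by field.
        rewrite qpow_plus, qpow_nat. ring.
      + apply Nat.eqb_neq in E. rewrite Hs; [ring|]. intros Z0. apply E.
        assert (Z.of_nat m mod 4 = 0)%Z as Y.
        { replace (Z.of_nat m) with ((Z.of_nat L + Z.of_nat m) - Z.of_nat L)%Z by ring.
          rewrite Zminus_mod, Z0, Z.sub_diag. reflexivity. }
        change 4%Z with (Z.of_nat 4) in Y. rewrite <- Nat2Z.inj_mod in Y. lia.
    - rewrite (csum_ext _ (fun _ => 0)); [rewrite csum_const; ring|]. intros k Hk. unfold g. rewrite HL by lia. ring. }
  assert (K' : forall z, UHP z -> csums (fun k => c (Z.of_nat L + 4 * Z.of_nat k)%Z * qpow 1 z ^ k) (/ qpow (INR L / 4) z * f z)).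
  { intros z Hz. eapply clim_ext; [|apply (clim_scal (/ qpow (INR L / 4) z)); exact (K z Hz)].
    intros M. cbv beta. rewrite <- csum_scal. apply csum_ext. intros k _. field. apply qpow_neq0. }
  assert (R : rad1 (fun k => c (Z.of_nat L + 4 * Z.of_nat k)%Z)).
  { apply rad1_of_csums. intros z Hz. eexists. now apply K'. }
  split; [exact R|]. intros z Hz. unfold ev. rewrite (Cser_unique _ _ (cabs_rad1 _ _ R (Cmod_q_lt1 z Hz)) (K' z Hz)).
  field. apply qpow_neq0.
Qed.

Lemma qser_drop rho f (a : nat -> C) : qser rho f a -> a O = 0 -> qser (rho + 1) f (fun n => a (S n)).
Proof.
  intros [H1 H2] H0.
  assert (R : rad1 (fun n => a (S n))).
  { intros r Hr. apply psabs_cabs; [lra|].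
    assert (Hr1 : (0 <= (1 + r) / 2 < 1)%R) by lra.
    pose proof (H1 _ Hr1) as P. apply (ex_series_incr_1 (fun n => Cmod (a n) * ((1 + r) / 2) ^ n)%R) in P.
    apply cabs_le with (fun n => / ((1 + r) / 2) * (Cmod (a (S n)) * ((1 + r) / 2) ^ S n))%R.
    - intros n. rewrite Cmod_mult, Cmod_pow, Cmod_R, Rabs_pos_eq by lra.
      replace (/ ((1 + r) / 2) * (Cmod (a (S n)) * ((1 + r) / 2) ^ S n))%R with (Cmod (a (S n)) * ((1 + r) / 2) ^ n)%R
        by (simpl; field; lra).
      apply Rmult_le_compat_l; [apply Cmod_ge_0|]. apply pow_incr. lra.
    - now apply (ex_series_scal_l (/ ((1 + r) / 2))%R (fun n => Cmod (a (S n)) * ((1 + r) / 2) ^ S n)%R). }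
  split; [exact R|]. intros z Hz. pose proof (Cmod_q_lt1 z Hz) as Hq. rewrite H2, qpow_plus, <- Cmult_assoc by assumption.
  f_equal. unfold ev. rewrite (Cser_S_l (fun n => a n * qpow 1 z ^ n)) by now apply cabs_rad1.
  rewrite H0, Cmult_0_l, Cplus_0_l, <- Cser_scal by now apply (cabs_rad1 (fun n => a (S n))).
  apply Cser_ext. intros n. rewrite Cpow_S. ring.
Qed.

Lemma vanish_qser rho eps F c : qser rho F c -> (3 / 4 <= rho)%R -> (eps * eps = 1)%R -> Winv eps F ->
  forall z, UHP z -> F z = 0.
Proof.
  intros HF Hr He HW. apply (vanishing 1 rho F c); [lia|simpl; lra|assumption|].
  intros z Hz. rewrite HW by assumption. rewrite !Cmod_mult, !Cmod_R, (Rabs_pos_eq 2) by lra.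
  assert (Rabs eps = 1)%R as ->.
  { assert (E : ((eps - 1) * (eps + 1) = 0)%R) by lra. apply Rmult_integral in E.
    destruct E as [E|E].
    - rewrite Rabs_pos_eq; lra.
    - rewrite Rabs_left; lra. }
  simpl. ring.
Qed.

Lemma h2_neq0 z : UHP z -> h2 z <> 0.
Proof. intros Hz. rewrite h2E by assumption. apply Cmult_neq_0; [apply etasq_neq0|apply v2_neq0]. Qed.

(* A form with the sign opposite to that of [h2] vanishes at the fixed point [i / sqrt 2] of [W2], while
   [f^2] is proportional to [h2^2]. *)
Lemma vanish_plus f c : qser (1 / 4) f c -> Winv 1 f -> forall z, UHP z -> f z = 0.
Proof.
  intros Hf HW. destruct qser_h2 as (ch & Ch0 & Hh).
  pose (G z := f z * f z + - (c O * c O) * (h2 z * h2 z)).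
  assert (HG : qser (1 / 4 + 1 / 4) G (fun n => conv c c n + - (c O * c O) * conv ch ch n)).
  { apply qser_plus; [now apply qser_mult|]. apply qser_scal. now apply qser_mult. }
  assert (G0 : forall z, UHP z -> G z = 0).
  (* The leading terms cancel, so [G] starts at [q^(3/2)], exactly the bound [3/4 * 2] that
     [vanishing] requires in weight 4. *)
  { apply qser_drop in HG; [|rewrite !conv_0, Ch0; ring].
    apply (vanishing 2 (1 / 4 + 1 / 4 + 1) G _ ltac:(lia) ltac:(simpl; lra) HG).
    intros z Hz. assert (G (- / (2 * z)) = (2 * (z * z)) * (2 * (z * z)) * G z) as ->.
    { unfold G. rewrite HW, h2_W, RtoC_m1 by assumption. ring. }
    rewrite !Cmod_mult, Cmod_R, Rabs_pos_eq by lra. simpl. ring. }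
  set (z0 := ((0, / sqrt 2)%R : C)).
  assert (Hs : (0 < sqrt 2)%R) by (apply sqrt_lt_R0; lra).
  assert (Hz0 : UHP z0) by (unfold UHP, z0; simpl; now apply Rinv_0_lt_compat).
  assert (E0 : 2 * z0 * z0 = -(1)).
  { unfold z0, Cmult, RtoC, Copp; simpl. f_equal; [|ring].
    replace ((2 * 0 - 0 * / sqrt 2) * 0 - (2 * / sqrt 2 + 0 * 0) * / sqrt 2)%R with (- (2 / (sqrt 2 * sqrt 2)))%R by (field; lra).
    rewrite sqrt_sqrt by lra. field. }
  assert (f z0 = 0) as F0.
  { pose proof (HW z0 Hz0) as Q. pose proof (UHP_neq0 z0 Hz0).
    replace (- / (2 * z0)) with z0 in Q.
    - rewrite E0 in Q. replace (f z0) with (RtoC (/ 2) * (f z0 - (1 * (-(1)) * f z0))).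
      + rewrite <- Q. ring.
      + replace (f z0 - 1 * (-(1)) * f z0) with (2 * f z0) by ring. rewrite Cmult_assoc, <- RtoC_mult.
        replace (/ 2 * 2)%R with 1%R by field. ring.
    - apply (Cmult_reg_l (2 * z0)); [apply Cmult_neq_0; [apply RtoC_neq0; lra|assumption]|].
      rewrite E0. field. assumption. }
  pose proof (G0 z0 Hz0) as Q. unfold G in Q. rewrite F0 in Q.
  assert (c O * c O = 0) as C0.
  { pose proof (h2_neq0 z0 Hz0) as Hn. apply (Cmult_reg_l (h2 z0 * h2 z0)); [now apply Cmult_neq_0|].
    transitivity (- (0 * 0 + - (c O * c O) * (h2 z0 * h2 z0))); [ring|]. rewrite Q. ring. }
  intros z Hz. pose proof (G0 z Hz) as R. unfold G in R. rewrite C0 in R.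
  assert (f z * f z = 0) as S by (rewrite <- R; ring).
  destruct (excluded_middle_informative (f z = 0)) as [|Hn]; [assumption|].
  exfalso. now apply (Cmult_neq_0 _ _ Hn Hn).
Qed.

Lemma form_Winv b eps f : weakly_holomorphic 2 in_GammaStar2 (chi b eps) f -> Winv eps f.
Proof.
  intros (_ & H & _) z Hz. pose proof (UHP_neq0 z Hz) as Hz0.
  assert (HG : in_GammaStar2 W2).
  { right. unfold mdet, W2; cbn [ma mb mc md]. split; [reflexivity|]. split; [now exists 0%Z|]. split; [now exists 1%Z|now exists 0%Z]. }
  specialize (H W2 HG z Hz). rewrite slash2E in H by (unfold mdet, W2; simpl; lia).
  rewrite chiE in H. change (mdet W2) with 2%Z in H. change (2 =? 1)%Z with false in H. cbv iota in H.
  change (mc W2 / 2 * (ma W2 / 2 + md W2 / 2))%Z with 0%Z in H. rewrite ich_0, Cmult_1_r in H.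
  replace (mact W2 z) with (- / (2 * z)) in H.
  - replace (aut W2 z) with (2 * z) in H by (unfold aut, W2; cbn [mc md]; ring).
    replace (f (- / (2 * z))) with ((2 * z * z) * (2 * / (2 * z * (2 * z)) * f (- / (2 * z)))) by (field; assumption).
    rewrite H. ring.
  - unfold mact, W2; cbn [ma mb mc md]. rewrite RtoC_m1. field. assumption.
Qed.

Lemma qcoef_supp d r L a n : (1 <= L)%Z -> (0 < d)%Z -> (- d mod 4 = r)%Z -> (n mod 4 <> r)%Z -> qcoef d r L a n = 0.
Proof.
  intros HL Hd Hr Hn. unfold qcoef. rewrite (proj2 (Z.eqb_neq n (- d))) by congruence.
  rewrite (proj2 (Z.eqb_neq (n mod 4) r)) by assumption. now rewrite Bool.andb_false_r.
Qed.

Lemma qcoef_low d r L a n : (1 <= L)%Z -> (n < L)%Z -> qcoef d r L a n = if (n =? - d)%Z then 1 else 0.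
Proof.
  intros HL Hn. unfold qcoef. destruct (n =? - d)%Z; [reflexivity|].
  now rewrite (proj2 (Z.leb_gt _ _)) by lia.
Qed.

Lemma form_unique b eps d r (L : nat) f g a a' :
  (eps * eps = 1)%R -> (0 < d)%Z -> (- d mod 4 = r)%Z -> (Z.of_nat L mod 4 = r)%Z -> (1 <= L)%nat ->
  ((3 <= L)%nat \/ L = 1%nat /\ eps = 1%R) ->
  forall L', (1 <= L' <= Z.of_nat L)%Z -> (forall n, (L' <= n < Z.of_nat L)%Z -> (n mod 4 <> r)%Z) ->
  is_form d r L' (chi b eps) f a -> is_form d r L' (chi b eps) g a' ->
  forall z, UHP z -> g z = f z.
Proof.
  intros He Hd Hdr HLr HL1 HL L' HL' Hgap [Wf Qf] [Wg Qg] z Hz.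
  assert (Q : has_qexp 4 (fun z => g z + -(1) * f z) (fun n => qcoef d r L' a' n + -(1) * qcoef d r L' a n))
    by now apply has_qexp_lin.
  apply (qexp_qser _ _ L) in Q.
  - assert (HW : Winv eps (fun z => g z + -(1) * f z)).
    { apply Winv_lin; eapply form_Winv; eassumption. }
    assert (g z + -(1) * f z = 0) as E.
    { destruct HL as [HL| [-> ->]].
      - refine (vanish_qser _ eps _ _ Q _ He HW z Hz). apply (le_INR 3) in HL. simpl in HL. lra.
      - apply (vanish_plus _ _ (qser_rho _ _ _ _ ltac:(simpl; field) Q) HW z Hz). }
    replace (g z) with (g z + -(1) * f z + f z) by ring. rewrite E. ring.
  - intros n Hn. destruct (Z_lt_le_dec n L') as [Hlt|Hge].
    + rewrite !qcoef_low by lia. ring.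
    + rewrite !(qcoef_supp d r L') by (try lia; auto). ring.
  - intros n Hn. rewrite HLr in Hn. rewrite !(qcoef_supp d r L') by (try lia; auto). ring.
Qed.

(** * Hecke operators *)

Lemma heckeE (P : nat) f z : (0 < P)%nat ->
  hecke_p 2 4 (Z.of_nat P) f z =
  / INR P * csum (fun l => f (RtoC (/ INR P) * (z + 4 * INR l))) P + INR P * f (INR P * z).
Proof.
  intros HP. assert (HR : (0 < INR P)%R) by now apply lt_0_INR.
  assert (HC : RtoC (INR P) <> 0) by (apply RtoC_neq0; lra).
  unfold hecke_p. replace (INR 2 / 2 - 1)%R with 0%R by (simpl; field).
  rewrite Rpower_O, Cmult_1_l by (rewrite <- INR_IZR_INZ; assumption). f_equal.
  - rewrite sum_n_csum, Nat2Z.id. replace (S (P - 1)) with P by lia. rewrite <- csum_scal. apply csum_ext. intros l _.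
    rewrite slash2E by (unfold mdet; cbn [ma mb mc md]; lia).
    unfold mdet, aut, mact; cbn [ma mb mc md].
    replace (1 * Z.of_nat P - 4 * Z.of_nat l * 0)%Z with (Z.of_nat P) by ring.
    rewrite mult_IZR, <- !INR_IZR_INZ, RtoC_mult, RtoC_inv by lra.
    replace ((1 * z + 4 * INR l) / (0 * z + INR P)) with (/ INR P * (z + 4 * INR l)) by (field; assumption).
    set (w := f _). field. assumption.
  - rewrite slash2E by (unfold mdet; cbn [ma mb mc md]; lia).
    unfold mdet, aut, mact; cbn [ma mb mc md].
    replace (Z.of_nat P * 1 - 0 * 0)%Z with (Z.of_nat P) by ring. rewrite <- INR_IZR_INZ.
    replace ((INR P * z + 0) / (0 * z + 1)) with (INR P * z) by field.
    set (w := f _). field.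
Qed.

Definition Hc (p : Z) (c : Z -> C) (n : Z) : C :=
  c (p * n)%Z + IZR p * (if (n mod p =? 0)%Z then c (n / p)%Z else 0).

Lemma csums_csum (X : nat -> nat -> C) (L : nat -> C) n :
  (forall l, csums (X l) (L l)) -> csums (fun m => csum (fun l => X l m) n) (csum L n).
Proof.
  intros H. eapply clim_ext; [intros M; apply csum_swap|].
  induction n as [|n IH]; cbn [csum]; [apply clim_const|]. apply clim_plus; [exact IH|apply H].
Qed.

(** The sum over [l] averages over roots of unity and keeps the coefficients at multiples of [P];
    the other term dilates the series. *)
Lemma hecke_qexp (P : nat) f c : (0 < P)%nat -> has_qexp 4 f c ->
  has_qexp 4 (hecke_p 2 4 (Z.of_nat P) f) (Hc (Z.of_nat P) c).
Proof.
  intros HP H. apply has_qexpE in H. destruct H as [N HN]. apply has_qexpE.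
  assert (HR : (0 < INR P)%R) by now apply lt_0_INR.
  assert (HC : RtoC (INR P) <> 0) by (apply RtoC_neq0; lra).
  assert (HPN : forall k, (k <= P * k)%nat) by (intros k; nia).
  exists (P * N)%nat.
  (* The expansion is restarted at [- P * (P * N)], so that the multiples of [P], once divided by
     [P], start at [- P * N] like the dilated series. *)
  pose proof (qexpN_le N (P * (P * N)) f c (Nat.le_trans _ _ _ (HPN N) (HPN (P * N)%nat)) HN) as [U1 U2]. destruct HN as [V1 V2].
  split.
  - intros n Hn. unfold Hc. rewrite V1 by nia. destruct (Z.eqb_spec (n mod Z.of_nat P) 0); [|ring].
    rewrite V1; [ring|]. apply Z.div_lt_upper_bound; lia.
  - intros z Hz. rewrite heckeE by assumption.
    assert (HU : csums (fun m => c (Z.of_nat P * (Z.of_nat m - Z.of_nat (P * N)))%Z * qpow ((INR m - INR (P * N)) / 4) z)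
      (/ INR P * csum (fun l => f (RtoC (/ INR P) * (z + 4 * INR l))) P)).
    { apply (csums_spread P); [assumption|].
      set (N2 := (P * (P * N))%nat) in *.
      assert (HL : forall l : nat, csums (fun m => c (Z.of_nat m - Z.of_nat N2)%Z * qpow ((INR m - INR N2) / 4) (RtoC (/ INR P) * (z + 4 * INR l)))
                (f (RtoC (/ INR P) * (z + 4 * INR l)))).
      { intros l. apply U2. apply UHP_scal; [now apply Rinv_0_lt_compat|]. rewrite <- RtoC_mult. now apply UHP_shift. }
      eapply clim_ext; [|apply (clim_scal (/ INR P)); exact (csums_csum _ _ P HL)].
      intros M. cbv beta. rewrite <- csum_scal. apply csum_ext. intros m _.
      assert (E : forall l : nat, c (Z.of_nat m - Z.of_nat N2)%Z * qpow ((INR m - INR N2) / 4) (RtoC (/ INR P) * (z + 4 * INR l)) =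
         (c (Z.of_nat m - Z.of_nat N2)%Z * qpow ((INR m - INR N2) / 4 * / INR P) z) * qpow (IZR (Z.of_nat m - Z.of_nat N2) / INR P) (INR l)).
      { intros l. rewrite qpow_zscal, qpow_zplus, <- Cmult_assoc. do 2 f_equal.
        rewrite <- RtoC_mult, !qpow_real. do 4 f_equal. rewrite minus_IZR, <- !INR_IZR_INZ. field. lra. }
      rewrite (csum_ext _ _ P (fun l _ => E l)), csum_scal, roots_sum by assumption.
      unfold spread. destruct (m mod P =? 0)%nat eqn:Em.
      - apply Nat.eqb_eq in Em. pose proof (Nat.div_mod_eq m P) as Q. rewrite Em, Nat.add_0_r in Q.
        set (k := (m / P)%nat) in *.
        assert (Ez : (Z.of_nat m - Z.of_nat N2 = Z.of_nat P * (Z.of_nat k - Z.of_nat (P * N)))%Z) by (unfold N2; nia).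
        rewrite Ez, Z.mul_comm, Z.mod_mul by lia. rewrite Z.eqb_refl, Z.mul_comm.
        replace ((INR m - INR N2) / 4 * / INR P)%R with ((INR k - INR (P * N)) / 4)%R.
        + field. assumption.
        + rewrite Q. unfold N2. rewrite !mult_INR. field. lra.
      - apply Nat.eqb_neq in Em. rewrite (proj2 (Z.eqb_neq _ _)); [ring|]. intros Z0. apply Em.
        unfold N2 in Z0. rewrite (Nat2Z.inj_mul P (P * N)) in Z0.
        replace (Z.of_nat m - Z.of_nat P * Z.of_nat (P * N))%Z with (Z.of_nat m + (- Z.of_nat (P * N)) * Z.of_nat P)%Z in Z0 by ring.
        rewrite Z.mod_add, <- Nat2Z.inj_mod in Z0 by lia. lia. }
    assert (HV : csums (fun m => IZR (Z.of_nat P) * (if ((Z.of_nat m - Z.of_nat (P * N)) mod Z.of_nat P =? 0)%Z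
        then c ((Z.of_nat m - Z.of_nat (P * N)) / Z.of_nat P)%Z else 0) * qpow ((INR m - INR (P * N)) / 4) z) (INR P * f (INR P * z))).
    { pose proof (V2 (INR P * z) ltac:(now apply UHP_scal)) as Q.
      apply (clim_scal (INR P)) in Q.
      eapply clim_ext in Q; [|intros M; rewrite <- csum_scal; reflexivity].
      apply (csums_spread P _ _ HP) in Q. eapply clim_ext; [|exact Q]. intros M. apply csum_ext. intros m _.
      unfold spread. rewrite Nat2Z.inj_mul, <- INR_IZR_INZ.
      replace (Z.of_nat m - Z.of_nat P * Z.of_nat N)%Z with (Z.of_nat m + (- Z.of_nat N) * Z.of_nat P)%Z by ring.
      rewrite Z.mod_add, Z.div_add by lia. rewrite <- Nat2Z.inj_mod, <- Nat2Z.inj_div.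
      destruct (m mod P =? 0)%nat eqn:Em.
      - apply Nat.eqb_eq in Em. rewrite Em. change (Z.of_nat 0 =? 0)%Z with true. cbv iota.
        pose proof (Nat.div_mod_eq m P) as Qm. rewrite Em, Nat.add_0_r in Qm.
        rewrite qpow_zscal. replace ((INR (m / P) - INR N) / 4 * INR P)%R with ((INR m - INR (P * N)) / 4)%R.
        + replace (Z.of_nat (m / P) + - Z.of_nat N)%Z with (Z.of_nat (m / P) - Z.of_nat N)%Z by ring. ring.
        + rewrite Qm at 1. rewrite !mult_INR. field.
      - apply Nat.eqb_neq in Em. rewrite (proj2 (Z.eqb_neq _ _)) by lia. ring. }
    eapply clim_ext; [|apply clim_plus; [exact HU|exact HV]]. intros M. cbv beta. rewrite <- csum_plus. apply csum_ext.
    intros m _. unfold Hc. ring.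
Qed.

(** * Hecke operators and the Fricke involution *)

Lemma csum_involution (g : nat -> C) (sg : nat -> nat) n :
  (forall l, (l < n)%nat -> (sg l < n)%nat /\ sg (sg l) = l) -> csum (fun l => g (sg l)) n = csum g n.
Proof.
  intros H.
  assert (D : forall (h : nat -> C) j k, (j < k)%nat -> csum (fun l => if (l =? j)%nat then h l else 0) k = h j).
  { intros h j k Hj. induction k as [|k IH]; [lia|]. cbn [csum]. destruct (Nat.eqb_spec k j) as [->|Hne].
    - rewrite (csum_ext _ (fun _ => 0)).
      + rewrite csum_const. ring.
      + intros l Hl. rewrite (proj2 (Nat.eqb_neq _ _)) by lia. reflexivity.
    - rewrite IH by lia. ring. }
  transitivity (csum (fun l => csum (fun j => if (j =? sg l)%nat then g j else 0) n) n).
  - apply csum_ext. intros l Hl. symmetry. apply D. now apply H.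
  - rewrite csum_swap. apply csum_ext. intros j Hj.
    rewrite (csum_ext _ (fun l => if (l =? sg j)%nat then g j else 0)).
    + apply (D (fun _ => g j)). now apply H.
    + intros l Hl. destruct (Nat.eqb_spec j (sg l)) as [E|E], (Nat.eqb_spec l (sg j)) as [E'|E']; try reflexivity.
      * exfalso. apply E'. rewrite E. symmetry. now apply H.
      * exfalso. apply E. rewrite E'. symmetry. now apply H.
Qed.

(** The congruence is the one that gives the matrix [G] of [hecke_W] determinant [2]. It is solvable
    because [P] is odd, and symmetric in the two residues, so solving it twice returns the first. *)
Lemma inverse_mod (P : nat) : prime (Z.of_nat P) -> Z.of_nat P <> 2%Z ->
  exists sg : nat -> nat, sg O = O /\ (forall l, (l < P)%nat -> (sg l < P)%nat /\ sg (sg l) = l) /\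
    forall l, (0 < l < P)%nat -> (0 < sg l)%nat /\ (Z.of_nat P | 32 * Z.of_nat l * Z.of_nat (sg l) + 1)%Z.
Proof.
  intros Hp Hp2. pose proof (prime_ge_2 _ Hp) as Hge. set (p := Z.of_nat P) in *.
  assert (R32 : forall l, (0 < l < p)%Z -> rel_prime (32 * l) p).
  { intros l Hl. apply rel_prime_sym, rel_prime_mult.
    - assert (rel_prime p 2).
      { apply prime_rel_prime; [assumption|]. intros D. apply Z.divide_pos_le in D; lia. }
      change 32%Z with (2 * (2 * (2 * (2 * 2))))%Z. repeat apply rel_prime_mult; assumption.
    - apply prime_rel_prime; [assumption|]. intros D. apply Z.divide_pos_le in D; lia. }
  assert (Ex : forall l : nat, exists l' : nat, (0 < l < P)%nat -> (0 < l' < P)%nat /\ (p | 32 * Z.of_nat l * Z.of_nat l' + 1)%Z).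
  { intros l. destruct (excluded_middle_informative (0 < l < P)%nat) as [Hl|Hl]; [|exists O; tauto].
    destruct (rel_prime_bezout _ _ (R32 (Z.of_nat l) ltac:(unfold p; lia))) as [u v Huv].
    set (x := ((- u) mod p)%Z). pose proof (Z.mod_pos_bound (- u) p ltac:(lia)) as Bx. fold x in Bx.
    assert (Dx : (p | 32 * Z.of_nat l * x + 1)%Z).
    { assert (x = - u - p * (- u / p))%Z as Ex by (unfold x; pose proof (Z.div_mod (- u) p ltac:(lia)); lia).
      exists (v - 32 * Z.of_nat l * (- u / p))%Z. rewrite Ex.
      transitivity (1 - u * (32 * Z.of_nat l) - 32 * Z.of_nat l * p * (- u / p))%Z; [ring|]. rewrite <- Huv. ring. }
    exists (Z.to_nat x). intros _. rewrite Z2Nat.id by lia. split; [|exact Dx].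
    assert (x <> 0)%Z.
    { intros E. rewrite E, Z.mul_0_r in Dx. apply Z.divide_pos_le in Dx; lia. }
    unfold p in *. lia. }
  pose (sg l := if excluded_middle_informative (0 < l < P)%nat then proj1_sig (constructive_indefinite_description _ (Ex l)) else l).
  assert (S1 : forall l, (0 < l < P)%nat -> (0 < sg l < P)%nat /\ (p | 32 * Z.of_nat l * Z.of_nat (sg l) + 1)%Z).
  { intros l Hl. unfold sg. destruct (excluded_middle_informative (0 < l < P)%nat) as [Hl'|]; [|tauto].
    destruct (constructive_indefinite_description _ (Ex l)) as [l' H']. now apply H'. }
  exists sg. split; [|split].
  - unfold sg. destruct (excluded_middle_informative (0 < 0 < P)%nat); [lia|reflexivity].
  - intros l Hl. destruct l as [|l].
    + assert (sg O = O) as E0.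
      { unfold sg. destruct (excluded_middle_informative (0 < 0 < P)%nat); [lia|reflexivity]. }
      rewrite !E0. lia.
    + destruct (S1 (S l) ltac:(lia)) as [B1 D1]. split; [lia|]. destruct (S1 (sg (S l)) B1) as [B2 D2].
      set (a := sg (S l)) in *. set (b := sg a) in *.
      assert (D : (p | 32 * Z.of_nat a * (Z.of_nat b - Z.of_nat (S l)))%Z).
      { replace (32 * Z.of_nat a * (Z.of_nat b - Z.of_nat (S l)))%Z with
          ((32 * Z.of_nat a * Z.of_nat b + 1) - (32 * Z.of_nat (S l) * Z.of_nat a + 1))%Z by ring.
        now apply Z.divide_sub_r. }
      apply Gauss in D; [|apply rel_prime_sym, R32; unfold p; lia].
      destruct D as [t Ht]. unfold p in Ht. assert (t = 0)%Z by nia. nia.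
  - intros l Hl. destruct (S1 l Hl) as [B D]. split; [lia|exact D].
Qed.

(** [W2] exchanges the term [l = 0] of the sum with the term [f (P z)], and permutes the remaining
    terms by [sg]. *)
Lemma hecke_W (b : bool) eps (P : nat) f : (eps * eps = 1)%R -> prime (Z.of_nat P) -> Z.of_nat P <> 2%Z ->
  Tinv b f -> Winv eps f -> Winv eps (hecke_p 2 4 (Z.of_nat P) f).
Proof.
  intros He Hp Hp2 HT HW z Hz. pose proof (prime_ge_2 _ Hp) as Hge.
  assert (HP : (0 < P)%nat) by lia.
  assert (HR : (0 < INR P)%R) by now apply lt_0_INR.
  assert (HC : RtoC (INR P) <> 0) by (apply RtoC_neq0; lra).
  pose proof (UHP_neq0 z Hz) as Hz0.
  rewrite !heckeE by assumption. destruct (inverse_mod P Hp Hp2) as (sg & S0 & S1 & S2).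
  destruct P as [|P']; [lia|]. set (P := S P') in *.
  pose (g l := f (RtoC (/ INR P) * (z + 4 * INR l))).
  assert (E0 : f (RtoC (/ INR P) * (- / (2 * z) + 4 * INR 0)) = RtoC eps * (2 * z * z) * (INR P * INR P * f (INR P * z))).
  { replace (RtoC (/ INR P) * (- / (2 * z) + 4 * INR 0)) with (- / (2 * (INR P * z))).
    - rewrite HW by now apply UHP_scal. ring.
    - change (INR 0) with 0%R. rewrite RtoC_inv by lra. field. split; assumption. }
  assert (EV : f (INR P * - / (2 * z)) = RtoC eps * (2 * z * z) * (/ (INR P * INR P) * g O)).
  { replace (INR P * - / (2 * z)) with (- / (2 * (RtoC (/ INR P) * z))).
    - rewrite HW by (apply UHP_scal; [now apply Rinv_0_lt_compat|assumption]). unfold g. change (INR 0) with 0%R.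
      replace (z + 4 * 0) with z by ring. set (w := f _). rewrite RtoC_inv by lra. field. assumption.
    - rewrite RtoC_inv by lra. field. split; assumption. }
  assert (El : forall l, (l < P)%nat -> (0 < l)%nat ->
     f (RtoC (/ INR P) * (- / (2 * z) + 4 * INR l)) = RtoC eps * (2 * z * z) * g (sg l)).
  { intros l Hl Hl0. destruct (S2 l ltac:(lia)) as [Hs [t Ht]]. set (l' := sg l) in *.
    (* [G] carries the point of index [l'] over [z] to the point of index [l] over the image of [z]
       under [W2]. The factors [8] make the exponent of the character divisible by [4], so only the
       sign [eps] is left. *)
    pose (G := Mat (8 * Z.of_nat l) (- t) (2 * Z.of_nat P) (- (8 * Z.of_nat l'))).
    assert (HdG : mdet G = 2%Z).
    { unfold G, mdet; cbn [ma mb mc md].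
      transitivity (2 * (t * Z.of_nat P) - 64 * Z.of_nat l * Z.of_nat l')%Z; [ring|]. rewrite <- Ht. ring. }
    assert (HG : in_GammaStar2 G).
    { right. split; [exact HdG|]. unfold G; cbn [ma mb mc md].
      split; [exists (4 * Z.of_nat l)%Z; ring|]. split; [exists (Z.of_nat P); ring|exists (- (4 * Z.of_nat l'))%Z; ring]. }
    set (y := RtoC (/ INR P) * (z + 4 * INR l')).
    assert (Hy : UHP y).
    { apply UHP_scal; [now apply Rinv_0_lt_compat|]. rewrite <- RtoC_mult. now apply UHP_shift. }
    pose proof (GammaStar_form b eps f He HT HW G HG y Hy) as Q.
    rewrite slash2E, HdG in Q by lia. rewrite chiE, HdG in Q. change (2 =? 1)%Z with false in Q. cbv iota in Q.
    replace (ich b (mc G / 2 * (ma G / 2 + md G / 2))) with (RtoC 1) in Q.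
    2:{ rewrite <- (ich_0 b). apply ich_mod. unfold G; cbn [ma mc md].
        replace (- (8 * Z.of_nat l'))%Z with (- (4 * Z.of_nat l') * 2)%Z by ring.
        replace (8 * Z.of_nat l)%Z with (4 * Z.of_nat l * 2)%Z by ring.
        rewrite (Z.mul_comm 2), !Z.div_mul by lia.
        replace (Z.of_nat P * (4 * Z.of_nat l + - (4 * Z.of_nat l')))%Z with (0 + Z.of_nat P * (Z.of_nat l - Z.of_nat l') * 4)%Z by ring.
        now rewrite Z.mod_add by lia. }
    assert (Eaut : aut G y = 2 * z).
    { unfold aut, G, y; cbn [mc md]. rewrite opp_IZR, !mult_IZR, <- !INR_IZR_INZ, RtoC_opp, !RtoC_mult, RtoC_inv by lra.
      field. assumption. }
    assert (Emact : mact G y = RtoC (/ INR P) * (- / (2 * z) + 4 * INR l)).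
    { unfold mact. fold (aut G y). rewrite Eaut. unfold G, y; cbn [ma mb].
      assert (Et : RtoC (IZR t) * INR P = 32 * INR l * INR l' + 1).
      { rewrite <- !RtoC_mult, <- RtoC_plus. f_equal. rewrite !INR_IZR_INZ, <- !mult_IZR, <- plus_IZR. f_equal. now rewrite Ht. }
      rewrite opp_IZR, mult_IZR, <- INR_IZR_INZ, RtoC_opp, RtoC_mult, RtoC_inv by lra.
      replace (RtoC (IZR t)) with ((32 * INR l * INR l' + 1) / INR P) by (rewrite <- Et; field; assumption).
      field. split; assumption. }
    rewrite Eaut, Emact in Q.
    replace (f (RtoC (/ INR P) * (- / (2 * z) + 4 * INR l))) with
      ((2 * z * z) * (2 * / (2 * z * (2 * z)) * f (RtoC (/ INR P) * (- / (2 * z) + 4 * INR l)))).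
    - rewrite Q. unfold g. fold y. ring.
    - set (w := f _). field. assumption. }
  assert (CS : forall F, csum F P = F O + csum (fun k => F (S k)) P') by (intros F; apply csum_S_l).
  rewrite (CS (fun l => f (RtoC (/ INR P) * (- / (2 * z) + 4 * INR l)))).
  rewrite (csum_ext (fun k => f (RtoC (/ INR P) * (- / (2 * z) + 4 * INR (S k)))) (fun k => RtoC eps * (2 * z * z) * g (sg (S k)))).
  2:{ intros k Hk. apply El; unfold P; lia. }
  rewrite E0, EV, csum_scal. change (fun l => f (RtoC (/ INR P) * (z + 4 * INR l))) with g.
  rewrite <- (csum_involution g sg P) by exact S1. rewrite (CS (fun l => g (sg l))), S0.
  set (Sm := csum (fun k => g (sg (S k))) P'). field. assumption.
Qed.

(** * Coefficients of the Hecke operators of prime power index *)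

Fixpoint Hcn (p : Z) (c : Z -> C) (n : nat) : Z -> C :=
  match n with
  | O => c
  | S n' => match n' with
    | O => Hc p c
    | S n'' => fun m => Hc p (Hcn p c n') m + - IZR p * Hcn p c n'' m
    end
  end.

(* With [U : c(n) -> c(pn)] and [V : c(n) -> c(n/p)] this is [T(p^(n+1)) = U^(n+1) + p V T(p^n)], a consequence
   of [U V = 1]. *)
Lemma Hcn_S p c n m : (0 < p)%Z ->
  Hcn p c (S n) m = c (p ^ Z.of_nat (S n) * m)%Z + IZR p * (if (m mod p =? 0)%Z then Hcn p c n (m / p)%Z else 0).
Proof.
  intros Hp. revert m. induction n as [|n IH]; intros m.
  - change (Hcn p c 1 m) with (Hc p c m). unfold Hc. now rewrite Z.pow_1_r.
  - change (Hcn p c (S (S n)) m) with (Hc p (Hcn p c (S n)) m + - IZR p * Hcn p c n m). unfold Hc at 1.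
    rewrite (IH (p * m)%Z). rewrite (Z.mul_comm p m), Z.mod_mul, Z.div_mul, Z.eqb_refl by lia.
    replace (p ^ Z.of_nat (S n) * (m * p))%Z with (p ^ Z.of_nat (S (S n)) * m)%Z.
    + ring.
    + rewrite (Nat2Z.inj_succ (S n)), Z.pow_succ_r by lia. ring.
Qed.

(** Induction through [Hcn_S]. The [U] part contributes nothing in nonpositive degree, as a multiple
    of [p] is never [-1]; the [V] part moves the pole from [- q] to [- p q] and multiplies it by
    [p]. *)
Lemma Hcn_low p (c : Z -> C) n m : (1 < p)%Z -> (forall k : Z, (k <= 0)%Z -> c k = if (k =? - (1))%Z then 1 else 0) ->
  (m <= 0)%Z -> Hcn p c n m = if (m =? - p ^ Z.of_nat n)%Z then RtoC (IZR (p ^ Z.of_nat n)) else 0.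
Proof.
  intros Hp Hc. revert m. induction n as [|n IH]; intros m Hm.
  - simpl. now apply Hc.
  - rewrite Hcn_S by lia. rewrite Nat2Z.inj_succ, Z.pow_succ_r by lia.
    assert (Hpp : (0 < p ^ Z.of_nat n)%Z) by (apply Z.pow_pos_nonneg; lia).
    set (q := (p ^ Z.of_nat n)%Z) in *.
    assert (Hpq : (2 <= p * q)%Z) by nia.
    assert (Hm1 : (p * q * m <> - (1))%Z).
    { set (x := (p * q)%Z) in *. intros Z0. assert (m = 0 \/ m <= -1)%Z as [-> | Hm'] by lia; [lia|nia]. }
    rewrite Hc by nia. rewrite (proj2 (Z.eqb_neq _ _) Hm1). rewrite Cplus_0_l.
    destruct (Z.eqb_spec (m mod p) 0) as [E|E].
    + pose proof (Z.div_mod m p ltac:(lia)) as Q. rewrite E, Z.add_0_r in Q. set (k := (m / p)%Z) in *.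
      rewrite IH by nia. destruct (Z.eqb_spec k (- q)) as [Ek|Ek].
      * rewrite (proj2 (Z.eqb_eq _ _)) by (rewrite Q, Ek; ring). now rewrite mult_IZR, RtoC_mult.
      * rewrite (proj2 (Z.eqb_neq _ _)) by nia. ring.
    + rewrite (proj2 (Z.eqb_neq _ _)); [ring|]. intros Z0. apply E. rewrite Z0.
      replace (- (p * q))%Z with (- q * p)%Z by ring. apply Z.mod_mul. lia.
Qed.

(** The [V] part is absent because [p] does not divide [1]. For sign [-1] this coefficient is the
    multiple of [h2] in (c). *)
Lemma Hcn_1 p c n : (1 < p)%Z -> Hcn p c n 1 = c (p ^ Z.of_nat n)%Z.
Proof.
  intros Hp. destruct n as [|n]; [reflexivity|]. rewrite Hcn_S, Z.mod_1_l by lia.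
  change (1 =? 0)%Z with false. rewrite Z.mul_1_r. ring.
Qed.

(** Multiplying [m] by [p^n] treats both classes of [p^n] modulo [4] at once; the [V] part preserves
    the condition because [p^2 = 1] modulo [4]. *)
Lemma Hcn_supp p (c : Z -> C) n : (0 < p)%Z -> ((p * p) mod 4 = 1)%Z ->
  (forall k : Z, (k mod 4 <> 3)%Z -> c k = 0) -> forall m, ((m * p ^ Z.of_nat n) mod 4 <> 3)%Z -> Hcn p c n m = 0.
Proof.
  intros Hp Hpp Hc. induction n as [|n IH]; intros m Hm.
  - simpl in *. apply Hc. now rewrite Z.mul_1_r in Hm.
  - rewrite Hcn_S by assumption. rewrite Hc by now rewrite Z.mul_comm.
    destruct (Z.eqb_spec (m mod p) 0) as [E|E]; [|ring].
    pose proof (Z.div_mod m p ltac:(lia)) as Q. rewrite E, Z.add_0_r in Q.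
    rewrite IH; [ring|]. intros Z0. apply Hm.
    rewrite Nat2Z.inj_succ, Z.pow_succ_r by lia. rewrite Q.
    replace (p * (m / p) * (p * p ^ Z.of_nat n))%Z with (p * p * (m / p * p ^ Z.of_nat n))%Z by ring.
    now rewrite Z.mul_mod, Hpp, Z0 by lia.
Qed.

Lemma qexp_Tinv (b : bool) f c : has_qexp 4 f c ->
  (forall n : Z, (n mod 4 <> if b then 1 else 3)%Z -> c n = 0) -> Tinv b f.
Proof.
  intros H Hs z Hz. apply has_qexpE in H. destruct H as [N [_ H]].
  pose proof (H (z + 1) (UHP_shift z 1 Hz)) as H1. specialize (H z Hz). apply (clim_scal (ich b 1)) in H.
  refine (clim_unique _ _ _ H1 _). eapply clim_ext; [|exact H]. intros M. cbv beta. rewrite <- csum_scal. apply csum_ext.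
  intros m _. set (n := (Z.of_nat m - Z.of_nat N)%Z).
  destruct (Z.eq_dec (n mod 4) (if b then 1 else 3)%Z) as [E|E]; [|rewrite Hs by exact E; ring].
  rewrite qpow_zplus. replace ((INR m - INR N) / 4)%R with (IZR n / 4)%R
    by (unfold n; rewrite minus_IZR, <- !INR_IZR_INZ; reflexivity).
  rewrite qpow_quarter. assert (ipow n = ich b 1) as ->; [|ring].
  rewrite <- ipow_mod, E. destruct b; simpl; [reflexivity|].
  unfold ipow; simpl. unfold Cconj, Copp, Defs.Ci; simpl. f_equal; ring.
Qed.

Lemma odd_pow_mod4 p n : ((p * p) mod 4 = 1)%Z -> ((p ^ Z.of_nat n) mod 4 = 1 \/ (p ^ Z.of_nat n) mod 4 = 3)%Z.
Proof.
  intros Hp. assert (p mod 4 = 1 \/ p mod 4 = 3)%Z as H.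
  { rewrite Z.mul_mod in Hp by lia. pose proof (Z.mod_pos_bound p 4 ltac:(lia)) as B.
    assert (p mod 4 = 0 \/ p mod 4 = 1 \/ p mod 4 = 2 \/ p mod 4 = 3)%Z as [E|[E|[E|E]]] by lia;
      rewrite E in *; auto; discriminate. }
  induction n as [|n IH]; [now left|]. rewrite Nat2Z.inj_succ, Z.pow_succ_r by lia. rewrite Z.mul_mod by lia.
  destruct H as [-> | ->], IH as [-> | ->]; auto.
Qed.

Lemma mod4_mul_3 m q : (q mod 4 = 1 -> (m * q) mod 4 = m mod 4)%Z /\
  (q mod 4 = 3 -> m mod 4 <> 1 -> (m * q) mod 4 <> 3)%Z.
Proof.
  rewrite Z.mul_mod by lia. split; intros ->.
  - now rewrite Z.mul_1_r, Z.mod_mod by lia.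
  - pose proof (Z.mod_pos_bound m 4 ltac:(lia)). intros H0 H1.
    assert (m mod 4 = 0 \/ m mod 4 = 2 \/ m mod 4 = 3)%Z as [E|[E|E]] by lia; rewrite E in H1; discriminate.
Qed.

Lemma hecke_pn_form p n eps f c : prime p -> p <> 2%Z -> (eps * eps = 1)%R -> ((p * p) mod 4 = 1)%Z ->
  has_qexp 4 f c -> (forall k : Z, (k mod 4 <> 3)%Z -> c k = 0) -> Winv eps f ->
  has_qexp 4 (hecke_pn 2 4 p n f) (Hcn p c n) /\ Winv eps (hecke_pn 2 4 p n f).
Proof.
  intros Hp Hp2 He Hpp Hq Hs HW. pose proof (prime_ge_2 p Hp) as Hge.
  assert (Step : forall k g, has_qexp 4 g (Hcn p c k) -> Winv eps g ->
    has_qexp 4 (hecke_p 2 4 p g) (Hc p (Hcn p c k)) /\ Winv eps (hecke_p 2 4 p g)).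
  { intros k g Hg HWg. assert (Ep : p = Z.of_nat (Z.to_nat p)) by (rewrite Z2Nat.id; lia).
    remember (Z.to_nat p) as P eqn:EP. clear EP. subst p. split.
    - apply hecke_qexp; [lia|assumption].
    (* Each application of [T(p)] with [p = 3] modulo [4] exchanges the two conjugate characters, so
       the one obeyed here depends on [p^k] modulo [4]. *)
    - assert (exists b, Tinv b g) as [b HT].
      { destruct (odd_pow_mod4 (Z.of_nat P) k Hpp) as [E|E].
        - exists false. apply (qexp_Tinv false g _ Hg). intros m Hm. apply Hcn_supp; try assumption; [lia|].
          now rewrite (proj1 (mod4_mul_3 m _) E).
        - exists true. apply (qexp_Tinv true g _ Hg). intros m Hm. apply Hcn_supp; try assumption; [lia|].
          now apply (proj2 (mod4_mul_3 m _) E). }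
      now apply (hecke_W b). }
  (* The recursion reaches back two steps, so two consecutive indices are carried along. *)
  assert (Both : forall k, (has_qexp 4 (hecke_pn 2 4 p k f) (Hcn p c k) /\ Winv eps (hecke_pn 2 4 p k f)) /\
     (has_qexp 4 (hecke_pn 2 4 p (S k) f) (Hcn p c (S k)) /\ Winv eps (hecke_pn 2 4 p (S k) f))).
  { induction k as [|k [[A1 A2] [B1 B2]]].
    - split; [split; assumption|]. exact (Step O f Hq HW).
    - split; [split; assumption|]. destruct (Step (S k) _ B1 B2) as [C1 C2].
      assert (E : hecke_pn 2 4 p (S (S k)) f = (fun z => hecke_p 2 4 p (hecke_pn 2 4 p (S k) f) z + - IZR p * hecke_pn 2 4 p k f z)).
      { apply functional_extensionality. intros z.
        change (hecke_pn 2 4 p (S (S k)) f z) with (hecke_p 2 4 p (hecke_pn 2 4 p (S k) f) z - RtoC (Rpower (IZR p) (INR 2 - 1)) * hecke_pn 2 4 p k f z).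
        replace (INR 2 - 1)%R with 1%R by (simpl; ring). rewrite Rpower_1 by (apply (IZR_lt 0); lia). ring. }
      rewrite E. split.
      + apply (has_qexp_lin _ _ _ _ (- IZR p) C1 A1).
      + now apply Winv_lin. }
  apply Both.
Qed.

(* The principal parts of [f1 | T(p^n)] and [p^n g] cancel. *)
Lemma hecke_difference (b : bool) eps p n f1 a1 g (r L : Z) a : prime p -> p <> 2%Z -> (eps * eps = 1)%R ->
  is_form 1 3 1 (chi false eps) f1 a1 -> ((p * p) mod 4 = 1)%Z ->
  (- p ^ Z.of_nat n mod 4 = r)%Z -> (1 <= L)%Z ->
  is_form (p ^ Z.of_nat n) r L (chi b eps) g a ->
  let c := qcoef 1 3 1 a1 in
  let q := RtoC (IZR (p ^ Z.of_nat n)) in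
  (forall L' : nat, (Z.of_nat L' mod 4 = r)%Z -> (L' <= 4)%nat ->
    qser (INR L' / 4) (fun z => hecke_pn 2 4 p n f1 z + - q * g z)
      (fun k => Hcn p c n (Z.of_nat L' + 4 * Z.of_nat k) + - q * qcoef (p ^ Z.of_nat n) r L a (Z.of_nat L' + 4 * Z.of_nat k)))
  /\ Winv eps (fun z => hecke_pn 2 4 p n f1 z + - q * g z).
Proof.
  intros Hp Hp2 He [W1 Q1] Hpp Hr HL [Wg Qg] c q. pose proof (prime_ge_2 p Hp) as Hge.
  assert (HD : (0 < p ^ Z.of_nat n)%Z) by (apply Z.pow_pos_nonneg; lia).
  assert (Hs : forall k : Z, (k mod 4 <> 3)%Z -> c k = 0) by (intros k Hk; apply qcoef_supp; [lia|lia|reflexivity|assumption]).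
  destruct (hecke_pn_form p n eps f1 c Hp Hp2 He Hpp Q1 Hs (form_Winv _ _ _ W1)) as [K1 K2].
  split; [|apply Winv_lin; [assumption|eapply form_Winv; eassumption]].
  intros L' HL' HL4.
  assert (Z0 : forall m : Z, (m mod 4 <> r)%Z -> Hcn p c n m + - q * qcoef (p ^ Z.of_nat n) r L a m = 0).
  { intros m Hm. rewrite (qcoef_supp _ r) by assumption. rewrite Hcn_supp; [ring|lia|assumption|assumption|].
    destruct (odd_pow_mod4 p n Hpp) as [E|E].
    - rewrite (proj1 (mod4_mul_3 m _) E). rewrite Z.mod_opp_l_nz, E in Hr by lia. now subst r.
    - apply (proj2 (mod4_mul_3 m _) E). rewrite Z.mod_opp_l_nz, E in Hr by lia. now subst r. }
  apply (qexp_qser _ (fun m => Hcn p c n m + - q * qcoef (p ^ Z.of_nat n) r L a m)).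
  - now apply has_qexp_lin.
  - intros m Hm. destruct (Z_lt_le_dec 0 m) as [Hm0|Hm0].
    + apply Z0. intros E. rewrite <- HL' in E. rewrite Z.mod_small in E by lia.
      destruct (Nat.eq_dec L' 4) as [->|]; [change (Z.of_nat 4 mod 4)%Z with 0%Z in E; lia|].
      rewrite Z.mod_small in E by lia. lia.
    + rewrite Hcn_low, qcoef_low by (try lia; intros k Hk; unfold c; rewrite qcoef_low by lia; reflexivity).
      fold q. destruct (m =? - p ^ Z.of_nat n)%Z; ring.
  - intros m Hm. apply Z0. now rewrite <- HL'.
Qed.

Lemma Cminus_eq0 (x y : C) : x + - y = 0 -> x = y.
Proof. intros H. replace x with (x + - y + y) by ring. rewrite H. ring. Qed.

Theorem theorem4p1 :
  (* (a) *)
  (forall d : Z, (0 < d)%Z -> (d mod 4 = 1)%Z ->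
     unique_on_UHP (fun f => exists a, is_form d 3 1 (nubar 1) f a) /\
     unique_on_UHP (fun f => exists a, is_form d 3 1 (nubar (-1)) f a)) /\
  (* (b) *)
  (forall d : Z, (0 < d)%Z -> (d mod 4 = 3)%Z ->
     unique_on_UHP (fun f => exists a, is_form d 1 1 (nu 1) f a) /\
     unique_on_UHP (fun f => exists a, is_form d 1 5 (nu (-1)) f a)) /\
  (* (c) *)
  (forall (p : Z) (n : nat), prime p -> p <> 2%Z -> (1 <= n)%nat ->
     (forall f1 a1 g b, is_fplus 1 f1 a1 -> is_fplus (p ^ Z.of_nat n) g b ->
        forall z, UHP z ->
          hecke_pn 2 4 p n f1 z = (RtoC (IZR (p ^ Z.of_nat n)) * g z)%C) /\
     (((p ^ Z.of_nat n) mod 4 = 1)%Z ->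
        forall f1 a1 g b, is_fminus 1 f1 a1 -> is_fminus (p ^ Z.of_nat n) g b ->
        forall z, UHP z ->
          hecke_pn 2 4 p n f1 z = (RtoC (IZR (p ^ Z.of_nat n)) * g z)%C) /\
     (((p ^ Z.of_nat n) mod 4 = 3)%Z ->
        forall f1 a1 g b, is_fminus 1 f1 a1 -> is_fminus (p ^ Z.of_nat n) g b ->
        forall z, UHP z ->
          hecke_pn 2 4 p n f1 z =
          (RtoC (IZR (p ^ Z.of_nat n)) * g z + a1 (p ^ Z.of_nat n)%Z * h2 z)%C)).
Proof.
  assert (Neg : forall d, (d mod 4 = 1 \/ d mod 4 = 3 -> - d mod 4 = 4 - d mod 4)%Z).
  { intros d Hd. apply Z.mod_opp_l_nz; lia. }
  assert (e1 : (1 * 1 = 1)%R) by ring. assert (em : (-1 * -1 = 1)%R) by ring.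
  split; [|split].
  - intros d Hd Hd4. assert (Hr : (- d mod 4 = 3)%Z) by (rewrite Neg, Hd4 by auto; reflexivity).
    pose (j := Z.to_nat (d / 4)). pose proof (Z.div_mod d 4 ltac:(lia)) as Q. rewrite Hd4 in Q.
    assert (Hj : d = (4 * Z.of_nat j + 1)%Z) by (unfold j; rewrite Z2Nat.id by (apply Z.div_pos; lia); exact Q).
    assert (Hrho : (- (1 / 4) - INR j = - IZR d / 4)%R).
    { rewrite Hj, plus_IZR, mult_IZR, <- INR_IZR_INZ. field. }
    assert (A : forall s : R, (s * s = 1)%R -> unique_on_UHP (fun f => exists a, is_form d 3 1 (chi false s) f a)).
    (* [base1] with parameter [- s] has sign [s] under [W2]. *)
    { intros s Hs. destruct (qser_base1 (- s)) as (c & C0 & HB).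
      pose proof (base1_W (- s) ltac:(lra)) as HW. rewrite Ropp_involutive in HW.
      destruct (exists_form false s d 3 1 _ _ c j Hs Hd ltac:(lia) eq_refl Hr HB C0 HW Hrho ltac:(lia)) as (f & a & Hf).
      exists f. split; [now exists a|]. intros g [a' Hg] z Hz.
      refine (form_unique false s d 3 3 f g a a' Hs Hd Hr eq_refl ltac:(lia) (or_introl (Nat.le_refl 3)) 1 ltac:(lia) _ Hf Hg z Hz).
      intros m Hm. rewrite Z.mod_small by lia. lia. }
    split; [exact (A 1%R e1)|exact (A (-1)%R em)].
  - intros d Hd Hd4. assert (Hr : (- d mod 4 = 1)%Z) by (rewrite Neg, Hd4 by auto; reflexivity).
    pose (j := Z.to_nat (d / 4)). pose proof (Z.div_mod d 4 ltac:(lia)) as Q. rewrite Hd4 in Q.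
    assert (Hj : d = (4 * Z.of_nat j + 3)%Z) by (unfold j; rewrite Z2Nat.id by (apply Z.div_pos; lia); exact Q).
    assert (Hd' : IZR d = (4 * INR j + 3)%R) by (rewrite Hj, plus_IZR, mult_IZR, <- INR_IZR_INZ; reflexivity).
    split.
    + destruct qser_base3 as (c & C0 & HB).
      destruct (exists_form true 1 d 1 1 _ _ c j e1 Hd ltac:(lia) eq_refl Hr HB C0 base3_W ltac:(rewrite Hd'; field) ltac:(lia)) as (f & a & Hf).
      exists f. split; [now exists a|]. intros g [a' Hg] z Hz.
      refine (form_unique true 1 d 1 1 f g a a' e1 Hd Hr eq_refl ltac:(lia) (or_intror (conj eq_refl eq_refl)) 1 ltac:(lia) _ Hf Hg z Hz).
      intros m Hm. lia.
    (* The seed is [h2] itself, with one step more than for sign [+1]: clearing up to [S j] includes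
       the coefficient of [q^(1/4)], so the first free exponent is [5]. *)
    + destruct qser_h2 as (c & C0 & HB).
      destruct (exists_form true (-1) d 1 5 _ _ c (S j) em Hd ltac:(lia) eq_refl Hr HB C0 h2_W ltac:(rewrite Hd', S_INR; field) ltac:(lia)) as (f & a & Hf).
      exists f. split; [now exists a|]. intros g [a' Hg] z Hz.
      refine (form_unique true (-1) d 1 5 f g a a' em Hd Hr eq_refl ltac:(lia) (or_introl _) 5 ltac:(lia) _ Hf Hg z Hz).
      * lia.
      * intros m Hm. lia.
  - intros p n Hp Hp2 Hn. pose proof (prime_ge_2 p Hp) as Hge.
    assert (Hpp : ((p * p) mod 4 = 1)%Z).
    { apply odd_mod4. destruct (Z.Even_or_Odd p) as [[k Hk]|Ho]; [|exact Ho]. exfalso.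
      assert (2 | p)%Z as D by (exists k; lia). apply prime_divisors in D; [|assumption]. lia. }
    assert (HD : (0 < p ^ Z.of_nat n)%Z) by (apply Z.pow_pos_nonneg; lia).
    assert (Case1 : forall eps f1 a1 g b, (eps * eps = 1)%R -> ((p ^ Z.of_nat n) mod 4 = 1)%Z ->
      is_form 1 3 1 (chi false eps) f1 a1 -> is_form (p ^ Z.of_nat n) 3 1 (chi false eps) g b -> forall z, UHP z ->
      hecke_pn 2 4 p n f1 z = RtoC (IZR (p ^ Z.of_nat n)) * g z).
    { intros eps f1 a1 g b He E F1 Fg z Hz.
      assert (Hr : (- p ^ Z.of_nat n mod 4 = 3)%Z) by (rewrite Neg, E by auto; reflexivity).
      destruct (hecke_difference false eps p n f1 a1 g 3 1 b Hp Hp2 He F1 Hpp Hr ltac:(lia) Fg) as [QS HW].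
      specialize (QS 3%nat eq_refl ltac:(lia)). apply Cminus_eq0.
      rewrite <- (vanish_qser _ eps _ _ QS ltac:(simpl; lra) He HW z Hz). ring. }
    split; [|split].
    + intros f1 a1 g b F1 Fg z Hz. unfold is_fplus in F1, Fg. change (1 mod 4 =? 1)%Z with true in F1. cbv iota in F1.
      destruct (odd_pow_mod4 p n Hpp) as [E|E]; rewrite E in Fg.
      * exact (Case1 1%R f1 a1 g b e1 E F1 Fg z Hz).
      * change (3 =? 1)%Z with false in Fg. cbv iota in Fg.
        assert (Hr : (- p ^ Z.of_nat n mod 4 = 1)%Z) by (rewrite Neg, E by auto; reflexivity).
        destruct (hecke_difference true 1 p n f1 a1 g 1 1 b Hp Hp2 e1 F1 Hpp Hr ltac:(lia) Fg) as [QS HW].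
        (* The difference may start at [q^(1/4)]; sign [+1] allows [vanish_plus]. *)
        specialize (QS 1%nat eq_refl ltac:(lia)). apply Cminus_eq0.
        rewrite <- (vanish_plus _ _ QS HW z Hz). ring.
    + intros E f1 a1 g b F1 Fg z Hz. unfold is_fminus in F1, Fg. change (1 mod 4 =? 1)%Z with true in F1. cbv iota in F1.
      rewrite E in Fg. exact (Case1 (-1)%R f1 a1 g b em E F1 Fg z Hz).
    + intros E f1 a1 g b F1 Fg z Hz. unfold is_fminus in F1, Fg. change (1 mod 4 =? 1)%Z with true in F1. cbv iota in F1.
      rewrite E in Fg. change (3 =? 1)%Z with false in Fg. cbv iota in Fg.
      assert (Hr : (- p ^ Z.of_nat n mod 4 = 1)%Z) by (rewrite Neg, E by auto; reflexivity).
      destruct (hecke_difference true (-1) p n f1 a1 g 1 5 b Hp Hp2 em F1 Hpp Hr ltac:(lia) Fg) as [QS HW].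
      specialize (QS 1%nat eq_refl ltac:(lia)).
      destruct qser_h2 as (ch & Ch0 & Hh).
      set (q := (p ^ Z.of_nat n)%Z) in *.
      (* Since [g] has no term in [q^(1/4)], that coefficient of the difference is [a1 q].
         Subtracting [a1 q * h2] removes it, and the remainder starts at [q^(5/4)]. *)
      pose proof (qser_plus _ _ _ _ _ (qser_rho (INR 1 / 4) (1 / 4) _ _ ltac:(simpl; field) QS) (qser_scal _ (- a1 q) _ _ Hh)) as QT.
      apply qser_drop in QT.
      * assert (HW' : Winv (-1) (fun z => hecke_pn 2 4 p n f1 z + - IZR q * g z + - a1 q * h2 z)) by (apply Winv_lin; [exact HW|exact h2_W]).
        pose proof (vanish_qser _ (-1) _ _ QT ltac:(lra) em HW' z Hz) as V. cbv beta in V.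
        apply Cminus_eq0. rewrite <- V. ring.
      * cbv beta. change (Z.of_nat 1 + 4 * Z.of_nat 0)%Z with 1%Z. rewrite Ch0, Hcn_1 by lia. fold q.
        rewrite (qcoef_low q) by lia. rewrite (proj2 (Z.eqb_neq 1 (- q))) by lia.
        unfold qcoef. rewrite (proj2 (Z.eqb_neq q (- (1)))) by lia. rewrite E, (proj2 (Z.leb_le 1 q)) by lia.
        change (3 =? 3)%Z with true. simpl andb. cbv iota. ring.
Qed.
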